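(* Let $d \ge 1$ and let $f$ be a probability density on $\mathbb{R}^d$ with $\int f^5 < \infty$. Let $(r_n)$ be a sequence of positive reals with $r_n \to 0$ and $\lim_{n\to\infty} n^{3/2} r_n^d = \infty$. For each $n$, let $X_1,\ldots,X_n$ be i.i.d. with density $f$ and let $G_n$ be the random geometric graph on vertex set $[n]=\{1,\ldots,n\}$ in which $\{i,j\}$ ($i\neq j$) is an edge iff $\|X_i - X_j\| \le r_n$ (Euclidean norm). Then there exists an estimator $\Delta_n$ of $d$, computed from the adjacency matrix of $G_n$ alone (without knowledge of $d$, $f$, $r_n$ or the $X_i$), such that $\Delta_n \to d$ in probability as $n \to \infty$. *)

(* Defs.v *)
From HB Require Import structures.
From mathcomp Require Import all_boot all_order all_algebra.
From mathcomp Require Import all_classical all_reals all_analysis.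
Set Implicit Arguments. Unset Strict Implicit. Unset Printing Implicit Defensive.
Import Order.TTheory GRing.Theory Num.Theory.
Import numFieldNormedType.Exports.
Local Open Scope classical_set_scope.
Local Open Scope ring_scope.

(* Points of R^d are d-tuples of reals, with the product (= Borel) sigma-algebra
   generated by the coordinate projections (library instance on n.-tuple T). *)

(* Integral over R^d w.r.t. d-dimensional Lebesgue measure, written as the
   iterated Lebesgue integral over the coordinates (by Tonelli this is the
   Lebesgue integral on R^d for nonnegative measurable integrands, the only
   ones used below). *)
Fixpoint int_Rd (R : realType) (d : nat) : (d.-tuple R -> \bar R) -> \bar R :=
  match d return (d.-tuple R -> \bar R) -> \bar R with
  | 0 => fun g => g [tuple]
  | d'.+1 => fun g =>
      (\int[@lebesgue_measure R]_x int_Rd (fun t : d'.-tuple R => g (cons_tuple x t)))%E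
  end.

Definition edist (R : realType) (d : nat) (x y : d.-tuple R) : R :=
  Num.sqrt (\sum_(k < d) (tnth x k - tnth y k) ^+ 2).

Definition is_density (R : realType) (d : nat) (f : d.-tuple R -> R) : Prop :=
  measurable_fun setT f /\ (forall x, 0 <= f x) /\
  int_Rd (fun x => (f x)%:E) = 1%E.

Definition has_density (R : realType) (d0 : measure_display) (T : measurableType d0)
  (P : probability T R) (d : nat) (X : T -> d.-tuple R) (f : d.-tuple R -> R) : Prop :=
  measurable_fun setT X /\
  forall B : set (d.-tuple R), measurable B ->
    P (X @^-1` B) = int_Rd (fun x => (f x * \1_B x)%:E).

Definition mutually_independent (R : realType) (d0 : measure_display)
  (T : measurableType d0) (P : probability T R) (d n : nat)
  (X : 'I_n -> T -> d.-tuple R) : Prop :=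
  forall B : 'I_n -> set (d.-tuple R), (forall i, measurable (B i)) ->
    P [set w | forall i, B i (X i w)] = (\prod_(i < n) P (X i @^-1` B i))%E.

Definition rgg_adj (R : realType) (d n : nat) (x : 'I_n -> d.-tuple R) (r : R)
  : 'M[bool]_n :=
  \matrix_(i < n, j < n) ((i != j) && (edist (x i) (x j) <= r)).

(* Main.v *)
Require Import Defs.
From HB Require Import structures.
From mathcomp Require Import all_boot all_order all_algebra.
From mathcomp Require Import all_classical all_reals all_analysis.
From mathcomp Require Import measurable_realfun.
From mathcomp Require Import ring lra zify.
Set Implicit Arguments.
Unset Strict Implicit.
Unset Printing Implicit Defensive.
Import Order.TTheory GRing.Theory Num.Theory.
Import numFieldNormedType.Exports.
Local Open Scope classical_set_scope.
Local Open Scope ring_scope.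

(* In the geometric graph, the proportion of cherries (two edges sharing a vertex) that
   close up to a triangle tends to [alpha], the probability that two independent uniform
   points of the unit ball lie at distance at most 1. By rotation invariance and by slicing
   the lens cut out by two unit balls, [alpha] in dimension [k.+1] equals
   [(\int m^k.+1 w^k) / (\int w^k)] on [0, 1], where [w t = sqrt (1 - t^2)] and
   [m t = min 1 (2 t)]. As [m <= 1] increases and [w] decreases, Chebyshev's correlation
   inequality makes [alpha] strictly decreasing, so the dimension can be read off the
   empirical ratio.
   The expected counts are asymptotic to [n^3 r^(2d) \int f^3]: AM-GM bounds them above, and
   the continuity of translations below. For the concentration, two triples with a common
   vertex and [m] vertices in total (3 <= m <= 5) occur together only if these [m] points
   form a star of radius [2r], which has probability O(r^(d(m-1)) \int f^m); the variance
   over the squared mean is then O(1/(n^3 r^(2d)) + 1/(n^2 r^d) + 1/n). *)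

(** * Lebesgue measure on tuples *)

(** The factor [n^3 r^(2d) \int f^3] cannot be observed, but it is common to both counts, so their
    quotient leaves only [alpha], which depends on the dimension alone. The hypothesis that
    [n^(3/2) r^d] diverges says, after squaring, that [n^3 r^(2d)], the order of the expected
    counts, diverges. The fifth moment is the price of [m = 5], two triples sharing a single vertex;
    together with [\int f = 1] it controls the moments in between. The density is only measurable,
    so the lower bound on the expected counts cannot use continuity of [f]. Translations are shown
    to be continuous in measure for every measurable set, and [f] is then truncated and rounded to
    finitely many levels. Strict monotonicity gives each value of [alpha] a window disjoint from the
    others. The windows may shrink as the dimension grows, but [d] is fixed while [n] tends to
    infinity, so an integer-valued estimator equals [d] exactly with probability tending to 1. *)

Section measurable_integral.
Context d1 d2 (T1 : measurableType d1) (T2 : measurableType d2) (R : realType).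
Local Open Scope ereal_scope.

Lemma measurable_integral_snd (m : {sigma_finite_measure set T2 -> \bar R})
    (g : T1 -> T2 -> \bar R) :
  measurable_fun setT (fun p : T1 * T2 => g p.1 p.2) -> (forall x y, 0 <= g x y) ->
  measurable_fun setT (fun x => \int[m]_y g x y).
Proof.
by move=> mg g0; exact: (measurable_fun_fubini_tonelli_F (m2 := m) _ mg).
Qed.

Lemma integral_swap (m1 : {sigma_finite_measure set T1 -> \bar R})
    (m2 : {sigma_finite_measure set T2 -> \bar R}) (g : T1 -> T2 -> \bar R) :
  measurable_fun setT (fun p : T1 * T2 => g p.1 p.2) -> (forall x y, 0 <= g x y) ->
  \int[m1]_x \int[m2]_y g x y = \int[m2]_y \int[m1]_x g x y.
Proof.
by move=> mg g0; exact: (fubini_tonelli _ mg).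
Qed.

End measurable_integral.

Section power_measure.
Context d (T : measurableType d) (R : realType).
Variable mu : {sigma_finite_measure set T -> \bar R}.

Definition tcons n (p : T * n.-tuple T) : n.+1.-tuple T := cons_tuple p.1 p.2.
Definition tuncons n (x : n.+1.-tuple T) : T * n.-tuple T :=
  (thead x, [tuple of behead x]).

Lemma measurable_tcons n : measurable_fun setT (@tcons n).
Proof. exact: measurable_cons. Qed.

Lemma measurable_tuncons n : measurable_fun setT (@tuncons n).
Proof.
apply/measurable_fun_pairP; split; last exact: measurable_behead.
by apply: measurable_tnth.
Qed.

Lemma tconsK n : cancel (@tcons n) (@tuncons n).
Proof.
case=> x t; rewrite /tuncons theadE; congr pair.
by apply/val_inj.
Qed.

HB.instance Definition _ n :=
  isMeasurableFun.Build _ _ _ _ (@tcons n) (@measurable_tcons n).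

Section step.
Variables (n : nat) (nu : {sigma_finite_measure set (n.-tuple T) -> \bar R}).

Definition cons_measure : set (n.+1.-tuple T) -> \bar R :=
  pushforward (mu \x nu)%E (@tcons n).

Let cons_measure0 : cons_measure set0 = 0%E.
Proof. by rewrite /cons_measure /pushforward preimage_set0 measure0. Qed.

Let cons_measure_ge0 A : (0 <= cons_measure A)%E.
Proof. exact: measure_ge0. Qed.

Let cons_measure_sigma_additive : semi_sigma_additive cons_measure.
Proof. by apply: measure_semi_sigma_additive; exact: measurable_tcons. Qed.

HB.instance Definition _ := isMeasure.Build _ _ _ cons_measure
  cons_measure0 cons_measure_ge0 cons_measure_sigma_additive.

Lemma cons_measure_sigma_finite : sigma_finite setT cons_measure.
Proof.
have /sigma_finiteP[F [TF ndF Foo]] := sigma_finiteT mu.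
have /sigma_finiteP[G [TG ndG Goo]] := sigma_finiteT nu.
(* Both exhausting sequences are increasing, so the diagonal products already cover everything: a
   point enters at the larger of its two indices. *)
exists (fun k => @tuncons n @^-1` (F k `*` G k)).
  rewrite -preimage_bigcup; apply/esym/seteqP; split=> // x _.
  have [i _ Fx] : (\bigcup_i F i) (tuncons x).1 by rewrite -TF.
  have [j _ Gx] : (\bigcup_i G i) (tuncons x).2 by rewrite -TG.
  exists (maxn i j) => //; split.
    by apply: (subsetPset _ _ (ndF _ _ _)) Fx; exact: leq_maxl.
  by apply: (subsetPset _ _ (ndG _ _ _)) Gx; exact: leq_maxr.
move=> k; have [mF Fk] := Foo k; have [mG Gk] := Goo k; split.
  rewrite -[X in measurable X]setTI; apply: measurable_tuncons => //.
  exact: measurableX.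
rewrite /cons_measure /pushforward.
rewrite (_ : _ @^-1` _ = F k `*` G k).
  by rewrite product_measure1E// lte_mul_pinfty// ge0_fin_numE.
by rewrite -comp_preimage (_ : _ \o _ = id)//; apply/funext => p; exact: tconsK.
Qed.

HB.instance Definition _ := Measure_isSigmaFinite.Build _ _ _ cons_measure
  cons_measure_sigma_finite.
End step.

(** Used with two base measures: Lebesgue measure, which gives [leb], and the law [Q] of one sample
    point, which gives the law of several independent points. *)
Fixpoint powm n : {sigma_finite_measure set (n.-tuple T) -> \bar R} :=
  match n return {sigma_finite_measure set (n.-tuple T) -> \bar R} with
  | 0 => @dirac _ (0.-tuple T) [tuple] R
  | n'.+1 => cons_measure (powm n')
  end.

Local Open Scope ereal_scope.

Lemma integral_powm0 (g : 0.-tuple T -> \bar R) : (forall x, 0 <= g x) ->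
  measurable_fun setT g ->
  \int[powm 0]_x g x = g [tuple].
Proof. by move=> g0 mg; rewrite integral_dirac//= diracT mul1e. Qed.

Lemma measurable_fun_tcons n (g : n.+1.-tuple T -> \bar R) :
  measurable_fun setT g ->
  measurable_fun setT (fun p : T * n.-tuple T => g (cons_tuple p.1 p.2)).
Proof. by move=> mg; apply: (measurableT_comp mg); exact: measurable_tcons. Qed.

Lemma measurable_integral_cons n (g : n.+1.-tuple T -> \bar R) : (forall x, 0 <= g x) ->
  measurable_fun setT g ->
  measurable_fun setT (fun x => \int[powm n]_t g (cons_tuple x t)).
Proof.
move=> g0 mg.
apply: (measurable_fun_fubini_tonelli_F (m2 := powm n)
  (fun p : T * n.-tuple T => g (cons_tuple p.1 p.2))) => //.
exact: measurable_fun_tcons.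
Qed.

Lemma integral_powmS n (g : n.+1.-tuple T -> \bar R) : (forall x, 0 <= g x) ->
  measurable_fun setT g ->
  \int[powm n.+1]_x g x = \int[mu]_x \int[powm n]_t g (cons_tuple x t).
Proof.
move=> g0 mg.
rewrite /= /cons_measure (ge0_integral_pushforward (@measurable_tcons n))//=.
by rewrite fubini_tonelli1//=; exact: measurable_fun_tcons.
Qed.

Lemma measurable_box n (B : 'I_n -> set T) : (forall i, measurable (B i)) ->
  measurable [set x : n.-tuple T | forall i, B i (tnth x i)].
Proof.
move=> mB.
rewrite (_ : [set x | _] = \bigcap_(i in [set: 'I_n]) ((@tnth _ T ^~ i) @^-1` B i)).
  apply: fin_bigcap_measurable => // i _.
  by rewrite -[X in measurable X]setTI; exact: measurable_tnth.
by apply/seteqP; split=> x h i => [_|]; exact: h.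
Qed.

Lemma powm_box n (B : 'I_n -> set T) : (forall i, measurable (B i)) ->
  powm n [set x | forall i, B i (tnth x i)] = \prod_(i < n) mu (B i).
Proof.
elim: n B => [|n IH] B mB.
  rewrite big_ord0 /= (_ : [set x | _] = setT) ?diracT//.
  by apply/seteqP; split=> x //= _ [].
rewrite big_ord_recl /= /cons_measure /pushforward.
rewrite (_ : _ @^-1` _ = B ord0 `*` [set x : n.-tuple T | forall i, B (lift ord0 i) (tnth x i)]).
  rewrite product_measure1E; [|exact: mB|].
    by congr (_ * _); apply: (IH (fun i => B (lift ord0 i))) => i; exact: mB.
  by apply: (measurable_box (B := fun i => B (lift ord0 i))) => i; exact: mB.
apply/seteqP; split=> [[x t]/= h|[x t]/= [h0 h] i].
  split; first exact: (h ord0).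
  by move=> i; have := h (lift ord0 i); rewrite /tcons/= tnthS.
case: (unliftP ord0 i) => [j ->|-> //].
by rewrite tnthS; exact: h.
Qed.

End power_measure.

(** * Affine changes of variables *)

Section push_measure.
Context d1 d2 (T1 : measurableType d1) (T2 : measurableType d2) (R : realType).
Variables (m : {measure set T1 -> \bar R}) (f : T1 -> T2).
Hypothesis mf : measurable_fun setT f.

(** The proof of measurability is an argument so that the measure structure, which depends on it,
    can be attached to the term. *)
Definition push_measure of measurable_fun setT f : set T2 -> \bar R :=
  pushforward m f.

Let push_measure0 : push_measure mf set0 = 0%E.
Proof. by rewrite /push_measure /pushforward preimage_set0 measure0. Qed.

Let push_measure_ge0 A : (0 <= push_measure mf A)%E.
Proof. exact: measure_ge0. Qed.

Let push_measure_sigma_additive : semi_sigma_additive (push_measure mf).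
Proof. exact: measure_semi_sigma_additive. Qed.

HB.instance Definition _ := isMeasure.Build _ _ _ (push_measure mf)
  push_measure0 push_measure_ge0 push_measure_sigma_additive.
End push_measure.

Section affine.
Context (R : realType).
Notation mu := (@lebesgue_measure R).
Notation RR := (measurableTypeR R).
Local Open Scope ereal_scope.

Lemma measurable_affine (c b : R) :
  measurable_fun setT (fun x : RR => (c * x + b)%R : RR).
Proof. by apply: measurable_funD => //; exact: measurable_funM. Qed.

(** The rescaled image measure has the right value on half-open intervals, and these determine
    Lebesgue measure. *)
Lemma lebesgue_affine (c b : R) (A : set RR) : (0 < c)%R -> measurable A ->
  c%:E * mu ((fun x => (c * x + b)%R) @^-1` A) = mu A.
Proof.
move=> c0 mA.
have c0' : (0 <= c)%R by exact: ltW.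
pose nu : {measure set RR -> \bar R} :=
  mscale (NngNum c0') (push_measure mu (measurable_affine c b)).
suff h : forall X, ocitv X -> mu X = nu X.
  by rewrite [RHS](lebesgue_measure_unique h).
move=> _ [[p q]] _ <-.
rewrite /nu/= /mscale /push_measure /pushforward/=.
rewrite (_ : _ @^-1` _ = `](p - b) / c, (q - b) / c]%classic)%R.
  rewrite !lebesgue_measure_itv/= !lte_fin ltr_pM2r ?invr_gt0// ltrD2r.
  case: ifPn => pq; last by rewrite mule0.
  rewrite -!EFinB -EFinM; congr (_%:E).
  by field; rewrite gt_eqF.
apply/seteqP; split => x /=; rewrite !in_itv/= ltr_pdivrMr// ler_pdivlMr// => /andP[h1 h2]; apply/andP; split; lra.
Qed.

Lemma integral_affine_pos (c b : R) (g : RR -> \bar R) : (0 < c)%R ->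
  measurable_fun setT g -> (forall x, 0 <= g x) ->
  c%:E * \int[mu]_x g (c * x + b)%R = \int[mu]_x g x.
Proof.
move=> c0 mg g0.
have c0' : (0 <= c)%R by exact: ltW.
transitivity (\int[mscale (NngNum c0') (push_measure mu (measurable_affine c b))]_x g x); last first.
  apply: eq_measure_integral => A mA _.
  exact: (lebesgue_affine b c0 mA).
rewrite ge0_integral_mscale//=; congr (_ * _).
by rewrite (ge0_integral_pushforward (measurable_affine c b)).
Qed.

Lemma integral_opp (g : RR -> \bar R) :
  measurable_fun setT g -> (forall x, 0 <= g x) ->
  \int[mu]_x g (- x)%R = \int[mu]_x g x.
Proof.
move=> mg g0.
have mN : measurable_fun setT (fun x : RR => (- x)%R : RR) by exact: measurable_funN.
transitivity (\int[push_measure mu mN]_x g x).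
  by rewrite (ge0_integral_pushforward mN).
by apply: eq_measure_integral => A mA _; exact: lebesgue_measureN.
Qed.

Lemma integral_affine (c b : R) (g : RR -> \bar R) : c != 0%R ->
  measurable_fun setT g -> (forall x, 0 <= g x) ->
  `|c|%R%:E * \int[mu]_x g (c * x + b)%R = \int[mu]_x g x.
Proof.
move=> c0 mg g0; have [c_lt0|c_gt0|/eqP] := ltgtP c 0%R; last by rewrite (negbTE c0).
- rewrite ltr0_norm// -(@integral_opp (fun x => g (c * x + b)%R))//; last first.
    by apply: (measurableT_comp mg); exact: measurable_affine.
  rewrite -[RHS](@integral_affine_pos (- c)%R b)// ?oppr_gt0//.
  by under eq_integral do rewrite mulrN -mulNr.
- by rewrite gtr0_norm// integral_affine_pos.
Qed.

End affine.

Section lebR.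
Context (R : realType).
Local Open Scope ereal_scope.

(* [lebesgue_measure] lives on [measurableTypeR R], whose display differs from that of
   the measurable structure of [R] used by the tuples. *)
Definition lebR : set R -> \bar R := @lebesgue_measure R.

Let lebR0 : lebR set0 = 0.
Proof. exact: (@measure0 _ _ _ (@lebesgue_measure R)). Qed.

Let lebR_ge0 A : 0 <= lebR A.
Proof. exact: (@measure_ge0 _ _ _ (@lebesgue_measure R)). Qed.

Let lebR_sigma_additive : semi_sigma_additive lebR.
Proof. exact: (@measure_semi_sigma_additive _ _ _ (@lebesgue_measure R)). Qed.

HB.instance Definition _ := isMeasure.Build _ _ _ lebR
  lebR0 lebR_ge0 lebR_sigma_additive.

Let lebR_sigma_finite : sigma_finite setT lebR.
Proof. exact: (@sigma_finiteT _ _ _ (@lebesgue_measure R)). Qed.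

HB.instance Definition _ := Measure_isSigmaFinite.Build _ _ _ lebR
  lebR_sigma_finite.

Lemma measurable_fun_RR : measurable_fun setT (id : measurableTypeR R -> R).
Proof. by []. Qed.

Lemma integral_lebR (g : R -> \bar R) :
  measurable_fun setT g -> (forall x, 0 <= g x) ->
  \int[lebR]_x g x = \int[@lebesgue_measure R]_x g x.
Proof.
move=> mg g0.
transitivity (\int[push_measure (@lebesgue_measure R) measurable_fun_RR]_x g x).
  exact: eq_measure_integral.
by rewrite (ge0_integral_pushforward measurable_fun_RR).
Qed.

Lemma lebR_affine (c b : R) (g : R -> \bar R) : c != 0%R ->
  measurable_fun setT g -> (forall x, 0 <= g x) ->
  `|c|%R%:E * \int[lebR]_x g (c * x + b)%R = \int[lebR]_x g x.
Proof.
move=> c0 mg g0; rewrite !integral_lebR//; first exact: integral_affine.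
by apply: (measurableT_comp mg); apply: measurable_funD => //; exact: measurable_funM.
Qed.

End lebR.

(** * Lebesgue measure in dimension d *)

Section leb.
Context (R : realType).
Notation mu := (@lebR R).
Local Open Scope ereal_scope.

Definition leb d : {sigma_finite_measure set (d.-tuple R) -> \bar R} :=
  powm mu d.

Lemma measurable_section_cons d (g : d.+1.-tuple R -> \bar R) (x : R) :
  measurable_fun setT g ->
  measurable_fun setT (fun t : d.-tuple R => g (cons_tuple x t)).
Proof.
move=> mg; apply: (measurableT_comp mg).
by apply: (measurable_cons (f := fun=> x)); [exact: measurable_cst|exact: measurable_id].
Qed.

Lemma integral_lebS d (g : d.+1.-tuple R -> \bar R) : measurable_fun setT g ->
  (forall x, 0 <= g x) ->
  \int[leb d.+1]_x g x = \int[mu]_x \int[leb d]_t g (cons_tuple x t).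
Proof. by move=> mg g0; rewrite /leb integral_powmS. Qed.

Lemma integral_leb0 (g : 0.-tuple R -> \bar R) : measurable_fun setT g ->
  (forall x, 0 <= g x) -> \int[leb 0]_x g x = g [tuple].
Proof. by move=> mg g0; rewrite /leb (integral_powm0 mu). Qed.

(** Bridge from the iterated integral of the statement to a genuine measure, for which Tonelli and
    monotone convergence are available. *)
Lemma int_RdE d (g : d.-tuple R -> \bar R) : measurable_fun setT g ->
  (forall x, 0 <= g x) -> int_Rd g = \int[leb d]_x g x.
Proof.
elim: d g => [|d IH] g mg g0; first by rewrite /leb (integral_powm0 mu).
rewrite [LHS]/=.
rewrite /leb integral_powmS// integral_lebR//; first last.
- by move=> x; exact: integral_ge0.
- exact: measurable_integral_cons.
by apply: eq_integral => x _; rewrite IH//; exact: measurable_section_cons.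
Qed.

(** One map for three uses: translation ([c = 1]), dilation ([a = 0]), and the passage from [u] to
    the point at offset [r u] from a sample point. *)
Definition taff d (a : d.-tuple R) (c : R) (u : d.-tuple R) : d.-tuple R :=
  [tuple (tnth a i + c * tnth u i)%R | i < d].

Lemma measurable_taff d (a : d.-tuple R) (c : R) :
  measurable_fun setT (taff a c : d.-tuple R -> d.-tuple R).
Proof.
apply/measurable_fun_tnthP => i.
rewrite (_ : _ \o _ = fun u => (tnth a i + c * tnth u i)%R); last first.
  by apply/funext => u /=; rewrite tnth_mktuple.
apply: measurable_funD => //; apply: measurable_funM => //.
exact: measurable_tnth.
Qed.

Lemma taff_cons d (a b : R) (s t : d.-tuple R) (c : R) :
  taff (cons_tuple a s) c (cons_tuple b t) = cons_tuple (a + c * b)%R (taff s c t).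
Proof.
apply: eq_from_tnth => i; rewrite tnth_mktuple.
by case: (unliftP ord0 i) => [j ->|->]; rewrite ?tnthS ?tnth0// tnth_mktuple.
Qed.

Lemma integral_taff d (a : d.-tuple R) (c : R) (g : d.-tuple R -> \bar R) :
  (0 < c)%R -> measurable_fun setT g -> (forall x, 0 <= g x) ->
  (c ^+ d)%:E * \int[leb d]_x g (taff a c x) = \int[leb d]_x g x.
Proof.
move=> c0; elim: d a g => [|d IH] a g mg g0.
  rewrite expr0 mul1e /leb !(integral_powm0 mu)//.
    by rewrite (tuple0 (taff a c [tuple])).
  by apply: (measurableT_comp mg); exact: measurable_taff.
have mga : measurable_fun setT (fun x => g (taff a c x)).
  by apply: (measurableT_comp mg); exact: measurable_taff.
rewrite /leb !integral_powmS//.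
have m1 x : measurable_fun setT (fun t : d.-tuple R => g (cons_tuple x t)).
  exact: measurable_section_cons.
rewrite exprS EFinM -muleA -ge0_integralZl//=; first last.
- by rewrite lee_fin exprn_ge0// ltW.
- by move=> x _; apply: integral_ge0.
- exact: (@measurable_integral_cons _ _ _ mu d (fun x => g (taff a c x))).
case/tupleP: a mga => a1 a mga.
under eq_integral => x _.
  under eq_integral do rewrite taff_cons.
  rewrite (IH a (fun t => g (cons_tuple (a1 + c * x)%R t)))//.
  over.
have h0 x : 0 <= \int[leb d]_t g (cons_tuple x t) by exact: integral_ge0.
have mh : measurable_fun setT (fun x => \int[leb d]_t g (cons_tuple x t)).
  exact: measurable_integral_cons.
have c1 : c != 0%R by rewrite gt_eqF.
rewrite -[RHS](@lebR_affine _ c a1 _ c1 mh h0) (gtr0_norm c0); congr (_ * _).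
by apply: eq_integral => x _; rewrite addrC.
Qed.

End leb.

Ltac mfun := repeat first
  [ solve [exact: measurable_cst | exact: measurable_id | exact: measurable_fst
          | exact: measurable_snd | exact: measurable_tnth | assumption]
  | apply: measurable_funD | apply: measurable_funB | apply: measurable_funM
  | apply: measurable_funX | apply: measurable_funN
  | apply: measurable_fun_pair ].

(** * Rotation invariance *)

Section rotation.
Context (R : realType).
Notation mu := (@lebR R).
Local Open Scope ereal_scope.

Lemma lebR_opp (g : R -> \bar R) :
  measurable_fun setT g -> (forall x, 0 <= g x) ->
  \int[mu]_x g (- x)%R = \int[mu]_x g x.
Proof.
move=> mg g0; rewrite -(@lebR_affine _ (-1) 0 g)// normrN1 mul1e.
by under [RHS]eq_integral do rewrite mulN1r addr0.
Qed.

Lemma lebR_sqrt_sqr (h : R * R -> \bar R) (a : R) :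
  measurable_fun setT h -> (forall x, 0 <= h x) ->
  \int[mu]_y h (y ^+ 2, a * y)%R = \int[mu]_y h (y ^+ 2, Num.sqrt (a ^+ 2) * y)%R.
Proof.
move=> mh h0; rewrite sqrtr_sqr.
have [//|a0] := ger0P a.
rewrite -lebR_opp//; last by apply: (measurableT_comp mh); mfun.
by under eq_integral do rewrite sqrrN mulrN -mulNr.
Qed.

(** The rotation taking [(a, b)] to the first axis, with cosine [c] and sine [s], factors into two
    affine substitutions in one variable each: [x] is replaced by [u = c x + s y], then [y] by [v]
    with [y = c v + s u]. Their Jacobians [1/|c|] and [|c|] cancel. *)
Lemma rotation_plane (h : R * R -> \bar R) (a b : R) :
  measurable_fun setT h -> (forall x, 0 <= h x) ->
  \int[mu]_x \int[mu]_y h (x ^+ 2 + y ^+ 2, a * x + b * y)%R =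
  \int[mu]_x \int[mu]_y h (x ^+ 2 + y ^+ 2, Num.sqrt (a ^+ 2 + b ^+ 2) * x)%R.
Proof.
move=> mh h0.
have mhab : measurable_fun setT (fun p : R * R => h (p.1 ^+ 2 + p.2 ^+ 2, a * p.1 + b * p.2)%R).
  by apply: (measurableT_comp mh); mfun.
rewrite (@integral_swap _ _ _ _ _ mu mu
  (fun x y => h (x ^+ 2 + y ^+ 2, a * x + b * y)%R) mhab (fun x y => h0 _)).
(* Here the cosine would vanish and the substitutions break down; exchanging the axes, with a
   reflection if [b < 0], replaces them. *)
have [->|a0] := eqVneq a 0%R.
  rewrite expr0n add0r sqrtr_sqr /=.
  have [b0|b0] := ger0P b.
    by apply: eq_integral => y _; apply: eq_integral => x _; rewrite mul0r add0r addrC.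
  rewrite -[LHS]lebR_opp; first last.
  - by move=> x; exact: integral_ge0.
  - apply: measurable_integral_snd => //.
    by apply: (measurableT_comp mh); mfun.
  apply: eq_integral => y _; apply: eq_integral => x _.
  by rewrite mul0r add0r addrC sqrrN mulrN -mulNr.
set rho := Num.sqrt _.
have rho2 : (rho ^+ 2 = a ^+ 2 + b ^+ 2)%R.
  by rewrite sqr_sqrtr// addr_ge0// sqr_ge0.
have rho0 : rho != 0%R.
  rewrite -sqrf_eq0 rho2 gt_eqF// ltr_pwDl ?sqr_ge0//.
  by rewrite lt0r sqr_ge0 sqrf_eq0 a0.
pose c := (a / rho)%R; pose s := (b / rho)%R.
have cs : (c ^+ 2 + s ^+ 2 = 1)%R.
  by rewrite /c /s !expr_div_n -mulrDl -rho2 divff// sqrf_eq0.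
have c0 : c != 0%R by rewrite mulf_neq0// invr_eq0.
pose G (p : R * R) := h ((((c^-1 * p.1 - s / c * p.2) ^+ 2 + p.2 ^+ 2)%R), (rho * p.1)%R).
have mG : measurable_fun setT G by apply: (measurableT_comp mh); mfun.
have G0 p : 0 <= G p by exact: h0.
transitivity (\int[mu]_y (`|c^-1|%R%:E * \int[mu]_u G (u, y))).
  apply: eq_integral => y _.
  rewrite -(@lebR_affine _ (c^-1) (- (s / c * y))%R
    (fun x => h ((x ^+ 2 + y ^+ 2)%R, (a * x + b * y)%R))) ?invr_eq0//; last first.
    by apply: (measurableT_comp mh); mfun.
  congr (_ * _); apply: eq_integral => u _; rewrite /G/=.
  congr (h (_, _))%R.
  have -> : (a = rho * c)%R by rewrite /c mulrCA divff// mulr1.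
  have -> : (b = rho * s)%R by rewrite /s mulrCA divff// mulr1.
  by field.
have m1 : measurable_fun setT (fun y => \int[mu]_u G (u, y)).
  by apply: measurable_integral_snd => //; apply: (measurableT_comp mG); mfun.
rewrite ge0_integralZl//; last by move=> y _; exact: integral_ge0.
rewrite -(integral_swap mu mu (g := fun u y => G (u, y)))//.
transitivity (`|c^-1|%R%:E * (`|c|%R%:E * \int[mu]_u \int[mu]_v h (u ^+ 2 + v ^+ 2, rho * u)%R)); last first.
  by rewrite muleA -EFinM -normrM mulVf// normr1 mul1e.
congr (_ * _); rewrite -ge0_integralZl//; first last.
- by move=> x _; exact: integral_ge0.
- apply: measurable_integral_snd => //.
  by apply: (measurableT_comp mh); mfun.
apply: eq_integral => u _.
rewrite -(@lebR_affine _ c (s * u)%R (fun y => G (u, y)))//; last first.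
  by apply: (measurableT_comp mG); mfun.
congr (_ * _); apply: eq_integral => v _; rewrite /G/=; congr (h (_, _)).
have -> : (c^-1 * u - s / c * (c * v + s * u) = c * u - s * v)%R.
  have {1}-> : u = ((c ^+ 2 + s ^+ 2) * u)%R by rewrite cs mul1r.
  by field.
transitivity ((c ^+ 2 + s ^+ 2) * (u ^+ 2 + v ^+ 2))%R; last by rewrite cs mul1r.
by ring.
Qed.

End rotation.

Section euclid.
Context (R : realType).
Notation mu := (@lebR R).

Definition nrm2 d (x : d.-tuple R) : R := \sum_(i < d) tnth x i ^+ 2.
Definition dot d (x y : d.-tuple R) : R := \sum_(i < d) tnth x i * tnth y i.

Lemma nrm2_ge0 d (x : d.-tuple R) : 0 <= nrm2 x.
Proof. by apply: sumr_ge0 => i _; exact: sqr_ge0. Qed.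

Lemma nrm2_cons d (a : R) (x : d.-tuple R) : nrm2 (cons_tuple a x) = a ^+ 2 + nrm2 x.
Proof.
rewrite /nrm2 big_ord_recl tnth0; congr (_ + _).
by apply: eq_bigr => i _; rewrite tnthS.
Qed.

Lemma dot_cons d (a b : R) (x y : d.-tuple R) :
  dot (cons_tuple a x) (cons_tuple b y) = a * b + dot x y.
Proof.
rewrite /dot big_ord_recl !tnth0; congr (_ + _).
by apply: eq_bigr => i _; rewrite !tnthS.
Qed.

Lemma nrm2_0 (x : 0.-tuple R) : nrm2 x = 0.
Proof. by rewrite /nrm2 big_ord0. Qed.

Lemma dot_0 (x y : 0.-tuple R) : dot x y = 0.
Proof. by rewrite /dot big_ord0. Qed.

Lemma measurable_nrm2 d : measurable_fun setT (@nrm2 d).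
Proof.
by apply: measurable_sum => i; apply: measurable_funX; exact: measurable_tnth.
Qed.

Lemma measurable_dot d (x : d.-tuple R) : measurable_fun setT (dot x).
Proof.
apply: measurable_sum => i; apply: measurable_funM => //; exact: measurable_tnth.
Qed.

Local Open Scope ereal_scope.

(** Lens volumes depend on [y] only through [nrm2 y] and [dot x y], so invariance is needed for
    functions of this pair only. Induction: with the first coordinate [u] fixed, the tail of [x] is
    aligned with the second axis, and a plane rotation then merges the first two axes. *)
Lemma rotation d (x : d.+1.-tuple R) (h : R * R -> \bar R) :
  measurable_fun setT h -> (forall p, 0 <= h p) ->
  \int[leb R d.+1]_y h (nrm2 y, dot x y) =
  \int[leb R d.+1]_y h (nrm2 y, Num.sqrt (nrm2 x) * thead y)%R.
Proof.
have mh1 n (k : R * R -> \bar R) (z : n.-tuple R) : measurable_fun setT k ->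
    measurable_fun setT (fun y : n.-tuple R => k (nrm2 y, dot z y)).
  move=> mk; apply: (measurableT_comp mk); apply: measurable_fun_pair.
    exact: measurable_nrm2.
  exact: measurable_dot.
have mh2 n (k : R * R -> \bar R) (c : R) : measurable_fun setT k ->
    measurable_fun setT (fun y : n.+1.-tuple R => k (nrm2 y, c * thead y)%R).
  move=> mk; apply: (measurableT_comp mk); apply: measurable_fun_pair.
    exact: measurable_nrm2.
  by apply: measurable_funM => //; exact: measurable_tnth.
elim: d x h => [|d IH] x h mh h0.
  case/tupleP: x => a x.
  rewrite !integral_lebS; [|exact: mh2|by []|exact: mh1|by []].
  transitivity (\int[mu]_y h (y ^+ 2, a * y)%R).
    apply: eq_integral => y _; rewrite (integral_powm0 mu)//.
      by rewrite nrm2_cons dot_cons nrm2_0 dot_0 !addr0.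
    by apply: (measurable_section_cons (g := fun y => h (nrm2 y, dot (cons_tuple a x) y))); exact: mh1.
  rewrite lebR_sqrt_sqr//; apply: eq_integral => y _; rewrite (integral_powm0 mu)//.
    by rewrite !nrm2_cons !nrm2_0 !addr0 theadE.
  by apply: (measurable_section_cons (g := fun y => h (nrm2 y, Num.sqrt (nrm2 (cons_tuple a x)) * thead y)%R)); exact: mh2.
case/tupleP: x => a x.
rewrite !integral_lebS; [|exact: mh2|by []|exact: mh1|by []].
(* Integrating out the coordinates beyond the first two leaves a function on the plane, to which
   [rotation_plane] applies. *)
pose H (p : R * R) := \int[leb R d]_t h (p.1 + nrm2 t, p.2)%R.
have mH' : measurable_fun setT (fun q : (R * R) * d.-tuple R => h (q.1.1 + nrm2 q.2, q.1.2)%R).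
  apply: (measurableT_comp mh); apply: measurable_fun_pair.
    apply: measurable_funD.
      by apply: measurableT_comp.
    by apply: measurableT_comp => //; exact: measurable_nrm2.
  by apply: measurableT_comp.
have mH : measurable_fun setT H by exact: measurable_integral_snd.
have H0 p : 0 <= H p by exact: integral_ge0.
transitivity (\int[mu]_u \int[mu]_v H (u ^+ 2 + v ^+ 2, a * u + Num.sqrt (nrm2 x) * v)%R).
  apply: eq_integral => u _.
  pose h' (p : R * R) := h (u ^+ 2 + p.1, a * u + p.2)%R.
  have mh' : measurable_fun setT h' by apply: (measurableT_comp mh); mfun.
  have h1 p : 0 <= h' p by exact: h0.
  transitivity (\int[leb R d.+1]_y h' (nrm2 y, dot x y)).
    by apply: eq_integral => y _; rewrite nrm2_cons dot_cons.
  rewrite IH//; rewrite integral_lebS; [|exact: mh2|by []].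
  apply: eq_integral => v _; apply: eq_integral => t _.
  by rewrite /h'/= nrm2_cons theadE addrA.
rewrite rotation_plane; [|exact: mH|exact: H0].
apply: eq_integral => u _.
rewrite integral_lebS; [|by apply: (measurable_section_cons (g := fun y => h (nrm2 y, Num.sqrt (nrm2 (cons_tuple a x)) * thead y)%R)); exact: mh2|by []].
apply: eq_integral => v _; apply: eq_integral => t _.
rewrite !nrm2_cons theadE addrA sqr_sqrtr ?nrm2_ge0//.
Qed.

End euclid.

Section indicator.
Context (R : realType).
Local Open Scope ereal_scope.

Definition ib (b : bool) : \bar R := (b%:R)%:E.

Lemma ib_ge0 b : 0 <= ib b.
Proof. by rewrite lee_fin ler0n. Qed.

Lemma ibM b c : ib (b && c) = ib b * ib c.
Proof. by case: b c => [] []; rewrite /ib /= -EFinM ?mulr1 ?mulr0 ?mul0r. Qed.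

Lemma ib1 : ib true = 1. Proof. by []. Qed.
Lemma ib0 : ib false = 0. Proof. by []. Qed.

Context d (T : measurableType d).

Lemma measurable_ib (p : T -> bool) : measurable_fun setT p ->
  measurable_fun setT (fun x => ib (p x)).
Proof. by move=> mp; apply: (measurableT_comp (f := ib)). Qed.

Lemma integral_ib (mu : {measure set T -> \bar R}) (p : T -> bool) :
  measurable_fun setT p -> \int[mu]_x ib (p x) = mu [set x | p x].
Proof.
move=> mp; rewrite -[X in mu X]setIT -integral_indic//; last first.
  by rewrite -[X in measurable X]setTI; apply: mp.
apply: eq_integral => x _; rewrite /ib indicE; congr ((nat_of_bool _)%:R%:E).
by apply/idP/idP => [h|]; [exact/mem_set|move/set_mem].
Qed.

End indicator.

Ltac mf := repeat first
  [ solve [exact: measurable_cst | exact: measurable_id | exact: measurable_fst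
          | exact: measurable_snd | exact: measurable_tnth | assumption]
  | apply: measurable_ib | apply: measurable_and | apply: measurable_fun_ler | apply: measurable_fun_ltr
  | apply: emeasurable_funM
  | apply: measurable_funD | apply: measurable_funB | apply: measurable_funM
  | apply: measurable_funX | apply: measurable_funN
  | apply: measurable_fun_pair
  | apply: (measurableT_comp (@measurable_nrm2 _ _))
  | apply: (measurableT_comp (@measurable_dot _ _ _)) ].

(** * Volumes of balls and lenses *)

Section ball_volume.
Context (R : realType).
Notation mu := (@lebR R).
Notation ib := (@ib R).
Local Open Scope ereal_scope.

(** The parameter is the squared radius; a negative one gives the empty ball, so slices at height
    [t] are [q - t ^+ 2] for every [t]. *)
Definition ballvol d (q : R) : \bar R := \int[leb R d]_x ib (nrm2 x <= q)%R.

Lemma ballvol_ge0 d q : 0 <= ballvol d q.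
Proof. by apply: integral_ge0 => x _; exact: ib_ge0. Qed.

Lemma measurable_ballvol d : measurable_fun setT (ballvol d).
Proof.
apply: measurable_integral_snd; last by move=> *; exact: ib_ge0.
by mf.
Qed.

Lemma le_ballvol d q1 q2 : (q1 <= q2)%R -> ballvol d q1 <= ballvol d q2.
Proof.
move=> q12; apply: ge0_le_integral => //; [by move=> *; exact: ib_ge0|by mf|by mf|].
move=> x _; rewrite /ib lee_fin ler_nat.
by case: (leP (nrm2 x) q1) => // h; rewrite (le_trans h q12).
Qed.

Lemma ballvol_neg d (q : R) : (q < 0)%R -> ballvol d q = 0.
Proof.
move=> q0; rewrite /ballvol integral0_eq// => x _.
by rewrite lt_geF// (lt_le_trans q0)// nrm2_ge0.
Qed.

Definition tzero d : d.-tuple R := [tuple 0%R | i < d].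

Lemma nrm2_taff0 d (c : R) (x : d.-tuple R) : nrm2 (taff (tzero d) c x) = (c ^+ 2 * nrm2 x)%R.
Proof.
rewrite /nrm2 big_distrr/=; apply: eq_bigr => i _.
by rewrite !tnth_mktuple add0r exprMn.
Qed.

Lemma ballvol_pos d (c : R) : (0 < c)%R -> ballvol d (c ^+ 2) = (c ^+ d)%:E * ballvol d 1.
Proof.
move=> c0; rewrite {1}/ballvol -(integral_taff (tzero d) c0); first last.
- by move=> x; exact: ib_ge0.
- by mf.
congr (_ * _); apply: eq_integral => x _.
by rewrite nrm2_taff0 -{2}(mulr1 (c ^+ 2)%R) ler_pM2l// exprn_gt0.
Qed.

Lemma ballvolS d q : ballvol d.+1 q = \int[mu]_t ballvol d (q - t ^+ 2)%R.
Proof.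
rewrite /ballvol integral_lebS; [|by mf|by move=> x; exact: ib_ge0].
apply: eq_integral => t _; apply: eq_integral => x _.
by rewrite nrm2_cons; congr (ib _); apply/idP/idP => ?; lra.
Qed.

Lemma ballvol_fin d : ballvol d 1 < +oo.
Proof.
rewrite /ballvol integral_ib; last by mf.
pose C : set (d.-tuple R) := [set x | forall i, `[(-1)%R, 1%R]%classic (tnth x i)].
have mC : measurable C.
  by apply: (@measurable_box _ R d (fun=> `[(-1)%R, 1%R]%classic)) => i; exact: measurable_itv.
have CE : leb R d C = \prod_(i < d) mu `[(-1)%R, 1%R]%classic.
  exact: (powm_box mu (B := fun=> `[(-1)%R, 1%R]%classic)).
apply: (@le_lt_trans _ _ (leb R d C)).
  apply: le_measure; rewrite ?inE.
  - by rewrite -[X in measurable X]setTI; apply: (measurable_fun_ler (measurable_nrm2 (d := d)) (measurable_cst (1%R : R))).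
  - exact: mC.
  move=> x hx i; rewrite set_itvE.
  have : (tnth x i ^+ 2 <= 1)%R.
    apply: le_trans hx; rewrite /nrm2 (bigD1 i)//= lerDl.
    by apply: sumr_ge0 => j _; exact: sqr_ge0.
  by rewrite /= -ler_norml => h; rewrite -(@ler_pXn2r _ 2)// ?nnegrE// expr1n real_normK// num_real.
rewrite CE.
have -> : \prod_(i < d) mu `[(-1)%R, 1%R]%classic = \prod_(i < d) (2%:E : \bar R).
  apply: eq_bigr => i _; rewrite /lebR lebesgue_measure_itv/= lte_fin ifT; last by lra.
  by rewrite -EFinB opprK.
by rewrite prodEFin ltry.
Qed.

Lemma ballvol_fin_num d q : ballvol d q \is a fin_num.
Proof.
rewrite ge0_fin_numE ?ballvol_ge0//.
pose c := (Num.max 1 q)%R.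
have c1 : (1 <= c)%R by rewrite le_max lexx.
apply: (@le_lt_trans _ _ (ballvol d (c ^+ 2))).
  apply: le_ballvol; apply: (@le_trans _ _ c); first by rewrite le_max lexx orbT.
  by rewrite expr2 ler_peMl// (le_trans _ c1).
rewrite ballvol_pos ?(lt_le_trans _ c1)//.
by rewrite lte_mul_pinfty ?ballvol_fin// lee_fin exprn_ge0// (le_trans _ c1).
Qed.

(** By scaling: the point lies in balls of radius [c], of volume at most a constant times [c]. *)
Lemma ballvol_0 d : ballvol d.+1 0 = 0.
Proof.
apply/eqP; rewrite eq_le ballvol_ge0 andbT.
apply/lee_addgt0Pr => e e0; rewrite add0e.
pose W := (1 + fine (ballvol d.+1 1))%R.
have W1 : (1 <= W)%R by rewrite lerDl fine_ge0// ballvol_ge0.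
have W0 : (0 < W)%R by rewrite (lt_le_trans _ W1).
pose c := (Num.min 1 (e / W))%R.
have c0 : (0 < c)%R by rewrite lt_min ltr01 divr_gt0.
apply: (@le_trans _ _ (ballvol d.+1 (c ^+ 2))).
  by apply: le_ballvol; exact: sqr_ge0.
rewrite ballvol_pos// -(fineK (ballvol_fin_num d.+1 1)) -EFinM lee_fin.
apply: (@le_trans _ _ (c * W)%R); last first.
  by rewrite -ler_pdivlMr// ge_min lexx orbT.
apply: ler_pM; [by rewrite exprn_ge0// ltW|by rewrite fine_ge0// ballvol_ge0| |by rewrite lerDr].
by rewrite exprS ler_piMr ?(ltW c0)// exprn_ile1 ?(ltW c0)// ge_min lexx.
Qed.

Lemma ballvolE d (c : R) : (0 <= c)%R -> ballvol d (c ^+ 2) = (c ^+ d)%:E * ballvol d 1.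
Proof.
rewrite le_eqVlt => /predU1P[<-|]; last exact: ballvol_pos.
(* In dimension 0 the space is a single point of mass 1, which matches the convention that the
   zeroth power of 0 is 1. *)
case: d => [|d]; last by rewrite expr0n ballvol_0 exprS mul0r mul0e.
rewrite expr0 mul1e /ballvol; apply: eq_integral => x _.
by rewrite !nrm2_0 expr0n lexx ler01.
Qed.

End ball_volume.

Section lens.
Context (R : realType).
Notation mu := (@lebR R).
Notation ib := (@ib R).
Local Open Scope ereal_scope.

Lemma measurable_sqrtr : measurable_fun setT (@Num.sqrt R).
Proof. by apply: continuous_measurable_fun; exact: sqrt_continuous. Qed.

Lemma lebR_set1 (a : R) : mu [set a] = 0.
Proof. exact: lebesgue_measure_set1. Qed.

Lemma integral_lt_le (c s : R) (g : R -> \bar R) : c != 0%R -> measurable_fun setT g ->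
  (forall x, 0 <= g x) ->
  \int[mu]_t (ib (s < c * t)%R * g t) = \int[mu]_t (ib (s <= c * t)%R * g t).
Proof.
move=> c0 mg g0; apply: ge0_ae_eq_integral => //.
- by mf.
- by mf.
- by move=> t _; rewrite mule_ge0// ib_ge0.
- by move=> t _; rewrite mule_ge0// ib_ge0.
exists [set (s / c)%R]; split; [exact: measurable_set1|exact: lebR_set1|].
move=> t /= h; apply: contrapT => st; apply: h => _.
rewrite lt_neqAle (_ : (s != c * t)%R)//; apply/eqP => E; apply: st.
by rewrite E mulrAC divff// mul1r.
Qed.

(** The distance from [u] to [v] is expanded so that the integrand is a function of [nrm2 v] and
    [dot u v], the form required by [rotation]. *)
Definition lensvol d (u : d.-tuple R) : \bar R :=
  \int[leb R d]_v ib ((nrm2 v <= 1) && (nrm2 u + nrm2 v - 2 * dot u v <= 1))%R.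

(** With [u] on the first axis at distance [s], slice at height [t]. Beyond the bisector [2 t = s]
    only the ball around the origin constrains the slice, before it only the ball around [u]. The
    reflection of [t] into [s - t] exchanges the two halves, whence the factor 2. *)
Lemma lensvolE d (u : d.+1.-tuple R) :
  lensvol u = 2%:E * \int[mu]_t (ib (Num.sqrt (nrm2 u) <= 2 * t)%R * ballvol d (1 - t ^+ 2)%R).
Proof.
set s := Num.sqrt _.
have s0 : (0 <= s)%R by exact: sqrtr_ge0.
have s2 : (nrm2 u = s ^+ 2)%R by rewrite sqr_sqrtr// nrm2_ge0.
pose h (p : R * R) := ib ((p.1 <= 1) && (s ^+ 2 + p.1 - 2 * p.2 <= 1))%R.
have mh : measurable_fun setT h by mf.
have h0 p : 0 <= h p by exact: ib_ge0.
have mb (k : R -> R) : measurable_fun setT k -> measurable_fun setT (fun t => ballvol d (k t)).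
  by move=> mk; apply: (measurableT_comp (@measurable_ballvol R d)).
transitivity (\int[leb R d.+1]_v h (nrm2 v, dot u v)).
  by apply: eq_integral => v _; rewrite /h/= s2.
rewrite rotation// -/s integral_lebS//; last by mf.
transitivity (\int[mu]_t (ib (s <= 2 * t)%R * ballvol d (1 - t ^+ 2)%R +
    ib (2 * t < s)%R * ballvol d (1 - (s - t) ^+ 2)%R)).
  apply: eq_integral => t _.
  under eq_integral => v _ do rewrite /h/= nrm2_cons theadE.
  have [st|ts] := leP s (2 * t)%R; rewrite ?ib1 ?ib0 ?mul1e ?mul0e ?adde0 ?add0e.
  - apply: eq_integral => v _; congr (ib _); apply/andP/idP; first by case; lra.
    move=> h1; split; first lra.
    have := mulr_ge0 s0 (_ : 0 <= 2 * t - s)%R; nra.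
  - apply: eq_integral => v _; congr (ib _); apply/andP/idP; first by case; nra.
    by move=> h1; split; nra.
rewrite ge0_integralD//; first last.
- by mf; apply: mb; mf.
- by move=> t _; rewrite mule_ge0 ?ib_ge0 ?ballvol_ge0.
- by mf; apply: mb; mf.
- by move=> t _; rewrite mule_ge0 ?ib_ge0 ?ballvol_ge0.
rewrite -[X in _ + X](@lebR_affine _ (-1) s)//; first last.
- by move=> t; rewrite mule_ge0 ?ib_ge0 ?ballvol_ge0.
- by mf; apply: mb; mf.
rewrite normrN1 mul1e.
under [X in _ + X]eq_integral => t _.
  rewrite (_ : s - (-1 * t + s) = t)%R; last by ring.
  rewrite (_ : (2 * (-1 * t + s) < s) = (s < 2 * t))%R; last by apply/idP/idP => ?; lra.
  over.
rewrite integral_lt_le//; first last.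
- by move=> t; exact: ballvol_ge0.
- by apply: mb; mf.
by rewrite (_ : 2%:E = 1 + 1)// ge0_muleDl// mul1e.
Qed.

(* [sqrt (1 - t^2)] is the radius of the slice of the unit ball at height [t]. *)
Definition slice_radius (t : R) : R := (Num.sqrt (1 - t ^+ 2))%R.
(** Radius of the set of centres [u] of the unit ball for which height [t] lies beyond the bisector,
    that is [|u| <= 2 t]. *)
Definition clip (t : R) : R := (Num.min 1 (2 * t))%R.
Definition in01 (t : R) : bool := (0 <= t <= 1)%R.

(** A Wallis integral: half the ratio of the unit ball volumes in dimensions [k.+1] and [k]. *)
Definition slice_int k : \bar R := \int[mu]_t (ib (in01 t) * (slice_radius t ^+ k)%:E).
Definition clip_slice_int k : \bar R :=
  \int[mu]_t (ib (in01 t) * (clip t ^+ k.+1 * slice_radius t ^+ k)%:E).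

Lemma measurable_ballvol_comp d (k : R -> R) : measurable_fun setT k ->
  measurable_fun setT (fun t => ballvol d (k t)).
Proof. by move=> mk; apply: (measurableT_comp (@measurable_ballvol R d)). Qed.

Lemma measurable_slice_radius : measurable_fun setT slice_radius.
Proof.
by apply: (measurableT_comp measurable_sqrtr); mf.
Qed.

Lemma measurable_clip : measurable_fun setT clip.
Proof. by apply: measurable_minr; mf. Qed.

Lemma measurable_in01 : measurable_fun setT in01.
Proof. by rewrite /in01; mf. Qed.

Lemma slice_ge0 (t : R) : (0 <= slice_radius t)%R.
Proof. exact: sqrtr_ge0. Qed.

Lemma slice_sqr (t : R) : in01 t -> (1 - t ^+ 2 = slice_radius t ^+ 2)%R.
Proof. by move=> /andP[t0 t1]; rewrite sqr_sqrtr//; nra. Qed.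

Lemma half_ballvol d (t : R) :
  ib (0 <= t)%R * ballvol d (1 - t ^+ 2)%R =
  ballvol d 1 * (ib (in01 t) * (slice_radius t ^+ d)%:E).
Proof.
have [t0|t0] := leP 0%R t; last first.
  by rewrite /in01 [X in ib (X && _)]leNgt t0 ib0 !mul0e mule0.
have [t1|t1] := leP t 1%R; last first.
  by rewrite ballvol_neg ?mule0 /in01 ?[(t <= 1)%R]leNgt ?t1 ?andbF ?ib0 ?mul0e ?mule0//; nra.
have t01 : in01 t by exact/andP.
by rewrite t01 ib1 !mul1e slice_sqr// ballvolE ?slice_ge0// muleC.
Qed.

Lemma measurable_slice_fun k : measurable_fun setT
  (fun t => ib (in01 t) * (slice_radius t ^+ k)%:E).
Proof.
apply: emeasurable_funM; first by apply: measurable_ib; exact: measurable_in01.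
by apply/measurable_EFinP; apply: measurable_funX; exact: measurable_slice_radius.
Qed.

Lemma slice_fun_ge0 k t : 0 <= ib (in01 t) * (slice_radius t ^+ k)%:E.
Proof. by rewrite mule_ge0 ?ib_ge0// lee_fin exprn_ge0// slice_ge0. Qed.

Lemma ballvol_slice d : ballvol d.+1 1 = 2%:E * ballvol d 1 * slice_int d.
Proof.
have mb : measurable_fun setT (fun t : R => ballvol d (1 - t ^+ 2)%R).
  by apply: measurable_ballvol_comp; mf.
rewrite ballvolS.
transitivity (\int[mu]_t (ib (0 <= t)%R * ballvol d (1 - t ^+ 2)%R +
    ib (t < 0)%R * ballvol d (1 - t ^+ 2)%R)).
  by apply: eq_integral => t _; case: leP; rewrite ?ib1 ?ib0 ?mul1e ?mul0e ?adde0 ?add0e.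
rewrite ge0_integralD//; first last.
- by mf.
- by move=> t _; rewrite mule_ge0 ?ib_ge0 ?ballvol_ge0.
- by mf.
- by move=> t _; rewrite mule_ge0 ?ib_ge0 ?ballvol_ge0.
rewrite -[X in _ + X]lebR_opp; first last.
- by move=> t; rewrite mule_ge0 ?ib_ge0 ?ballvol_ge0.
- by mf.
under [X in _ + X]eq_integral => t _ do
  rewrite sqrrN oppr_lt0 -[X in (0 < X)%R]mul1r.
rewrite integral_lt_le//; last by move=> t; exact: ballvol_ge0.
under [X in _ + X]eq_integral do rewrite mul1r.
have -> : \int[mu]_t (ib (0 <= t :> R)%R * ballvol d (1 - t ^+ 2)%R) = ballvol d 1 * slice_int d.
  under eq_integral do rewrite half_ballvol.
  rewrite ge0_integralZl//; [exact: measurable_slice_fun|by move=> t _; exact: slice_fun_ge0|].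
  exact: ballvol_ge0.
by rewrite -[in RHS]muleA (_ : 2%:E = 1 + 1)// [RHS]ge0_muleDl// mul1e.
Qed.

Definition trivol d : \bar R := \int[leb R d]_u \int[leb R d]_v
  (ib (nrm2 u <= 1)%R * ib ((nrm2 v <= 1) && (nrm2 u + nrm2 v - 2 * dot u v <= 1))%R).
Definition cherryvol d : \bar R := \int[leb R d]_u \int[leb R d]_v
  (ib (nrm2 u <= 1)%R * ib (nrm2 v <= 1)%R).

Lemma measurable_ib_le1 d : measurable_fun setT (fun u : d.-tuple R => ib (nrm2 u <= 1)%R).
Proof. by mf. Qed.

Lemma cherryvolE d : cherryvol d = ballvol d 1 * ballvol d 1.
Proof.
rewrite /cherryvol.
under eq_integral => u _.
  rewrite ge0_integralZl//; [|exact: measurable_ib_le1|by move=> *; exact: ib_ge0|exact: ib_ge0].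
  over.
by rewrite ge0_integralZr ?ballvol_ge0//; [exact: measurable_ib_le1|move=> *; exact: ib_ge0].
Qed.

Lemma measurable_triangle d : measurable_fun setT (fun p : d.-tuple R * d.-tuple R =>
  ib ((nrm2 p.2 <= 1) && (nrm2 p.1 + nrm2 p.2 - 2 * dot p.1 p.2 <= 1))%R).
Proof.
mf; apply: measurable_sum => i; apply: measurable_funM.
  by apply: (measurableT_comp (@measurable_tnth _ _ _ i)).
by apply: (measurableT_comp (@measurable_tnth _ _ _ i)).
Qed.

(** Exchanging the integrals over [u] and over the height [t]: for fixed [t] the admissible [u] fill
    a ball of radius [clip t], which contributes [clip t ^+ d.+1] times the unit ball volume. *)
Lemma trivolE d :
  trivol d.+1 = 2%:E * ballvol d 1 * ballvol d.+1 1 * clip_slice_int d.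
Proof.
have mb : measurable_fun setT (fun t : R => ballvol d (1 - t ^+ 2)%R).
  by apply: measurable_ballvol_comp; mf.
have msq : measurable_fun setT (fun u : d.+1.-tuple R => Num.sqrt (nrm2 u)).
  by apply: (measurableT_comp measurable_sqrtr); exact: measurable_nrm2.
transitivity (\int[leb R d.+1]_u (2%:E * \int[mu]_t
    (ib (nrm2 u <= 1)%R * (ib (Num.sqrt (nrm2 u) <= 2 * t)%R * ballvol d (1 - t ^+ 2)%R)))).
  apply: eq_integral => u _.
  rewrite ge0_integralZl//; [|exact: (measurableT_comp (@measurable_triangle d.+1) (pair1_measurable u))|by move=> *; exact: ib_ge0|exact: ib_ge0].
  rewrite -/(lensvol u) lensvolE muleCA ge0_integralZl//; first by mf.
    by move=> t _; rewrite mule_ge0 ?ib_ge0 ?ballvol_ge0.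
  exact: ib_ge0.
have m1 : measurable_fun setT (fun p : d.+1.-tuple R * R =>
  ib (nrm2 p.1 <= 1)%R * (ib (Num.sqrt (nrm2 p.1) <= 2 * p.2)%R * ballvol d (1 - p.2 ^+ 2)%R)).
  mf; first by apply: (measurableT_comp msq); mf.
  by apply: (measurableT_comp mb); mf.
have pos u t : 0 <= ib (nrm2 u <= 1)%R * (ib (Num.sqrt (@nrm2 _ d.+1 u) <= 2 * t)%R * ballvol d (1 - t ^+ 2)%R).
  by rewrite !mule_ge0 ?ib_ge0 ?ballvol_ge0.
rewrite ge0_integralZl//; first last.
- by move=> u _; exact: integral_ge0.
- exact: measurable_integral_snd.
rewrite -!muleA; congr (_ * _).
rewrite (integral_swap (leb R d.+1) mu)//.
transitivity (\int[mu]_t (ballvol d 1 * (ballvol d.+1 1 *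
   (ib (in01 t) * (clip t ^+ d.+1 * slice_radius t ^+ d)%:E)))); last first.
  have mc : measurable_fun setT (fun t => ib (in01 t) * (clip t ^+ d.+1 * slice_radius t ^+ d)%:E).
    apply: emeasurable_funM; first by apply: measurable_ib; exact: measurable_in01.
    apply/measurable_EFinP; apply: measurable_funM; apply: measurable_funX.
      exact: measurable_clip.
    exact: measurable_slice_radius.
  have c0 t : 0 <= ib (in01 t) * (clip t ^+ d.+1 * slice_radius t ^+ d)%:E.
    have [t01|] := boolP (in01 t); last by rewrite ib0 mul0e.
    rewrite ib1 mul1e lee_fin mulr_ge0// exprn_ge0 ?slice_ge0// le_min ler01/=.
    by case/andP: t01; lra.
  rewrite ge0_integralZl ?ballvol_ge0//; first last.
  - by move=> t _; rewrite mule_ge0 ?ballvol_ge0.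
  - by apply: emeasurable_funM => //; mf.
  by congr (_ * _); rewrite ge0_integralZl ?ballvol_ge0.
apply: eq_integral => t _.
(* The condition [0 <= t] is repeated inside the integral because squaring [2 * t] would otherwise
   admit negative heights. *)
transitivity (ib (0 <= t)%R * ballvol d (1 - t ^+ 2)%R * \int[leb R d.+1]_x ib ((0 <= t) && (nrm2 x <= Num.min 1 (2 * t) ^+ 2))%R).
  rewrite -ge0_integralZl; first last.
  - by rewrite mule_ge0 ?ib_ge0 ?ballvol_ge0.
  - by move=> x _; exact: ib_ge0.
  - by mf.
  - by [].
  apply: eq_integral => x _.
  have [t0|t0] := leP 0%R t; last first.
    rewrite [(_ <= 2 * t)%R]leNgt (_ : (2 * t < Num.sqrt (nrm2 x))%R) ?ib0 ?mul0e ?mule0//.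
    by rewrite (@lt_le_trans _ _ 0%R) ?sqrtr_ge0//; lra.
  rewrite ib1 mul1e muleA -ibM muleC; congr (_ * ib _).
  rewrite andTb -[(nrm2 x)%R in RHS]sqr_sqrtr ?nrm2_ge0//.
  rewrite ler_pXn2r ?nnegrE ?sqrtr_ge0 ?le_min//=; last by rewrite ler01/=; lra.
  by rewrite -{1}[nrm2 x]sqr_sqrtr ?nrm2_ge0// expr_le1 ?sqrtr_ge0.
rewrite half_ballvol -!muleA; congr (_ * _).
have [t01|] := boolP (in01 t); last by rewrite ib0 !mul0e mule0.
have t0 : (0 <= t)%R by case/andP: t01.
rewrite ib1 !mul1e t0 -/(ballvol d.+1 (clip t ^+ 2)) ballvolE; last first.
  by rewrite /clip le_min ler01/=; lra.
by rewrite muleA -EFinM muleC [(slice_radius _ ^+ _ * _)%R]mulrC.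
Qed.

End lens.

(** * Monotonicity of the ratio in the dimension *)

Section alpha.
Context (R : realType).
Notation mu := (@lebR R).
Notation ib := (@ib R).
Notation w := (@slice_radius R).
Notation m := (@clip R).

Lemma lebR_cc (a b : R) : a <= b -> mu `[a, b]%classic = (b - a)%:E.
Proof.
move=> ab; rewrite [LHS](@lebesgue_measure_itv R `[a, b]) /= lte_fin lt_neqAle ab andbT.
by case: eqVneq => [->|_] /=; rewrite ?subrr// EFinB.
Qed.

Definition int01 (g : R -> R) : \bar R := (\int[mu]_t (ib (in01 t) * (g t)%:E))%E.
Definition ge0_01 (g : R -> R) := forall t, in01 t -> 0 <= g t.

Lemma measurable_int01_fun (g : R -> R) : measurable_fun setT g ->
  measurable_fun setT (fun t => ib (in01 t) * (g t)%:E)%E.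
Proof.
move=> mg; apply: emeasurable_funM.
  by apply: measurable_ib; exact: measurable_in01.
exact/measurable_EFinP.
Qed.

Lemma int01_fun_ge0 (g : R -> R) t : ge0_01 g -> (0 <= ib (in01 t) * (g t)%:E)%E.
Proof.
move=> g0; have [t01|] := boolP (in01 t); last by rewrite ib0 mul0e.
by rewrite ib1 mul1e lee_fin g0.
Qed.

Lemma int01_ge0 g : ge0_01 g -> (0 <= int01 g)%E.
Proof. by move=> g0; apply: integral_ge0 => t _; exact: int01_fun_ge0. Qed.

Lemma int01D (f g : R -> R) : measurable_fun setT f -> measurable_fun setT g ->
  ge0_01 f -> ge0_01 g -> int01 (fun t => f t + g t) = (int01 f + int01 g)%E.
Proof.
move=> mf_ mg f0 g0; rewrite /int01 -ge0_integralD//; first last.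
- exact: measurable_int01_fun.
- by move=> t _; exact: int01_fun_ge0.
- exact: measurable_int01_fun.
- by move=> t _; exact: int01_fun_ge0.
apply: eq_integral => t _; rewrite EFinD.
by have [t01|] := boolP (in01 t); rewrite ?ib1 ?mul1e// ib0 !mul0e adde0.
Qed.

Lemma int01Z (c : R) (f : R -> R) : measurable_fun setT f -> ge0_01 f -> 0 <= c ->
  int01 (fun t => c * f t) = (c%:E * int01 f)%E.
Proof.
move=> mf_ f0 c0; rewrite /int01 -ge0_integralZl//; first last.
- by move=> t _; exact: int01_fun_ge0.
- exact: measurable_int01_fun.
by apply: eq_integral => t _; rewrite EFinM muleCA.
Qed.

Lemma le_int01 (f g : R -> R) : measurable_fun setT f -> measurable_fun setT g ->
  ge0_01 f -> ge0_01 g -> (forall t, in01 t -> f t <= g t) -> (int01 f <= int01 g)%E.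
Proof.
move=> mf_ mg f0 g0 fg; apply: ge0_le_integral => //.
- by move=> t _; exact: int01_fun_ge0.
- exact: measurable_int01_fun.
- exact: measurable_int01_fun.
move=> t _; have [t01|] := boolP (in01 t); last by rewrite ib0 !mul0e.
by rewrite ib1 !mul1e lee_fin fg.
Qed.

(** On the window from 1/8 to 1/4 [clip] lies between 1/4 and 1/2 and [slice_radius] is at least
    1/2; its positive length makes the inequalities below strict. *)
Lemma measurable_01J : measurable_fun setT (fun t : R => ((8^-1 <= t) && (t <= 4^-1))%:R : R).
Proof. by apply: (measurableT_comp (f := fun b : bool => b%:R : R)) => //; mf. Qed.

Lemma int01J : int01 (fun t => ((8^-1 <= t) && (t <= 4^-1))%:R) = (8^-1)%:E.
Proof.
rewrite /int01.
transitivity (\int[mu]_t ib ((8^-1 <= t) && (t <= 4^-1))%R)%E.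
  apply: eq_integral => t _; rewrite /in01.
  have [t1|t1] := boolP ((8^-1 <= t) && (t <= 4^-1)); last by rewrite mule0.
  by rewrite (_ : (_ <= _ <= _))// ?ib1 ?mul1e//; case/andP: t1; lra.
rewrite integral_ib; last by mf.
rewrite (_ : [set x | _] = `[8^-1, 4^-1]%classic); last by rewrite set_itvE.
by rewrite [LHS]lebR_cc; [congr (_%:E)|]; lra.
Qed.

Lemma clip_ge0 : ge0_01 m.
Proof. by move=> t /andP[t0 t1]; rewrite le_min ler01/=; lra. Qed.

Lemma clip_le1 t : m t <= 1.
Proof. by rewrite ge_min lexx. Qed.

Lemma slice_le1 t : w t <= 1.
Proof.
rewrite /slice_radius -[leRHS]sqrtr1 ler_wsqrtr//; have := sqr_ge0 t; lra.
Qed.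

Lemma measurable_m_w i j : measurable_fun setT (fun t => m t ^+ i * w t ^+ j).
Proof.
apply: measurable_funM; apply: measurable_funX; [exact: measurable_clip|exact: measurable_slice_radius].
Qed.

Lemma measurable_w j : measurable_fun setT (fun t => w t ^+ j).
Proof. by apply: measurable_funX; exact: measurable_slice_radius. Qed.

Lemma m_w_ge0 i j : ge0_01 (fun t => m t ^+ i * w t ^+ j).
Proof. by move=> t t01; rewrite mulr_ge0// exprn_ge0 ?clip_ge0 ?slice_ge0. Qed.

Lemma w_ge0 j : ge0_01 (fun t => w t ^+ j).
Proof. by move=> t t01; rewrite exprn_ge0// slice_ge0. Qed.

Lemma int01_fin g : measurable_fun setT g -> ge0_01 g -> (forall t, in01 t -> g t <= 1) ->
  int01 g \is a fin_num.
Proof.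
move=> mg g0 g1; rewrite ge0_fin_numE ?int01_ge0//.
apply: (@le_lt_trans _ _ (int01 (fun=> 1))); first exact: le_int01.
rewrite /int01; under eq_integral do rewrite mule1.
rewrite integral_ib; last exact: measurable_in01.
rewrite (_ : [set x | _] = `[0, 1]%classic); last by rewrite set_itvE.
by rewrite [ltLHS]lebR_cc// ltry.
Qed.

Lemma slice_int_fin k : slice_int R k \is a fin_num.
Proof.
apply: (@int01_fin (fun t => w t ^+ k)); [exact: measurable_w|exact: w_ge0|].
by move=> t _; rewrite exprn_ile1 ?slice_ge0 ?slice_le1.
Qed.

Lemma clip_slice_int_fin k : clip_slice_int R k \is a fin_num.
Proof.
apply: (@int01_fin (fun t => m t ^+ k.+1 * w t ^+ k)); [exact: measurable_m_w|exact: m_w_ge0|].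
move=> t t01; rewrite mulr_ile1 ?exprn_ge0 ?slice_ge0 ?clip_ge0//.
  by rewrite exprn_ile1 ?clip_ge0 ?clip_le1.
by rewrite exprn_ile1 ?slice_ge0 ?slice_le1.
Qed.

Lemma slice_lb t : t <= 4^-1 -> 8^-1 <= t -> 2^-1 <= w t.
Proof.
move=> t4 t8; rewrite -(@ler_pXn2r _ 2) ?nnegrE ?slice_ge0// -slice_sqr; last first.
  by apply/andP; split; lra.
by rewrite expr2; nra.
Qed.

Lemma slice_int_gt0 k : 0 < fine (slice_int R k).
Proof.
suff : ((2^-1 ^+ k * 8^-1)%:E <= slice_int R k)%E.
  rewrite -{1}(fineK (slice_int_fin k)) lee_fin => h.
  by rewrite (lt_le_trans _ h)// mulr_gt0 ?exprn_gt0.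
rewrite EFinM -int01J -int01Z; [|exact: measurable_01J|by move=> t _; exact: ler0n|by rewrite exprn_ge0].
apply: le_int01; [|exact: measurable_w| |exact: w_ge0|].
- by apply: measurable_funM => //; exact: measurable_01J.
- by move=> t _; rewrite mulr_ge0// exprn_ge0.
move=> t _; have [/andP[t8 t4]|_] := boolP (_ && _); last by rewrite mulr0 exprn_ge0// slice_ge0.
by rewrite mulr1 lerXn2r ?nnegrE// ?slice_ge0// slice_lb.
Qed.

(** The index is shifted: this is the closing probability of a cherry in dimension [k.+1], as
    [trivol_const] shows. *)
Definition alpha k : R := fine (clip_slice_int R k) / fine (slice_int R k).

(** Two comparisons are chained. Removing one factor [m] from the integrand of [B'] gains at least
    [delta / 8]; in the resulting integral of [m^k.+1 w^k.+1], Chebyshev's inequality lets the mean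
    [wbar] replace one factor [w]. Hence [B' < wbar * B], which is the claim since
    [wbar = A' / A]. *)
Lemma alpha_decr k : alpha k.+1 < alpha k.
Proof.
pose A := fine (slice_int R k); pose A' := fine (slice_int R k.+1).
pose B := fine (clip_slice_int R k); pose B' := fine (clip_slice_int R k.+1).
have A0 : 0 < A by exact: slice_int_gt0.
have A'0 : 0 < A' by exact: slice_int_gt0.
have AE : slice_int R k = A%:E by rewrite fineK// slice_int_fin.
have A'E : slice_int R k.+1 = A'%:E by rewrite fineK// slice_int_fin.
have BE : clip_slice_int R k = B%:E by rewrite fineK// clip_slice_int_fin.
have B'E : clip_slice_int R k.+1 = B'%:E by rewrite fineK// clip_slice_int_fin.
have A'A : A' <= A.
  rewrite -lee_fin -AE -A'E; apply: le_int01; [exact: measurable_w|exact: measurable_w|exact: w_ge0|exact: w_ge0|].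
  by move=> t _; rewrite exprS ler_piMl ?exprn_ge0 ?slice_ge0 ?slice_le1.
(* [wbar] is the mean of [w] for the weight [w^k]; [clip] increases and [w] decreases,
   so both [clip - c] and [w - wbar] change sign at [t0]. *)
pose wbar := A' / A.
have wb0 : 0 < wbar by rewrite divr_gt0.
have wb1 : wbar <= 1 by rewrite ler_pdivrMr// mul1r.
(* On the unit interval [w] is an involution, so this is the point where [w] takes the value
   [wbar]. *)
pose t0 := w wbar.
have t00 : 0 <= t0 by exact: slice_ge0.
have t01 : in01 t0 by rewrite /in01 t00 slice_le1.
have wt0 : w t0 = wbar.
  apply/eqP; rewrite -(@eqrXn2 _ 2)// ?slice_ge0 ?(ltW wb0)//.
  rewrite -slice_sqr// /t0 -slice_sqr ?opprB; last by rewrite /in01 (ltW wb0) wb1.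
  by apply/eqP; ring.
pose c := m t0 ^+ k.+1.
have c0 : 0 <= c by rewrite exprn_ge0// clip_ge0.
have corr t : in01 t -> (m t ^+ k.+1 - c) * (w t - wbar) <= 0.
  move=> t01'; have /andP[tt0 tt1] := t01'.
  have [le_t|/ltW le_t] := leP t t0.
    rewrite mulr_le0_ge0// ?subr_le0 ?subr_ge0.
      rewrite /c lerXn2r ?nnegrE ?clip_ge0//.
      by rewrite /clip le_min ge_min lexx/= ge_min; apply/orP; right; lra.
    by rewrite -wt0 ler_wsqrtr//; nra.
  rewrite mulr_ge0_le0// ?subr_le0 ?subr_ge0.
    rewrite /c lerXn2r ?nnegrE ?clip_ge0//.
    by rewrite /clip le_min ge_min lexx/= ge_min; apply/orP; right; lra.
  by rewrite -wt0 ler_wsqrtr//; nra.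
(* On the window, the lower bounds of [m ^+ k.+1], [w ^+ k.+1] and [1 - m], multiplied. *)
pose delta : R := 4^-1 ^+ k.+1 * 2^-1 ^+ k.+1 * 2^-1.
have d0 : 0 < delta by rewrite !mulr_gt0 ?exprn_gt0.
pose J (t : R) : R := ((8^-1 <= t) && (t <= 4^-1))%:R.
have gap t : in01 t -> m t ^+ k.+2 * w t ^+ k.+1 + delta * J t <= m t ^+ k.+1 * w t ^+ k.+1.
  move=> t01'; rewrite /J; have [/andP[t8 t4]|_] := boolP (_ && _); last first.
    rewrite mulr0 addr0 ler_wpM2r ?exprn_ge0 ?slice_ge0//.
    by rewrite exprS ler_piMl ?exprn_ge0 ?clip_ge0 ?clip_le1.
  have mE : m t = 2 * t by apply/min_idPr; lra.
  have -> : m t ^+ k.+1 * w t ^+ k.+1 =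
      m t ^+ k.+2 * w t ^+ k.+1 + m t ^+ k.+1 * w t ^+ k.+1 * (1 - m t).
    by rewrite [m t ^+ k.+2]exprS; ring.
  rewrite mulr1 lerD2l ler_pM//.
  - rewrite ler_pM ?exprn_ge0//; first by rewrite lerXn2r ?nnegrE ?clip_ge0// mE; lra.
    by rewrite lerXn2r ?nnegrE ?slice_ge0// slice_lb.
  - by rewrite mE; lra.
have mJ : measurable_fun setT J by exact: measurable_01J.
have J0 t : 0 <= J t by [].
have nn1 t i j : in01 t -> 0 <= m t ^+ i * w t ^+ j by exact: m_w_ge0.
have nn2 t j : 0 <= w t ^+ j by rewrite exprn_ge0// slice_ge0.
have cw : 0 <= c * wbar by exact: mulr_ge0 c0 (ltW wb0).
(* The correlation inequality is rearranged so that both sides are sums of nonnegative terms. After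
   integration [c * wbar * A] and [c * A'] cancel, because [wbar * A = A']. *)
have key : (int01 (fun t => (m t ^+ k.+2 * w t ^+ k.+1 + delta * J t) + (c * wbar) * w t ^+ k)%R <=
   int01 (fun t => wbar * (m t ^+ k.+1 * w t ^+ k) + c * w t ^+ k.+1)%R)%E.
  apply: le_int01.
  - apply: measurable_funD; last by apply: measurable_funM => //; exact: measurable_w.
    by apply: measurable_funD; [exact: measurable_m_w|apply: measurable_funM].
  - by apply: measurable_funD; apply: measurable_funM => //; [exact: measurable_m_w|exact: measurable_w].
  - move=> t t01'; apply: addr_ge0; last by apply: mulr_ge0 (nn2 _ _); exact: mulr_ge0 c0 (ltW wb0).
    by apply: addr_ge0; [exact: nn1|exact: mulr_ge0 (ltW d0) (J0 t)].
  - move=> t t01'; apply: addr_ge0; first by apply: mulr_ge0 (ltW wb0) _; exact: nn1.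
    exact: mulr_ge0 c0 (nn2 _ _).
  move=> t t01'; apply: (le_trans (lerD (gap t t01') (lexx _))).
  have := mulr_ge0_le0 (exprn_ge0 k (slice_ge0 t)) (corr t t01').
  rewrite (exprSr (w t)); lra.
rewrite int01D in key; last 4 first.
- by apply: measurable_funD; [exact: measurable_m_w|apply: measurable_funM].
- by apply: measurable_funM => //; exact: measurable_w.
- by move=> t t01'; apply: addr_ge0; [exact: nn1|exact: mulr_ge0 (ltW d0) (J0 t)].
- by move=> t t01'; exact: mulr_ge0 cw (nn2 _ _).
rewrite int01D in key; last 4 first.
- exact: measurable_m_w.
- exact: measurable_funM.
- exact: m_w_ge0.
- by move=> t _; exact: mulr_ge0 (ltW d0) (J0 t).
rewrite int01D in key; last 4 first.
- by apply: measurable_funM => //; exact: measurable_m_w.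
- by apply: measurable_funM => //; exact: measurable_w.
- by move=> t t01'; apply: mulr_ge0 (ltW wb0) _; exact: nn1.
- by move=> t t01'; exact: mulr_ge0 c0 (nn2 _ _).
have E1 : int01 (fun t => delta * J t) = (delta * 8^-1)%:E.
  by rewrite int01Z ?(ltW d0)// int01J -EFinM.
have E2 : int01 (fun t => c * wbar * w t ^+ k) = (c * wbar * A)%:E.
  rewrite int01Z; [|exact: measurable_w|exact: w_ge0|exact: cw].
  by rewrite (_ : int01 _ = A%:E).
have E3 : int01 (fun t => wbar * (m t ^+ k.+1 * w t ^+ k)) = (wbar * B)%:E.
  rewrite int01Z; [|exact: measurable_m_w|exact: m_w_ge0|exact: ltW].
  by rewrite (_ : int01 _ = B%:E).
have E4 : int01 (fun t => c * w t ^+ k.+1) = (c * A')%:E.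
  rewrite int01Z; [|exact: measurable_w|exact: w_ge0|exact: c0].
  by rewrite (_ : int01 _ = A'%:E).
have E5 : int01 (fun t => m t ^+ k.+2 * w t ^+ k.+1) = B'%:E by exact: B'E.
rewrite E1 E2 E3 E4 E5 -!EFinD lee_fin in key.
rewrite /alpha -/A -/A' -/B -/B' ltr_pdivrMr// mulrAC ltr_pdivlMr//.
have wA : wbar * A = A' by rewrite /wbar divfK// gt_eqF.
have : B' < wbar * B.
  have d8 : 0 < delta * 8^-1 by rewrite mulr_gt0.
  by move: key; rewrite -mulrA wA => key; lra.
by rewrite -wA mulrA ltr_pM2r// mulrC.
Qed.

End alpha.

Lemma ecvg_le (R : realType) (u : nat -> \bar R) (l e : R) : u @ \oo --> l%:E -> l < e ->
  \forall n \near \oo, (u n <= e%:E)%E.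
Proof.
move=> /fine_cvgP[fu /cvgrPdist_lt cu] le; near=> n.
have fn : u n \is a fin_num by near: n.
have : `|l - fine (u n)| < e - l by near: n; apply: cu; rewrite subr_gt0.
by rewrite -[u n]fineK// lee_fin ltr_norml => /andP[? ?]; lra.
Unshelve. all: by end_near. Qed.

(** * Continuity of translations *)

Section translation.
Context (R : realType) (d : nat).
Notation mu := (leb R d).
Notation V := (d.-tuple R).
Implicit Types (A B : set V) (h x : V).

Definition tshift h x : V := taff h 1 x.
Definition small (e : R) h := forall i, `|tnth h i| <= e.
Definition box (M : R) : set V := [set x | forall i, `[- M, M]%classic (tnth x i)].
Definition symdiff A h : set V :=
  (A `\` (tshift h @^-1` A)) `|` ((tshift h @^-1` A) `\` A).

Lemma measurable_shift h : measurable_fun setT (tshift h : V -> V).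
Proof. exact: measurable_taff. Qed.

Lemma measurable_shift_pre A h : measurable A -> measurable (tshift h @^-1` A).
Proof. by move=> mA; rewrite -[X in measurable X]setTI; exact: measurable_shift. Qed.

Lemma measurable_symdiff A h : measurable A -> measurable (symdiff A h).
Proof.
move=> mA; have mS := measurable_shift_pre h mA.
by apply: measurableU; apply: measurableD.
Qed.

Lemma measurable_boxM M : measurable (box M).
Proof. by apply: (measurable_box (B := fun=> `[- M, M]%classic)) => i; exact: measurable_itv. Qed.

Lemma leb_shift A h : measurable A -> mu (tshift h @^-1` A) = mu A.
Proof.
move=> mA; rewrite -[in RHS](setIT A) -integral_indic//.
rewrite -[RHS](integral_taff h (@ltr01 R)); first last.
- by move=> x; rewrite lee_fin.
- by apply/measurable_EFinP; exact: measurable_indic.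
rewrite expr1n mul1e -[in LHS](setIT (_ @^-1` _)) -integral_indic//.
exact: measurable_shift_pre.
Qed.

Lemma leb_box M : 0 <= M -> mu (box M) = ((2 * M) ^+ d)%:E.
Proof.
move=> M0; transitivity (\prod_(i < d) lebR `[(- M)%R, M]%classic)%E.
  exact: (powm_box (@lebR R) (B := fun=> `[- M, M]%classic)).
rewrite lebR_cc; last lra.
by rewrite prodEFin prodr_const card_ord opprK mulr2n mulrDl mul1r.
Qed.

(** The restriction to a box keeps the measures finite, so that the property passes to complements
    and, by continuity from above, to countable unions. *)
Definition shift_cont A := measurable A /\ forall (M e : R), 0 < M -> 0 < e ->
  exists2 del : R, 0 < del &
    forall h, small del h -> (mu (box M `&` symdiff A h) <= e%:E)%E.

Lemma smallW (e1 e2 : R) h : e1 <= e2 -> small e1 h -> small e2 h.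
Proof. by move=> e12 s i; exact: le_trans (s i) e12. Qed.

Lemma box_shift M h x : small 1 h -> box M x -> box (M + 1) (tshift h x).
Proof.
move=> s bx i; have := s i; have := bx i.
rewrite /= !in_itv/= tnth_mktuple ler_norml => /andP[? ?] /andP[? ?].
by apply/andP; split; lra.
Qed.

(** Bounds the union of the symmetric differences, which contains the symmetric difference of the
    union. The larger set is what the level sets of [f] require later, where no level at all may be
    crossed. *)
Lemma shift_cont_bigcup_ord (A : nat -> set V) : (forall n, shift_cont (A n)) ->
  forall (K : nat) (M e : R), 0 < M -> 0 < e ->
  exists2 del : R, 0 < del &
    forall h, small del h ->
      (mu (box M `&` \bigcup_(n in [set n | (n < K)%N]) symdiff (A n) h) <= e%:E)%E.
Proof.
move=> cA; elim=> [|K IH] M e M0 e0.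
  exists 1 => // h _; rewrite (_ : _ `&` _ = set0) ?measure0 ?lee_fin ?(ltW e0)//.
  by apply/seteqP; split=> x //= [_ []].
have e20 : 0 < e / 2 by rewrite divr_gt0.
have [d1 d10 h1] := IH M (e / 2) M0 e20.
have [d2 d20 h2] := (cA K).2 M (e / 2) M0 e20.
exists (Num.min d1 d2); first by rewrite lt_min d10.
move=> h sh.
have mU k : measurable (\bigcup_(n in [set n | (n < k)%N]) symdiff (A n) h).
  by apply: bigcup_measurable => n _; apply: measurable_symdiff; exact: (cA n).1.
have mS : measurable (symdiff (A K) h) by apply: measurable_symdiff; exact: (cA K).1.
have -> : box M `&` \bigcup_(n in [set n | (n < K.+1)%N]) symdiff (A n) h =
    (box M `&` \bigcup_(n in [set n | (n < K)%N]) symdiff (A n) h) `|`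
    (box M `&` symdiff (A K) h).
  rewrite -setIUr; congr (_ `&` _); apply/seteqP; split => x.
    move=> [n /= nK An]; move: nK; rewrite ltnS leq_eqVlt => /predU1P[<-|nK]; first by right.
    by left; exists n.
  by move=> [[n /= nK An]|AK]; [exists n => //=; exact: ltnW|exists K => /=].
apply: (le_trans (measureU2 _ _ _)).
- by apply: measurableI => //; exact: measurable_boxM.
- by apply: measurableI => //; exact: measurable_boxM.
rewrite (splitr e) EFinD leeD//.
  by apply: h1; apply: smallW sh; rewrite ge_min lexx.
by apply: h2; apply: smallW sh; rewrite ge_min lexx orbT.
Qed.

Lemma symdiff_bigcup_ord (A : nat -> set V) K h :
  symdiff (\bigcup_(n in [set n | (n < K)%N]) A n) h `<=`
  \bigcup_(n in [set n | (n < K)%N]) symdiff (A n) h.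
Proof.
move=> x [[[n nK An] nS]|[[n nK An] nS]]; exists n => //.
  by left; split => // Sn; apply: nS; exists n.
by right; split => // Sn; apply: nS; exists n.
Qed.

Lemma shift_contC A : shift_cont A -> shift_cont (~` A).
Proof.
move=> [mA cA]; split; first exact: measurableC.
move=> M e M0 e0; have [dl d0 H] := cA M e M0 e0; exists dl => // h sh.
rewrite (_ : symdiff (~` A) h = symdiff A h); first exact: H.
rewrite /symdiff preimage_setC !setDE !setCK setUC.
by congr (_ `|` _); rewrite setIC.
Qed.

(** Cut the union at a finite stage [k]. A point that the translation moves in or out of the union
    either does so for one of the first [k] sets, or it or its translate lies in the tail [T k],
    whose measure tends to 0. The finite part takes [e / 2], the tail and its preimage [e / 4]
    each. *)
Lemma shift_cont_bigcup (F : nat -> set V) : (forall n, shift_cont (F n)) ->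
  shift_cont (\bigcup_n F n).
Proof.
move=> cF; split; first by apply: bigcup_measurable => n _; exact: (cF n).1.
move=> M e M0 e0.
set A := \bigcup_n F n.
pose Ak k := \bigcup_(n in [set n | (n < k)%N]) F n.
have mA : measurable A by apply: bigcup_measurable => n _; exact: (cF n).1.
have mAk k : measurable (Ak k) by apply: bigcup_measurable => n _; exact: (cF n).1.
(* The extra 1 leaves room for the translates of points of [box M] by shifts of size at most 1. *)
pose T k := box (M + 1) `&` (A `\` Ak k).
have mT k : measurable (T k).
  by apply: measurableI; [exact: measurable_boxM|exact: measurableD].
have M1 : 0 <= M + 1 by rewrite addr_ge0// ltW.
have cvT : mu \o T @ \oo --> mu (\bigcap_k T k).
  apply: nonincreasing_cvg_mu => //.
  - apply: (@le_lt_trans _ _ (mu (box (M + 1)))).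
      by apply: le_measure; rewrite ?inE//; [exact: measurable_boxM|exact: subIsetl].
    by rewrite leb_box// ltry.
  - by apply: bigcap_measurable => //; exists 0%N.
  - move=> i j ij; apply/subsetPset; apply: setIS; apply: setDS.
    by move=> x [n /= ni Fn]; exists n => //=; exact: leq_trans ij.
have T0 : \bigcap_k T k = set0.
  apply/seteqP; split=> x //= h.
  have [_ [[n _ Fn] _]] := h 0%N I.
  by have [_ [_]] := h n.+1 I; apply; exists n => /=.
rewrite T0 measure0 in cvT.
have e40 : 0 < e / 4 by rewrite divr_gt0.
have [k _ /(_ k (leqnn k)) hk] := ecvg_le cvT e40.
have e20 : 0 < e / 2 by rewrite divr_gt0.
have [d1 d10 h1] := shift_cont_bigcup_ord cF k M0 e20.
exists (Num.min 1 d1); first by rewrite lt_min ltr01.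
move=> h sh.
have sh1 : small 1 h by apply: smallW sh; rewrite ge_min lexx.
have mS : measurable (tshift h @^-1` T k) by exact: measurable_shift_pre.
have mU : measurable (box M `&` \bigcup_(n in [set n | (n < k)%N]) symdiff (F n) h).
  apply: measurableI; first exact: measurable_boxM.
  by apply: bigcup_measurable => n _; apply: measurable_symdiff; exact: (cF n).1.
have sub : box M `&` symdiff A h `<=`
    (T k `|` (tshift h @^-1` T k)) `|`
    (box M `&` \bigcup_(n in [set n | (n < k)%N]) symdiff (F n) h).
  move=> x [bx Ax].
  have [xk|xk] := pselect (Ak k x); have [sk|sk] := pselect (Ak k (tshift h x)).
  - by case: Ax => -[] => [_ []|+ []]; [case: sk => n _ ?|]; [exists n|case: xk => n _ ? _; exists n].
  - right; split => //; apply: symdiff_bigcup_ord; by left.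
  - right; split => //; apply: symdiff_bigcup_ord; by right.
  - left; case: Ax => -[Ax nAx]; [left|right].
      split; last by split.
      by move=> i; have := bx i; rewrite /= !in_itv/= => /andP[? ?]; apply/andP; split; lra.
    split; last by split.
    exact: box_shift.
apply: (@le_trans _ _ (mu ((T k `|` (tshift h @^-1` T k)) `|`
    (box M `&` \bigcup_(n in [set n | (n < k)%N]) symdiff (F n) h)))).
  apply: le_measure; rewrite ?inE//; last by apply: measurableU => //; exact: measurableU.
  by apply: measurableI; [exact: measurable_boxM|exact: measurable_symdiff].
apply: (le_trans (measureU2 _ _ _)) => //; first exact: measurableU.
rewrite (splitr e) EFinD leeD//; last by apply: h1; apply: smallW sh; rewrite ge_min lexx orbT.
apply: (le_trans (measureU2 _ _ _)) => //.
rewrite (_ : e / 2 = e / 4 + e / 4); last by field.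
by rewrite EFinD leeD// [leLHS]leb_shift.
Qed.

Lemma near_endpoint (a b dl t u : R) : - dl <= u -> u <= dl ->
  ((a < t <= b)%R /\ ~ (a < u + t <= b)%R) \/ ((a < u + t <= b)%R /\ ~ (a < t <= b)%R) ->
  `|t - a| <= dl \/ `|t - b| <= dl.
Proof.
move=> h1 h2; rewrite !ler_norml.
have [xa|xa] := ltP a t; have [xb|xb] := leP t b;
have [ya|ya] := ltP a (u + t); have [yb|yb] := leP (u + t) b => /= hh;
try (by case: hh => -[]); try (by left; apply/andP; split; lra); by right; apply/andP; split; lra.
Qed.

Lemma shift_cont_half (i : 'I_d) (a b : R) :
  shift_cont ((tnth (T := R))^~ i @^-1` `]a, b]%classic).
Proof.
set A := _ @^-1` _.
have mA : measurable A.
  rewrite -[X in measurable X]setTI; apply: measurable_tnth => //.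
split => // M e M0 e0.
(* Membership changes only within [dl] of the hyperplanes at [a] and [b]; the two plates of
   thickness [2 * dl] have total volume [W * dl] inside the box. *)
pose W := ((2 * M) ^+ d.-1) * 4.
have W0 : 0 < W by rewrite !mulr_gt0// exprn_gt0// mulr_gt0.
exists (e / W); first exact: divr_gt0.
move=> h sh; set dl := e / W in sh.
have dl0 : 0 < dl by exact: divr_gt0.
pose B c (j : 'I_d) : set R := if j == i then `[c - dl, c + dl]%classic else `[- M, M]%classic.
have mB c j : measurable (B c j) by rewrite /B; case: ifP => _; exact: measurable_itv.
pose C c : set V := [set x | forall j, B c j (tnth x j)].
have mC c : measurable (C c) by exact: measurable_box.
have muC c : mu (C c) = ((2 * M) ^+ d.-1 * (2 * dl))%:E.
  rewrite [LHS](powm_box (@lebR R) (mB c)).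
  rewrite (bigD1 i)//= {1}/B eqxx lebR_cc; last lra.
  rewrite (eq_bigr (fun=> (2 * M)%:E)); last first.
    move=> j ji; rewrite /B (negbTE ji) lebR_cc; last lra.
    by congr (_%:E); ring.
  rewrite prodEFin prodr_const -EFinM; congr (_%:E).
  rewrite (_ : #|_| = d.-1); last by rewrite cardC1 card_ord.
  by rewrite mulrC; congr (_ * _); ring.
have sub : box M `&` symdiff A h `<=` C a `|` C b.
  move=> x [bx xA].
  have xi c : `|tnth x i - c| <= dl -> C c x.
    move=> xc j; rewrite /B; case: eqVneq => [->|_]; last exact: bx.
    by move: xc; rewrite /= in_itv/= ler_norml => /andP[? ?]; apply/andP; split; lra.
  have := sh i; rewrite ler_norml => /andP[h1 h2].
  suff [?|?] : `|tnth x i - a| <= dl \/ `|tnth x i - b| <= dl by [left; exact: xi|right; exact: xi].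
  move: xA; rewrite /symdiff /A /= /tshift !in_itv/= tnth_mktuple mul1r.
  by move: (tnth x i) (tnth h i) h1 h2; exact: near_endpoint.
apply: (@le_trans _ _ (mu (C a `|` C b))).
  apply: le_measure; rewrite ?inE//; last exact: measurableU.
  by apply: measurableI; [exact: measurable_boxM|exact: measurable_symdiff].
have mle c : (mu (C c) <= ((2 * M) ^+ d.-1 * (2 * dl))%:E)%E by rewrite muC.
apply: (le_trans (measureU2 _ _ _)) => //.
apply: (le_trans (leeD (mle a) (mle b))).
rewrite -EFinD lee_fin.
suff -> : (2 * M) ^+ d.-1 * (2 * dl) + (2 * M) ^+ d.-1 * (2 * dl) = W * dl.
  by rewrite /dl mulrCA divff ?mulr1// gt_eqF.
by rewrite /W; ring.
Qed.

(* The sets satisfying [shift_cont] form a sigma-algebra containing the slabs. *)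
Lemma shift_cont_measurable A : measurable A -> shift_cont A.
Proof.
have c0 : shift_cont set0.
  split => // M e M0 e0; exists 1 => // h _.
  rewrite (_ : _ `&` _ = set0) ?measure0 ?lee_fin ?(ltW e0)//.
  by apply/seteqP; split=> x //= [_ [[]|[]]].
pose G : set (set V) := shift_cont.
have sG : sigma_algebra setT G.
  split => //; last exact: shift_cont_bigcup.
  by move=> B; rewrite setTD; exact: shift_contC.
suff gen : \big[setU/set0]_(i < d) preimage_set_system setT
    ((tnth (T := R))^~ i) measurable `<=` G.
  by move=> mA; exact: (smallest_sub sG gen mA).
rewrite -bigcup_seq => _ [i _ [I mI <-]]; rewrite setTI.
pose H : set (set R) := [set J | shift_cont ((tnth (T := R))^~ i @^-1` J)].
have sH : sigma_algebra setT H.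
  split; rewrite /H/=; first by rewrite preimage_set0.
    by move=> B HB; rewrite setTD preimage_setC; exact: shift_contC.
  by move=> F HF; rewrite preimage_bigcup; exact: shift_cont_bigcup.
suff genH : @ocitv R `<=` H by exact: (smallest_sub sH genH mI).
by move=> _ [[a b] _ <-]; exact: shift_cont_half.
Qed.

End translation.

Lemma ecvg_ge (R : realType) (u : nat -> \bar R) (l e : R) : u @ \oo --> l%:E -> e < l ->
  \forall n \near \oo, (e%:E <= u n)%E.
Proof.
move=> /fine_cvgP[fu /cvgrPdist_lt cu] le; near=> n.
have fn : u n \is a fin_num by near: n.
have : `|l - fine (u n)| < l - e by near: n; apply: cu; rewrite subr_gt0.
by rewrite -[u n]fineK// lee_fin ltr_norml => /andP[? ?]; lra.
Unshelve. all: by end_near. Qed.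

(** * Products of three translates of the density *)

Section triple.
Context (R : realType) (d : nat).
Notation mu := (leb R d).
Notation V := (d.-tuple R).
Variable f : V -> R.
Hypotheses (mf_ : measurable_fun setT f) (f0 : forall x, 0 <= f x).

Definition triple_int (h k : V) : \bar R :=
  (\int[mu]_x (f x * f (tshift h x) * f (tshift k x))%:E)%E.

Lemma measurable_f_shift h : measurable_fun setT (fun x => f (tshift h x)).
Proof. by apply: (measurableT_comp mf_); exact: measurable_shift. Qed.

Lemma measurable_triple h k :
  measurable_fun setT (fun x => (f x * f (tshift h x) * f (tshift k x))%:E).
Proof.
apply/measurable_EFinP; apply: measurable_funM; last exact: measurable_f_shift.
by apply: measurable_funM => //; exact: measurable_f_shift.
Qed.

Lemma integral_shift h (g : V -> \bar R) : measurable_fun setT g ->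
  (forall x, 0 <= g x)%E -> (\int[mu]_x g (tshift h x) = \int[mu]_x g x)%E.
Proof.
move=> mg g0; rewrite -[RHS](integral_taff h (@ltr01 R))//.
by rewrite expr1n mul1e.
Qed.

Lemma measurable_cube : measurable_fun setT (fun x => (f x ^+ 3)%:E).
Proof. by apply/measurable_EFinP; exact: measurable_funX. Qed.

Lemma cube_ge0 x : (0 <= (f x ^+ 3)%:E)%E.
Proof. by rewrite lee_fin exprn_ge0. Qed.

Lemma amgm3 (a b c : R) : 0 <= a -> 0 <= b -> 0 <= c ->
  a * b * c <= 3^-1 * (a ^+ 3 + b ^+ 3 + c ^+ 3).
Proof.
move=> a0 b0 c0.
(* Half of this product is [a^3 + b^3 + c^3 - 3abc]. *)
have : 0 <= (a + b + c) * ((a - b) ^+ 2 + (b - c) ^+ 2 + (c - a) ^+ 2).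
  by rewrite mulr_ge0 ?addr_ge0 ?sqr_ge0.
by lra.
Qed.

Lemma triple_int_le h k : (triple_int h k <= \int[mu]_x (f x ^+ 3)%:E)%E.
Proof.
have mc := measurable_cube.
have ms l : measurable_fun setT (fun x => (f (tshift l x) ^+ 3)%:E).
  by apply/measurable_EFinP; apply: measurable_funX; exact: measurable_f_shift.
apply: (@le_trans _ _ (\int[mu]_x (3^-1%:E * ((f x ^+ 3)%:E + (f (tshift h x) ^+ 3)%:E + (f (tshift k x) ^+ 3)%:E)))%E).
  apply: ge0_le_integral => //.
  - by move=> x _; rewrite lee_fin !mulr_ge0.
  - exact: measurable_triple.
  - by apply: emeasurable_funM => //; apply: emeasurable_funD => //; exact: emeasurable_funD.
  - by move=> x _; rewrite -!EFinD -EFinM lee_fin amgm3.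
rewrite ge0_integralZl//; first last.
- by move=> x _; rewrite !adde_ge0 ?lee_fin ?exprn_ge0.
- by apply: emeasurable_funD => //; exact: emeasurable_funD.
rewrite ge0_integralD//; first last.
- by move=> x _; rewrite lee_fin exprn_ge0.
- exact: emeasurable_funD.
- by move=> x _; rewrite adde_ge0 ?lee_fin ?exprn_ge0.
rewrite ge0_integralD//; first last.
- by move=> x _; rewrite lee_fin exprn_ge0.
- by move=> x _; rewrite lee_fin exprn_ge0.
rewrite (integral_shift h mc cube_ge0) (integral_shift k mc cube_ge0).
set I := integral _ _ _.
have I0 : (0 <= I)%E by apply: integral_ge0 => x _; exact: cube_ge0.
have [->|Ifin] := eqVneq I +oo%E; first by rewrite leey.
have : I \is a fin_num by rewrite ge0_fin_numE// ltey.
by move=> /fineK <-; rewrite -!EFinD -EFinM lee_fin; lra.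
Qed.

Definition level n j : set V := [set x | j.+1%:R / n.+1%:R <= f x].

Lemma measurable_level n j : measurable (level n j).
Proof.
rewrite (_ : level n j = setT `&` f @^-1` `[j.+1%:R / n.+1%:R, +oo[%classic).
  by apply: mf_ => //; exact: measurable_itv.
by rewrite setTI set_itvE.
Qed.

(* Off these sets, translation by [h] preserves the rounding of [f] to multiples of
   [n.+1^-1]. *)
Definition bad n K h := \bigcup_(j in [set j | (j < K)%N]) symdiff (level n j) h.

(** If the truncated value fell by more than one grid step, some grid value would separate [f x]
    from the value at the translate, and [x] would lie in the symmetric difference of that level
    set. *)
Lemma not_bad n m h x : ~ bad n (m * n.+1) h x ->
  Num.min (f x) m%:R <= Num.min (f (tshift h x)) m%:R + n.+1%:R^-1.
Proof.
move=> nb; rewrite leNgt; apply/negP => lt.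
set a := Num.min (f x) _ in lt; set b := Num.min _ _ in lt.
have am : a <= m%:R by rewrite ge_min lexx orbT.
have af : a <= f x by rewrite ge_min lexx.
have n0 : 0 < n.+1%:R :> R by rewrite ltr0n.
have bE : b = f (tshift h x).
  rewrite /b; apply/min_idPl; rewrite leNgt; apply/negP => mb.
  have bm : b = m%:R by apply/min_idPr; exact: ltW.
  have : m%:R + n.+1%:R^-1 < m%:R :> R by rewrite -[X in X + _]bm (lt_le_trans lt).
  by rewrite gtrDl invr_lt0 ltNge ltW.
have b0 : 0 <= b by rewrite bE.
(* [j.+1] over [n.+1] is the first grid value above [b]; it is still below [a], hence below the cap
   [m]. *)
pose j := Num.truncn (b * n.+1%:R).
have j1 : j%:R <= b * n.+1%:R by rewrite truncn_le// mulr_ge0// ltW.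
have j2 : b * n.+1%:R < j.+1%:R by exact: truncnS_gt.
have ja : j.+1%:R / n.+1%:R < a.
  apply: le_lt_trans lt; rewrite ler_pdivrMr// mulrDl mulVf ?gt_eqF//.
  by rewrite -natr1 lerD2r.
apply: nb; exists j => /=.
  rewrite -(ltr_nat R) natrM -ltr_pdivrMr//; apply: lt_le_trans am.
  by apply: le_lt_trans ja; rewrite ler_pM2r ?invr_gt0// ler_nat.
left; split; first by rewrite /level/= (le_trans (ltW ja)).
by rewrite /level /= -bE leNgt ltr_pdivlMr// => /negP; apply.
Qed.

(** The cap in height leaves finitely many levels to control, and the cap in space matches the boxes
    of [shift_cont]. Monotone convergence recovers the integral of the cube. *)
Definition trunc_cube m x : R := Num.min (f x) m%:R ^+ 3 * \1_(box m%:R) x.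

Lemma trunc_cube_ge0 m x : 0 <= trunc_cube m x.
Proof. by rewrite mulr_ge0// exprn_ge0// le_min f0 ler0n. Qed.

Lemma measurable_trunc_cube m : measurable_fun setT (trunc_cube m).
Proof.
apply: measurable_funM; last exact: measurable_indic (measurable_boxM _).
apply: measurable_funX; exact: measurable_minr.
Qed.

Lemma trunc_cube_nd x : {homo (fun m => trunc_cube m x) : m n / (m <= n)%N >-> m <= n}.
Proof.
move=> m n mn; have mnR : m%:R <= n%:R :> R by rewrite ler_nat.
rewrite /trunc_cube ler_pM ?exprn_ge0 ?le_min ?f0 ?ler0n//.
  rewrite lerXn2r ?nnegrE ?le_min ?f0 ?ler0n// ge_min lexx//=.
  by rewrite ge_min (mnR) orbT.
rewrite !indicE ler_nat.
have [bm|] := boolP (x \in box m%:R) => //.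
rewrite (_ : x \in box n%:R)//; apply/mem_set => i; move/set_mem : bm => /(_ i).
by rewrite /= !in_itv/= => /andP[? ?]; apply/andP; split; lra.
Qed.

Lemma cvg_trunc_cube x : trunc_cube ^~ x @ \oo --> f x ^+ 3.
Proof.
apply: cvg_near_cst.
pose C := f x + \sum_(i < d) `|tnth x i|.
near=> m.
have Cm : C <= m%:R by near: m; exact: nbhs_infty_ger.
have S0 : 0 <= \sum_(i < d) `|tnth x i| by exact: sumr_ge0.
rewrite /trunc_cube (_ : Num.min _ _ = f x); last by apply/min_idPl; apply: le_trans Cm; rewrite lerDl.
rewrite indicE (_ : x \in box m%:R) ?mulr1//.
apply/mem_set => i; rewrite set_itvE/= -ler_norml; apply: le_trans Cm.
rewrite /C (bigD1 i)//= addrCA lerDl addr_ge0// sumr_ge0//.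
Unshelve. all: by end_near. Qed.

(** Four losses of [e / 4]: truncation, rounding, and the bad sets of [h] and of [k]. At good points
    the truncated values [a], [b], [c] satisfy [a <= b + t] and [a <= c + t], with [t] the grid
    step, so [a^3] exceeds [a * b * c] by O(t); at bad points [a^3] is at most [m^3], and those sets
    are small. *)
Lemma triple_int_ge (I e : R) : (\int[mu]_x (f x ^+ 3)%:E = I%:E)%E -> 0 < e ->
  exists2 del : R, 0 < del & forall h k, small del h -> small del k ->
    ((I - e)%:E <= triple_int h k)%E.
Proof.
move=> IE e0.
have cv : (fun m => \int[mu]_x (trunc_cube m x)%:E)%E @ \oo --> I%:E.
  rewrite -IE.
  rewrite (_ : \int[mu]_x _ = \int[mu]_x limn (fun m => (trunc_cube m x)%:E))%E; last first.
    apply: eq_integral => x _; apply/esym/cvg_lim => //.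
    by apply: cvg_EFin; [exact: nearW|exact: cvg_trunc_cube].
  apply: cvg_monotone_convergence => //.
  - by move=> m; apply/measurable_EFinP; exact: measurable_trunc_cube.
  - by move=> m x _; rewrite lee_fin trunc_cube_ge0.
  - by move=> x _ m n mn; rewrite lee_fin trunc_cube_nd.
have Ie : I - e / 4 < I by rewrite ltrBlDr ltrDl divr_gt0.
have [m0 _ /(_ m0.+1 (leqnSn _)) hm] := ecvg_ge cv Ie.
set m := m0.+1 in hm.
have m1 : 1 <= m%:R :> R by rewrite ler1n.
have mgt : 0 < m%:R :> R by rewrite ltr0n.
pose B : R := (2 * m%:R) ^+ d.
have B0 : 0 < B by rewrite exprn_gt0// mulr_gt0.
(* [B] is the volume of the box and [m * (2 * m + 1)] bounds the coefficient [a * (b + c + t)] of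
   the grid step, so the total rounding error is [W / n.+1]. *)
pose W : R := B * (m%:R * (2 * m%:R + 1)).
have W0 : 0 < W by rewrite !mulr_gt0// addr_gt0// mulr_gt0.
pose n := Num.truncn (W / (e / 4)).
have nE : W / n.+1%:R <= e / 4.
  rewrite ler_pdivrMr ?ltr0n// mulrC -ler_pdivrMr ?divr_gt0//.
  by apply: ltW; exact: truncnS_gt.
have e40 : 0 < e / (4 * m%:R ^+ 3) by rewrite divr_gt0// mulr_gt0// exprn_gt0.
have [dl d0 H] := shift_cont_bigcup_ord (fun j => shift_cont_measurable (measurable_level n j)) (m * n.+1) mgt e40.
exists dl => // h k /H Hh /H Hk.
pose Bh := box m%:R `&` bad n (m * n.+1) h.
pose Bk := box m%:R `&` bad n (m * n.+1) k.
have mbad l : measurable (box m%:R `&` bad n (m * n.+1) l).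
  apply: measurableI; first exact: measurable_boxM.
  by apply: bigcup_measurable => j _; apply: measurable_symdiff; exact: measurable_level.
have mBh : measurable Bh by exact: mbad.
have mBk : measurable Bk by exact: mbad.
pose c1 : R := m%:R * (2 * m%:R + 1) / n.+1%:R.
have c10 : 0 <= c1 by rewrite !mulr_ge0 ?addr_ge0 ?mulr_ge0 ?invr_ge0 ?ler0n.
pose c2 : R := m%:R ^+ 3.
have c20 : 0 <= c2 by rewrite exprn_ge0.
have ptw x : trunc_cube m x <= f x * f (tshift h x) * f (tshift k x) +
   (c1 * \1_(box m%:R) x + (c2 * \1_Bh x + c2 * \1_Bk x)).
  have pos : 0 <= f x * f (tshift h x) * f (tshift k x) by rewrite !mulr_ge0.
  have i0 A : 0 <= \1_A x :> R by [].
  rewrite /trunc_cube !indicE.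
  have [bx|] := boolP (x \in box m%:R); last first.
    by move=> nb; rewrite !mulr0 add0r !addr_ge0 ?mulr_ge0.
  rewrite !mulr1.
  have a0 y : 0 <= Num.min (f y) m%:R by rewrite le_min f0 ler0n.
  have am y : Num.min (f y) m%:R <= m%:R by rewrite ge_min lexx orbT.
  have af y : Num.min (f y) m%:R <= f y by rewrite ge_min lexx.
  have ac2 : Num.min (f x) m%:R ^+ 3 <= c2 by rewrite lerXn2r ?nnegrE.
  have [bh|nbh] := boolP (x \in Bh).
    rewrite mulr1; apply: (le_trans ac2).
    rewrite addrCA -[X in X <= _]addr0 [leRHS]addrC addrA.
    have : 0 <= c2 * (x \in Bk)%:R by rewrite mulr_ge0.
    lra.
  have [bk|nbk] := boolP (x \in Bk).
    by rewrite mulr1 mulr0 add0r; apply: (le_trans ac2); lra.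
  rewrite !mulr0 !addr0.
  have N l : x \notin box m%:R `&` bad n (m * n.+1) l -> ~ bad n (m * n.+1) l x.
    by move=> /negP nb bl; apply: nb; apply/mem_set; split => //; exact/set_mem.
  have := not_bad (N _ nbh); have := not_bad (N _ nbk).
  move: (a0 x) (a0 (tshift h x)) (a0 (tshift k x)) (am x) (am (tshift h x)) (am (tshift k x)).
  set a := Num.min (f x) _; set b := Num.min (f (tshift h x)) _; set c := Num.min (f (tshift k x)) _.
  move=> a0' b0' c0' am' bm' cm' ac ab.
  have fabc : a * b * c <= f x * f (tshift h x) * f (tshift k x).
    by rewrite ler_pM ?mulr_ge0// ?ler_pM//; exact: af.
  set t := n.+1%:R^-1 in ac ab c1 c10 *.
  have t0 : 0 <= t by rewrite invr_ge0.
  have t1 : t <= 1 by rewrite invf_le1 ?ler1n// ltr0n.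
  apply: (@le_trans _ _ (a * ((b + t) * (c + t)))).
    rewrite exprS ler_wpM2l// expr2 ler_pM//.
  apply: (@le_trans _ _ (a * b * c + m%:R * (2 * m%:R + 1) * t)); last by rewrite lerD2r.
  rewrite (_ : a * _ = a * b * c + a * (b + c + t) * t); last by ring.
  rewrite lerD2l ler_wpM2r// ler_pM// ?addr_ge0//.
  lra.
have mI A : measurable A -> measurable_fun setT (fun x : V => \1_A x : R).
  by move=> mA; exact: measurable_indic.
have mB := measurable_boxM (R := R) (d := d) m%:R.
have intI (c : R) A : 0 <= c -> measurable A -> (\int[mu]_x (c * \1_A x)%:E = c%:E * mu A)%E.
  move=> cc mA; under eq_integral do rewrite EFinM.
  rewrite ge0_integralZl//; last by apply/measurable_EFinP; exact: mI.
  by rewrite integral_indic// setIT.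
have mcI (c : R) A : measurable A -> measurable_fun setT (fun x : V => (c * \1_A x)%:E).
  by move=> mA; apply/measurable_EFinP; apply: measurable_funM => //; exact: mI.
have : (\int[mu]_x (trunc_cube m x)%:E <= triple_int h k + (c1%:E * mu (box m%:R) + (c2%:E * mu Bh + c2%:E * mu Bk)))%E.
  rewrite -!intI//. rewrite -ge0_integralD//; first last.
  - exact: mcI (mbad _).
  - by move=> x _; rewrite lee_fin mulr_ge0.
  - exact: mcI (mbad _).
  - by move=> x _; rewrite lee_fin mulr_ge0.
  rewrite -ge0_integralD//; first last.
  - by apply: emeasurable_funD; exact: mcI (mbad _).
  - by move=> x _; rewrite adde_ge0 ?lee_fin ?mulr_ge0.
  - exact: mcI.
  - by move=> x _; rewrite lee_fin mulr_ge0.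
  rewrite -ge0_integralD//; first last.
  - by apply: emeasurable_funD; [exact: mcI|by apply: emeasurable_funD; exact: mcI (mbad _)].
  - by move=> x _; rewrite !adde_ge0 ?lee_fin ?mulr_ge0.
  - exact: measurable_triple.
  - by move=> x _; rewrite lee_fin !mulr_ge0.
  apply: ge0_le_integral => //.
  - by move=> x _; rewrite lee_fin trunc_cube_ge0.
  - by apply/measurable_EFinP; exact: measurable_trunc_cube.
  - apply: emeasurable_funD; first exact: measurable_triple.
    by apply: emeasurable_funD; [exact: mcI|by apply: emeasurable_funD; exact: mcI (mbad _)].
  - by move=> x _; rewrite -!EFinD lee_fin.
move=> le0; have le1 := le_trans hm le0.
have e1 : (c1%:E * mu (box m%:R) <= (e / 4)%:E)%E.
  rewrite [X in (_ * X)%E]leb_box// -EFinM lee_fin; apply: le_trans nE.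
  by rewrite le_eqVlt; apply/orP; left; apply/eqP; rewrite /c1 /W /B; ring.
have e2 A : (mu A <= (e / (4 * m%:R ^+ 3))%:E)%E -> (c2%:E * mu A <= (e / 4)%:E)%E.
  move=> /(lee_wpmul2l (_ : 0 <= c2%:E)%E); rewrite lee_fin => /(_ c20) /le_trans; apply.
  rewrite -EFinM lee_fin /c2 le_eqVlt; apply/orP; left; apply/eqP.
  by field; rewrite gt_eqF.
have : ((I - e / 4)%:E <= triple_int h k + ((e / 4)%:E + ((e / 4)%:E + (e / 4)%:E)))%E.
  apply: (le_trans le1); apply: leeD => //; apply: leeD => //; apply: leeD; exact: e2.
move=> le2; have [->|Tfin] := eqVneq (triple_int h k) +oo%E; first by rewrite leey.
have : triple_int h k \is a fin_num.
  rewrite ge0_fin_numE ?ltey//; apply: integral_ge0 => x _.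
  by rewrite lee_fin !mulr_ge0.
by move: le2 => + /fineK Tf; rewrite -Tf -!EFinD !lee_fin; lra.
Qed.

End triple.

(** * Expected counts *)

Section density.
Context d0 (T : measurableType d0) (R : realType).
Variables (mu Q : {measure set T -> \bar R}) (f : T -> R).
Hypotheses (mf_ : measurable_fun setT f) (f0 : forall x, 0 <= f x).
Local Open Scope ereal_scope.
Hypothesis QE : forall B, measurable B -> Q B = \int[mu]_x (f x * \1_B x)%:E.
Import HBNNSimple.

Let integral_density_nnsfun (h : {nnsfun T >-> R}) :
  \int[Q]_x (h x)%:E = \int[mu]_x ((f x)%:E * (h x)%:E).
Proof.
transitivity (\sum_(k \in range h) \int[Q]_x (k * \1_(h @^-1` [set k]) x)%:E).
  rewrite -ge0_integral_fsum//; last 2 first.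
  - by move=> k; apply/measurable_EFinP; apply: measurable_funM.
  - by move=> k x _; rewrite EFinM nnfun_muleindic_ge0.
  by apply: eq_integral => x _; rewrite fimfunE -fsumEFin.
transitivity (\sum_(k \in range h) \int[mu]_x ((f x)%:E * (k * \1_(h @^-1` [set k]) x)%:E)); last first.
  rewrite -ge0_integral_fsum//; last 2 first.
  - by move=> k; apply: emeasurable_funM; apply/measurable_EFinP => //; apply: measurable_funM.
  - by move=> k x _; apply: mule_ge0; [rewrite lee_fin|rewrite EFinM nnfun_muleindic_ge0].
  apply: eq_integral => x _; rewrite [in RHS]fimfunE -fsumEFin// ge0_mule_fsumr//.
  by move=> k; rewrite EFinM nnfun_muleindic_ge0.
apply: eq_fsbigr => k /set_mem [x _ <-].
under eq_integral do rewrite EFinM.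
rewrite ge0_integralZl ?lee_fin//; last by apply/measurable_EFinP.
rewrite integral_indic// setIT QE// -ge0_integralZl ?lee_fin//; last 2 first.
- by apply/measurable_EFinP; apply: measurable_funM.
- by move=> y _; rewrite lee_fin mulr_ge0.
by apply: eq_integral => y _; rewrite -!EFinM; congr (_%:E); ring.
Qed.

(** The density is given through its integrals over sets only; simple functions and monotone
    convergence extend this to nonnegative integrands. *)
Lemma integral_density (g : T -> \bar R) : measurable_fun setT g -> (forall x, 0 <= g x) ->
  \int[Q]_x g x = \int[mu]_x ((f x)%:E * g x).
Proof.
move=> mg g0.
pose g_ := nnsfun_approx measurableT mg.
have cg x : EFin \o g_ ^~ x @ \oo --> g x by exact: cvg_nnsfun_approx.
have ndg x : nondecreasing_seq (fun n => (g_ n x)%:E).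
  by move=> a b ab; rewrite lee_fin; exact/lefP/nd_nnsfun_approx.
transitivity (limn (fun n => \int[Q]_x (g_ n x)%:E)).
  rewrite -monotone_convergence//.
  - by apply: eq_integral => x _; apply/esym/cvg_lim => //; exact: cg.
  - by move=> n; exact/measurable_EFinP.
  - by move=> n x _; rewrite lee_fin.
under eq_fun do rewrite integral_density_nnsfun.
rewrite -monotone_convergence//.
- apply: eq_integral => x _; apply/cvg_lim => //.
  by apply: cvgeZl => //; exact: cg.
- by move=> n; apply: emeasurable_funM; exact/measurable_EFinP.
- by move=> n x _; rewrite mule_ge0 ?lee_fin.
- by move=> x _ a b ab; apply: lee_wpmul2l; [rewrite lee_fin|exact: ndg].
Qed.

End density.

Section dist.
Context (R : realType) (d : nat).
Notation V := (d.-tuple R).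
Implicit Types x y z u v : V.

Definition dist2 x y : R := \sum_(k < d) (tnth x k - tnth y k) ^+ 2.

Lemma edist_le x y (r : R) : 0 < r -> (Defs.edist x y <= r) = (dist2 x y <= r ^+ 2).
Proof.
move=> r0; rewrite -[Defs.edist _ _ <= r](ler_pXn2r (ltn0Sn 1)) ?nnegrE ?sqrtr_ge0 ?(ltW r0)//.
by rewrite sqr_sqrtr// sumr_ge0// => i _; exact: sqr_ge0.
Qed.

Lemma dist2_taff x (r : R) u : dist2 x (taff x r u) = r ^+ 2 * nrm2 u.
Proof.
rewrite /dist2 /nrm2 big_distrr/=; apply: eq_bigr => k _.
by rewrite tnth_mktuple; ring.
Qed.

Lemma dist2_taff2 x (r : R) u v :
  dist2 (taff x r u) (taff x r v) = r ^+ 2 * (nrm2 u + nrm2 v - 2 * dot u v).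
Proof.
rewrite /dist2 /nrm2 /dot -big_split/= big_distrr/= -sumrB big_distrr/=.
by apply: eq_bigr => k _; rewrite !tnth_mktuple; ring.
Qed.

Lemma taff_tshift x (r : R) u : taff x r u = tshift (taff (tzero R d) r u) x.
Proof. by apply: eq_from_tnth => i; rewrite !tnth_mktuple; ring. Qed.

Lemma measurable_dist2 : measurable_fun setT (fun p : V * V => dist2 p.1 p.2).
Proof.
apply: measurable_sum => i; apply: measurable_funX; apply: measurable_funB.
  by apply: (measurableT_comp (@measurable_tnth _ _ _ i)).
by apply: (measurableT_comp (@measurable_tnth _ _ _ i)).
Qed.

End dist.

Section three_points.
Context (R : realType) (d : nat).
Notation V := (d.-tuple R).
Notation mu := (leb R d).
Notation ib := (@ib R).
Variables (f : V -> R) (Q : {sigma_finite_measure set V -> \bar R}).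
Hypotheses (mf_ : measurable_fun setT f) (f0 : forall x, 0 <= f x).
Hypothesis QE : forall B, measurable B -> Q B = (\int[mu]_x (f x * \1_B x)%:E)%E.
Local Open Scope ereal_scope.

Definition int3 (E : V -> V -> V -> bool) : \bar R :=
  \int[Q]_x \int[Q]_y \int[Q]_z ib (E x y z).

Definition meas3 (E : V -> V -> V -> bool) :=
  measurable_fun setT (fun p : V * V * V => E p.1.1 p.1.2 p.2).
Definition meas2 (K : V -> V -> bool) := measurable_fun setT (fun p : V * V => K p.1 p.2).

Lemma int3_density E : meas3 E ->
  int3 E = \int[mu]_x \int[mu]_y \int[mu]_z ((f x * f y * f z)%:E * ib (E x y z)).
Proof.
move=> mE; rewrite /int3.
have mf1 : measurable_fun setT (fun x => (f x)%:E) by apply/measurable_EFinP.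
have mE' : measurable_fun setT (fun p : V * V * V => ib (E p.1.1 p.1.2 p.2)).
  exact: measurable_ib.
have m2 : measurable_fun setT (fun p : V * V => \int[Q]_z ib (E p.1 p.2 z)).
  by apply: measurable_integral_snd => // *; exact: ib_ge0.
have m2' x : measurable_fun setT (fun y => \int[Q]_z ib (E x y z)).
  exact: (measurableT_comp m2 (pair1_measurable x)).
have m1 : measurable_fun setT (fun x => \int[Q]_y \int[Q]_z ib (E x y z)).
  apply: measurable_integral_snd => // x y.
  by apply: integral_ge0 => *; exact: ib_ge0.
have mz x y : measurable_fun setT (fun z => ib (E x y z)).
  exact: (measurableT_comp mE' (pair1_measurable (x, y))).
have ge1 x y : 0 <= \int[Q]_z ib (E x y z) by apply: integral_ge0 => *; exact: ib_ge0.
have ge2 x y : 0 <= \int[mu]_z ((f z)%:E * ib (E x y z)).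
  by apply: integral_ge0 => z _; rewrite mule_ge0 ?ib_ge0 ?lee_fin.
have E1 x y : \int[Q]_z ib (E x y z) = \int[mu]_z ((f z)%:E * ib (E x y z)).
  by apply: (integral_density mf_ f0 QE) => // z; exact: ib_ge0.
rewrite (integral_density mf_ f0 QE)//; last by move=> x; exact: integral_ge0.
apply: eq_integral => x _.
rewrite (integral_density mf_ f0 QE)//.
rewrite -ge0_integralZl ?lee_fin//; first last.
- by move=> y _; rewrite mule_ge0 ?lee_fin.
- exact: emeasurable_funM.
apply: eq_integral => y _; rewrite E1 muleA -EFinM.
rewrite -ge0_integralZl ?lee_fin ?mulr_ge0//; first last.
- by move=> z _; rewrite mule_ge0 ?ib_ge0 ?lee_fin.
- exact: emeasurable_funM.
by apply: eq_integral => z _; rewrite [RHS]/= [in RHS]EFinM muleA.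
Qed.

Definition tscale (r : R) (u : V) : V := taff (tzero R d) r u.

Lemma measurable_taff2 (r : R) : measurable_fun setT (fun p : V * V => taff p.1 r p.2).
Proof.
apply/measurable_fun_tnthP => i.
rewrite (_ : _ \o _ = fun p : V * V => (tnth p.1 i + r * tnth p.2 i)%R); last first.
  by apply/funext => p /=; rewrite tnth_mktuple.
apply: measurable_funD.
  by apply: (measurableT_comp (@measurable_tnth _ _ _ i)).
apply: measurable_funM => //.
by apply: (measurableT_comp (@measurable_tnth _ _ _ i)).
Qed.

(** Substitute [y = x + r u] and [z = x + r v]. The relation then no longer depends on [x], so
    integrating over [x] first leaves [triple_int] at the offsets [r u] and [r v]. *)
Lemma int3_rescale E K (r : R) : (0 < r)%R -> meas3 E -> meas2 K ->
  (forall x u v, E x (taff x r u) (taff x r v) = K u v) ->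
  int3 E = (r ^+ d * r ^+ d)%:E *
    \int[mu]_u \int[mu]_v (ib (K u v) * triple_int f (tscale r u) (tscale r v)).
Proof.
move=> r0 mE mK EK; rewrite int3_density//.
have rd0 : (0 <= r ^+ d)%R by rewrite exprn_ge0// ltW.
have mfc (S : measurableType _) (g : S -> V) : measurable_fun setT g ->
    measurable_fun setT (fun s => f (g s)) by move=> mg; exact: measurableT_comp.
pose H (q : V * V * V) : \bar R :=
  (f q.1.1 * f q.1.2 * f q.2)%:E * ib (E q.1.1 q.1.2 q.2).
have mH : measurable_fun setT H.
  apply: emeasurable_funM; last exact: measurable_ib.
  apply/measurable_EFinP; apply: measurable_funM; last by apply: (measurableT_comp mf_).
  apply: measurable_funM.
    by apply: (measurableT_comp mf_); apply: (measurableT_comp measurable_fst).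
  by apply: (measurableT_comp mf_); apply: (measurableT_comp measurable_snd).
have H0 q : 0 <= H q by rewrite /H mule_ge0 ?ib_ge0// lee_fin !mulr_ge0.
pose G (q : V * V * V) : \bar R := H ((q.1.1, taff q.1.1 r q.1.2), taff q.1.1 r q.2).
have m11 : measurable_fun setT (fun q : V * V * V => q.1.1).
  by apply: (measurableT_comp measurable_fst).
have m12 : measurable_fun setT (fun q : V * V * V => q.1.2).
  by apply: (measurableT_comp measurable_snd).
have mt1 : measurable_fun setT (fun q : V * V * V => taff q.1.1 r q.1.2).
  by apply: (measurableT_comp (measurable_taff2 r)).
have mt2 : measurable_fun setT (fun q : V * V * V => taff q.1.1 r q.2).
  by apply: (measurableT_comp (measurable_taff2 r) (g := fun q : V * V * V => (q.1.1, q.2))); mf.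
have mG : measurable_fun setT G by apply: (measurableT_comp mH); mf.
have G0 q : 0 <= G q by exact: H0.
transitivity (\int[mu]_x ((r ^+ d * r ^+ d)%:E * \int[mu]_u \int[mu]_v G (x, u, v))).
  apply: eq_integral => x _.
  transitivity ((r ^+ d)%:E * \int[mu]_u \int[mu]_z H (x, taff x r u, z)).
    apply/esym; apply: (@integral_taff _ _ x r (fun y => \int[mu]_z H (x, y, z))) => //.
      apply: measurable_integral_snd => //.
      by apply: (measurableT_comp mH); mf.
    by move=> y; exact: integral_ge0.
  rewrite EFinM -muleA; congr (_ * _).
  rewrite -ge0_integralZl//; first last.
  - by move=> u _; exact: integral_ge0.
  - by apply: measurable_integral_snd => //; apply: (measurableT_comp mG); mf.
  apply: eq_integral => u _.
  rewrite -(@integral_taff _ _ x r (fun z => H (x, taff x r u, z)))//.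
  by apply: (measurableT_comp mH); mf.
pose F x := \int[mu]_u \int[mu]_v G (x, u, v).
have mF : measurable_fun setT F.
  apply: measurable_integral_snd; last by move=> *; exact: integral_ge0.
  by apply: measurable_integral_snd => //; apply: (measurableT_comp mG); mf.
have F0 x : 0 <= F x by apply: integral_ge0 => u _; exact: integral_ge0.
transitivity ((r ^+ d * r ^+ d)%:E * \int[mu]_x F x).
  by apply: ge0_integralZl => //; [move=> x _; exact: F0|rewrite lee_fin mulr_ge0].
apply: congr1.
rewrite integral_swap; first last.
- by move=> *; exact: integral_ge0.
- by apply: measurable_integral_snd => //; apply: (measurableT_comp mG); mf.
apply: eq_integral => u _.
rewrite integral_swap//; last by apply: (measurableT_comp mG); mf.
apply: eq_integral => v _.
rewrite /triple_int -ge0_integralZl ?ib_ge0//; first last.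
- by move=> x _; rewrite lee_fin !mulr_ge0.
- exact: measurable_triple.
by apply: eq_integral => x _; rewrite /G /H /= EK muleC (taff_tshift x r u) (taff_tshift x r v).
Qed.

Lemma small_tscale (r e : R) u : (0 <= r <= e)%R -> small 1 u -> small e (tscale r u).
Proof.
move=> /andP[r0 re] su i; rewrite !tnth_mktuple add0r normrM (ger0_norm r0).
by apply: le_trans re; rewrite ler_piMr//; exact: su.
Qed.

(** The threshold [del] is chosen before [E] and [K], so cherries and triangles are estimated at the
    same radius. The condition [e <= I] makes the lower factor nonnegative, so that it can be moved
    through the integrals. *)
Lemma int3_asymp (I e : R) : \int[mu]_x (f x ^+ 3)%:E = I%:E -> (0 < e)%R -> (e <= I)%R ->
  exists2 del : R, (0 < del)%R & forall r, (0 < r <= del)%R ->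
  forall E K, meas3 E -> meas2 K ->
    (forall x u v, E x (taff x r u) (taff x r v) = K u v) ->
    (forall u v, K u v -> small 1 u /\ small 1 v) ->
    (r ^+ d * r ^+ d * (I - e))%:E * \int[mu]_u \int[mu]_v ib (K u v) <= int3 E /\
    int3 E <= (r ^+ d * r ^+ d * I)%:E * \int[mu]_u \int[mu]_v ib (K u v).
Proof.
move=> IE e0 eI; have [dl d0 Hd] := triple_int_ge mf_ f0 IE e0.
exists dl => // r /andP[r0 rd] E K mE mK EK Ks.
rewrite (int3_rescale r0 mE mK EK).
have rr0 : (0 <= r ^+ d * r ^+ d)%R by rewrite mulr_ge0// exprn_ge0// ltW.
have mK' : measurable_fun setT (fun p : V * V => ib (K p.1 p.2)) by exact: measurable_ib.
have Ie : (0 <= I - e)%R by lra.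
have I0 : (0 <= I)%R by lra.
have J0 h k : 0 <= triple_int f h k by apply: integral_ge0 => x _; rewrite lee_fin !mulr_ge0.
have mts : measurable_fun setT (tscale r) by exact: measurable_taff.
have mJ : measurable_fun setT (fun p : V * V => triple_int f (tscale r p.1) (tscale r p.2)).
  apply: (measurable_integral_snd (T1 := (V * V)%type) mu (g := fun p x => (f x * f (tshift (tscale r p.1) x) * f (tshift (tscale r p.2) x))%:E)); last first.
    by move=> p x; rewrite lee_fin !mulr_ge0.
  have mfs (g : V * V * V -> V) : measurable_fun setT g ->
      measurable_fun setT (fun q : V * V * V => f (tshift (tscale r (g q)) q.2)).
    move=> mg; apply: (measurableT_comp mf_).
    apply: (measurableT_comp (measurable_taff2 1) (g := fun q : V * V * V => (tscale r (g q), q.2))).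
    by apply: measurable_fun_pair => //; exact: measurableT_comp.
  apply/measurable_EFinP; apply: measurable_funM; first apply: measurable_funM.
  - by apply: (measurableT_comp mf_).
  - by apply: mfs; apply: (measurableT_comp measurable_fst).
  - by apply: mfs; apply: (measurableT_comp measurable_snd).
have pull (c : R) : (0 <= c)%R ->
    (r ^+ d * r ^+ d * c)%:E * \int[mu]_u \int[mu]_v ib (K u v) =
    (r ^+ d * r ^+ d)%:E * \int[mu]_u \int[mu]_v (c%:E * ib (K u v)).
  move=> c0; rewrite EFinM -muleA; congr (_ * _).
  rewrite -ge0_integralZl//; first last.
  - by move=> u _; apply: integral_ge0 => *; exact: ib_ge0.
  - by apply: measurable_integral_snd => // *; exact: ib_ge0.
  apply: eq_integral => u _; rewrite ge0_integralZl//.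
    exact: (measurableT_comp mK' (pair1_measurable u)).
  by move=> v _; exact: ib_ge0.
have cmp (g1 g2 : V * V -> \bar R) : measurable_fun setT g1 -> measurable_fun setT g2 ->
    (forall p, 0 <= g1 p) -> (forall p, 0 <= g2 p) -> (forall p, g1 p <= g2 p) ->
    (r ^+ d * r ^+ d)%:E * \int[mu]_u \int[mu]_v g1 (u, v) <=
    (r ^+ d * r ^+ d)%:E * \int[mu]_u \int[mu]_v g2 (u, v).
  move=> m1 m2 p1 p2 p12; apply: lee_wpmul2l; first by rewrite lee_fin.
  apply: ge0_le_integral => //.
  - by move=> u _; exact: integral_ge0.
  - by apply: measurable_integral_snd => //; apply: (measurableT_comp m1); mf.
  - by apply: measurable_integral_snd => //; apply: (measurableT_comp m2); mf.
  move=> u _; apply: ge0_le_integral => //.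
  - exact: (measurableT_comp m1 (pair1_measurable u)).
  - exact: (measurableT_comp m2 (pair1_measurable u)).
rewrite (pull _ Ie) (pull _ I0); split.
- apply: (cmp (fun p => (I - e)%:E * ib (K p.1 p.2))
    (fun p => ib (K p.1 p.2) * triple_int f (tscale r p.1) (tscale r p.2))).
  + exact: emeasurable_funM.
  + exact: emeasurable_funM.
  + by move=> p; rewrite mule_ge0 ?ib_ge0 ?lee_fin.
  + by move=> p; rewrite mule_ge0 ?ib_ge0.
  move=> p; have [Kp|] := boolP (K p.1 p.2); last by rewrite ib0 mule0 mul0e.
  have [s1 s2] := Ks _ _ Kp.
  by rewrite ib1 mule1 mul1e; apply: Hd; apply: small_tscale => //; rewrite (ltW r0).
- apply: (cmp (fun p => ib (K p.1 p.2) * triple_int f (tscale r p.1) (tscale r p.2))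
    (fun p => I%:E * ib (K p.1 p.2))).
  + exact: emeasurable_funM.
  + exact: emeasurable_funM.
  + by move=> p; rewrite mule_ge0 ?ib_ge0.
  + by move=> p; rewrite mule_ge0 ?ib_ge0 ?lee_fin.
  move=> p; have [Kp|] := boolP (K p.1 p.2); last by rewrite ib0 mule0 mul0e.
  by rewrite ib1 mule1 mul1e -IE; exact: triple_int_le.
Qed.

End three_points.

(** * Stars *)

Section powers.
Context (R : realType).

(** Convexity: the graph of the power lies above its tangent at [m]. The negative term is moved
    across, since the inequality is to be integrated in the extended nonnegative reals. *)
Lemma tangent_power k (a m : R) : 0 <= a -> 0 <= m ->
  m ^+ k.+1 + k.+1%:R * m ^+ k * a <= a ^+ k.+1 + k.+1%:R * m ^+ k.+1.
Proof.
move=> a0 m0; elim: k => [|k IH]; first by rewrite !expr1 expr0; lra.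
have h1 : 0 <= k.+1%:R * m ^+ k * (a - m) ^+ 2.
  by apply: mulr_ge0; [apply: mulr_ge0 => //; exact: exprn_ge0|exact: sqr_ge0].
have := ler_wpM2l a0 IH.
rewrite (exprS a k.+1) -[k.+2%:R]natr1 !(exprS m) in h1 *; lra.
Qed.

Lemma young_power k (a m : R) : 0 <= a -> 0 <= m -> a * m ^+ k <= a ^+ k.+1 + m ^+ k.+1.
Proof.
move=> a0 m0; have [am|ma] := leP a m.
  apply: (@le_trans _ _ (m ^+ k.+1)); last by rewrite lerDr exprn_ge0.
  by rewrite exprS ler_wpM2r// exprn_ge0.
apply: ler_wpDr; first exact: exprn_ge0.
by rewrite exprS ler_wpM2l// lerXn2r ?nnegrE// ltW.
Qed.

(** One term wins below 1, the other above. Integrated, it bounds the moments of order 1 to 5 by the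
    sum of the first and the fifth. *)
Lemma power_le_1_5 (a : R) j : 0 <= a -> (0 < j <= 5)%N -> a ^+ j <= a + a ^+ 5.
Proof.
move=> a0 /andP[j0 j5]; have [a1|a1] := leP a 1.
  apply: ler_wpDr; first exact: exprn_ge0.
  by case: j j0 {j5} => // j _; rewrite exprS ler_piMr// exprn_ile1.
apply: ler_wpDl => //; apply: ler_weXn2l => //; exact: ltW.
Qed.

End powers.

Section star.
Context (R : realType) (d : nat).
Notation V := (d.-tuple R).
Notation mu := (leb R d).
Notation ib := (@ib R).
Variables (f : V -> R) (Q : {sigma_finite_measure set V -> \bar R}).
Hypotheses (mf_ : measurable_fun setT f) (f0 : forall x, 0 <= f x).
Hypothesis QE : forall B, measurable B -> Q B = (\int[mu]_x (f x * \1_B x)%:E)%E.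
Hypothesis Q1 : Q setT = 1%E.

Definition cball (rho : R) (x : V) : set V := [set y | dist2 x y <= rho ^+ 2].
Definition bvol (rho : R) : R := rho ^+ d * fine (ballvol d 1 : \bar R).
(** Given the centre [x], the [k] other points fall into the ball independently, hence the power;
    [powm_star_set] makes this precise. *)
Definition star_prob (rho : R) k : \bar R := (\int[Q]_x (fine (Q (cball rho x)) ^+ k)%:E)%E.

Lemma measurable_near rho : measurable_fun setT (fun p : V * V => dist2 p.1 p.2 <= rho ^+ 2).
Proof. by apply: measurable_fun_ler => //; exact: measurable_dist2. Qed.

Lemma measurable_near1 rho x : measurable_fun setT (fun y : V => dist2 x y <= rho ^+ 2).
Proof. exact: (measurableT_comp (measurable_near rho) (pair1_measurable x)). Qed.

Lemma measurable_cball rho x : measurable (cball rho x).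
Proof.
by rewrite -[X in measurable X]setTI; exact: (measurable_near1 rho x _ (Y := [set true])).
Qed.

Lemma dist2C (x y : V) : dist2 x y = dist2 y x.
Proof. by apply: eq_bigr => i _; ring. Qed.

Lemma integral_near rho x : 0 < rho -> (\int[mu]_y ib (dist2 x y <= rho ^+ 2)%R = (bvol rho)%:E)%E.
Proof.
move=> r0; rewrite -(@integral_taff _ _ x rho (fun y => ib (dist2 x y <= rho ^+ 2)%R))//; first last.
- by move=> y; exact: ib_ge0.
- by apply: measurable_ib; exact: measurable_near1.
rewrite /bvol EFinM fineK ?ballvol_fin_num//; congr (_ * _)%E.
apply: eq_integral => y _; rewrite dist2_taff -[X in (_ <= X)%R]mulr1 ler_pM2l//.
exact: exprn_gt0.
Qed.

Lemma Q_fin A : measurable A -> Q A \is a fin_num.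
Proof.
move=> mA; rewrite ge0_fin_numE//; apply: (@le_lt_trans _ _ (Q setT)); last by rewrite Q1 ltry.
by apply: le_measure; rewrite ?inE.
Qed.

Lemma Q_cball rho x : Q (cball rho x) = (\int[mu]_y ((f y)%:E * ib (dist2 x y <= rho ^+ 2)%R))%E.
Proof.
rewrite -(integral_density mf_ f0 QE).
- by rewrite integral_ib//; exact: measurable_near1.
- by apply: measurable_ib; exact: measurable_near1.
- by move=> y; exact: ib_ge0.
Qed.

Lemma measurable_Q_cball rho : measurable_fun setT (fun x => Q (cball rho x)).
Proof.
rewrite (_ : (fun _ => _) = fun x => (\int[Q]_y ib (dist2 x y <= rho ^+ 2)%R)%E).
  by apply: measurable_integral_snd => [|*]; [apply: measurable_ib; exact: measurable_near|exact: ib_ge0].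
by apply/funext => x; rewrite integral_ib//; exact: measurable_near1.
Qed.

(* Jensen's inequality on the ball, from the tangent line at the mean [m]. *)
Lemma jensen_cball rho x k : 0 < rho -> 0 < bvol rho ->
  (((fine (Q (cball rho x)) / bvol rho) ^+ k.+1 * bvol rho)%:E <=
   \int[mu]_y ((f y ^+ k.+1)%:E * ib (dist2 x y <= rho ^+ 2)%R))%E.
Proof.
move=> r0 b0; set q := fine _; set b := bvol rho in b0 *; set m := q / b.
have q0 : 0 <= q by rewrite fine_ge0.
have m0 : 0 <= m by rewrite divr_ge0// ltW.
have qE : (\int[mu]_y ((f y)%:E * ib (dist2 x y <= rho ^+ 2)%R) = q%:E)%E.
  by rewrite -Q_cball fineK// Q_fin//; exact: measurable_cball.
have mn : measurable_fun setT (fun y => ib (dist2 x y <= rho ^+ 2)%R).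
  by apply: measurable_ib; exact: measurable_near1.
have mfk j : measurable_fun setT (fun y => (f y ^+ j)%:E).
  by apply/measurable_EFinP; exact: measurable_funX.
have mfn : measurable_fun setT (fun y => (f y)%:E * ib (dist2 x y <= rho ^+ 2)%R)%E.
  by apply: emeasurable_funM => //; apply/measurable_EFinP.
have mfkn : measurable_fun setT (fun y => (f y ^+ k.+1)%:E * ib (dist2 x y <= rho ^+ 2)%R)%E.
  exact: emeasurable_funM.
have n0 y : (0 <= ib (dist2 x y <= rho ^+ 2)%R)%E by exact: ib_ge0.
have fn0 y : (0 <= (f y)%:E * ib (dist2 x y <= rho ^+ 2)%R)%E by rewrite mule_ge0 ?lee_fin.
have fkn0 y : (0 <= (f y ^+ k.+1)%:E * ib (dist2 x y <= rho ^+ 2)%R)%E.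
  by rewrite mule_ge0 ?lee_fin// exprn_ge0.
have c1 : 0 <= m ^+ k.+1 by rewrite exprn_ge0.
have c2 : 0 <= k.+1%:R * m ^+ k by rewrite mulr_ge0// exprn_ge0.
have c3 : 0 <= k.+1%:R * m ^+ k.+1 by rewrite mulr_ge0.
have key : (\int[mu]_y ((m ^+ k.+1)%:E * ib (dist2 x y <= rho ^+ 2)%R +
     (k.+1%:R * m ^+ k)%:E * ((f y)%:E * ib (dist2 x y <= rho ^+ 2)%R)) <=
   \int[mu]_y ((f y ^+ k.+1)%:E * ib (dist2 x y <= rho ^+ 2)%R +
     (k.+1%:R * m ^+ k.+1)%:E * ib (dist2 x y <= rho ^+ 2)%R))%E.
  apply: ge0_le_integral => //.
  - by move=> y _; rewrite adde_ge0 ?mule_ge0 ?lee_fin.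
  - by apply: emeasurable_funD; exact: emeasurable_funM.
  - by apply: emeasurable_funD => //; exact: emeasurable_funM.
  move=> y _; case: (dist2 x y <= _); last by rewrite ib0 !mule0.
  by rewrite ib1 !mule1 -EFinM -!EFinD lee_fin tangent_power.
have ID (F G : V -> \bar R) : measurable_fun setT F -> measurable_fun setT G ->
    (forall y, (0 <= F y)%E) -> (forall y, (0 <= G y)%E) ->
    (\int[mu]_y (F y + G y) = \int[mu]_y F y + \int[mu]_y G y)%E.
  by move=> mF mG F0 G0; exact: ge0_integralD.
have IZ (c : R) (F : V -> \bar R) : 0 <= c -> measurable_fun setT F ->
    (forall y, (0 <= F y)%E) -> (\int[mu]_y (c%:E * F y) = c%:E * \int[mu]_y F y)%E.
  by move=> c0 mF F0; exact: ge0_integralZl.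
rewrite !ID in key; last 8 first.
- by [].
- exact: emeasurable_funM.
- by [].
- by move=> y; rewrite mule_ge0.
- exact: emeasurable_funM.
- exact: emeasurable_funM.
- by move=> y; rewrite mule_ge0.
- by move=> y; rewrite mule_ge0.
rewrite !IZ// qE integral_near// -/b in key.
set J := integral _ _ _ in key *.
have [->|Jfin] := eqVneq J +oo%E; first by rewrite leey.
have J0 : (0 <= J)%E by exact: integral_ge0.
have /fineK JE : J \is a fin_num by rewrite ge0_fin_numE// ltey.
move: key; rewrite -JE -!EFinM -!EFinD !lee_fin.
have -> : k.+1%:R * m ^+ k * q = k.+1%:R * m ^+ k.+1 * b.
  by rewrite exprSr /m; field; rewrite gt_eqF.
lra.
Qed.

(** Let [q] be the mass of the ball around [x] and [b] its volume, so [q / b] is the mean of [f]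
    there. Young's inequality bounds [f x * (q / b)^k] by the sum of the two [k.+1]-st powers. The
    first integrates to [F]; by Jensen the second is at most the ball average of [f^k.+1], which
    integrates to [F] by Tonelli. *)
Lemma star_prob_le rho k (F : R) : 0 < rho -> 0 < bvol rho ->
  (\int[mu]_x (f x ^+ k.+1)%:E = F%:E)%E ->
  (star_prob rho k <= (bvol rho ^+ k * (F + F))%:E)%E.
Proof.
move=> r0 b0 FE; set b := bvol rho in b0 *.
have mq : measurable_fun setT (fun x => fine (Q (cball rho x))).
  apply/measurable_EFinP; rewrite (_ : _ \o _ = fun x => Q (cball rho x)).
    exact: measurable_Q_cball.
  by apply/funext => x /=; rewrite fineK// Q_fin//; exact: measurable_cball.
have q0 x : 0 <= fine (Q (cball rho x)) by rewrite fine_ge0.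
have mfk : measurable_fun setT (fun y => (f y ^+ k.+1)%:E).
  by apply/measurable_EFinP; exact: measurable_funX.
have mn : measurable_fun setT (fun p : V * V => ((f p.2 ^+ k.+1)%:E * ib (dist2 p.1 p.2 <= rho ^+ 2)%R)%E).
  apply: emeasurable_funM; last by apply: measurable_ib; exact: measurable_near.
  by apply: (measurableT_comp mfk).
have pos x y : (0 <= (f y ^+ k.+1)%:E * ib (dist2 x y <= rho ^+ 2)%R)%E.
  by rewrite mule_ge0 ?ib_ge0 ?lee_fin ?exprn_ge0.
pose M x : \bar R := (\int[mu]_y ((f y ^+ k.+1)%:E * ib (dist2 x y <= rho ^+ 2)%R))%E.
have mM : measurable_fun setT M by exact: measurable_integral_snd.
have M0 x : (0 <= M x)%E by exact: integral_ge0.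
have ME : (\int[mu]_x M x = (b * F)%:E)%E.
  rewrite /M integral_swap//.
  transitivity (\int[mu]_y ((f y ^+ k.+1)%:E * b%:E))%E.
    apply: eq_integral => y _; rewrite ge0_integralZl//.
    - by congr (_ * _)%E; under eq_integral do rewrite dist2C; exact: integral_near.
    - by apply: measurable_ib; under eq_fun do rewrite dist2C; exact: measurable_near1.
    - by move=> x _; exact: ib_ge0.
    - by rewrite lee_fin exprn_ge0.
  rewrite ge0_integralZr//; [|by move=> y _; rewrite lee_fin exprn_ge0|by rewrite lee_fin ltW].
  by rewrite FE -EFinM mulrC.
rewrite /star_prob (integral_density mf_ f0 QE); first last.
- by move=> x; rewrite lee_fin exprn_ge0.
- by apply/measurable_EFinP; exact: measurable_funX.
apply: (@le_trans _ _ (\int[mu]_x ((b ^+ k)%:E * ((f x ^+ k.+1)%:E + (b^-1)%:E * M x)))%E).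
  apply: ge0_le_integral => //.
  - by move=> x _; rewrite mule_ge0 ?lee_fin ?exprn_ge0.
  - by apply: emeasurable_funM; apply/measurable_EFinP => //; exact: measurable_funX.
  - apply: emeasurable_funM => //; apply: emeasurable_funD => //; exact: emeasurable_funM.
  move=> x _; set q := fine _.
  have h1 : (((q / b) ^+ k.+1)%:E <= (b^-1)%:E * M x)%E.
    have := jensen_cball x k r0 b0; rewrite -/q -/b -/(M x).
    have bi : (0 <= (b^-1)%:E :> \bar R)%E by rewrite lee_fin invr_ge0 ltW.
    move=> /(lee_wpmul2l bi); rewrite -EFinM; apply: le_trans; rewrite lee_fin.
    by rewrite mulrCA mulVf ?mulr1// gt_eqF.
  apply: (@le_trans _ _ ((b ^+ k)%:E * ((f x ^+ k.+1)%:E + ((q / b) ^+ k.+1)%:E))%E).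
    rewrite -EFinM -EFinD -EFinM lee_fin.
    have qb : 0 <= q / b by rewrite divr_ge0 ?(ltW b0)// fine_ge0.
    have bk : 0 <= b ^+ k by rewrite exprn_ge0// ltW.
    apply: le_trans (ler_wpM2l bk (young_power k (f0 x) qb)).
    by rewrite expr_div_n mulrCA [b ^+ k * _]mulrC divfK// expf_neq0// gt_eqF.
  apply: lee_wpmul2l; first by rewrite lee_fin exprn_ge0// ltW.
  exact: leeD2l.
rewrite ge0_integralZl//; first last.
- by rewrite lee_fin exprn_ge0// ltW.
- by move=> x _; rewrite adde_ge0 ?lee_fin ?exprn_ge0// mule_ge0// lee_fin invr_ge0 ltW.
- by apply: emeasurable_funD => //; exact: emeasurable_funM.
rewrite ge0_integralD//; first last.
- exact: emeasurable_funM.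
- by move=> x _; rewrite mule_ge0// lee_fin invr_ge0 ltW.
- by move=> x _; rewrite lee_fin exprn_ge0.
rewrite ge0_integralZl//; last by rewrite lee_fin invr_ge0 ltW.
rewrite ME FE -[((b^-1)%:E * _)%E]EFinM -EFinD -EFinM lee_fin mulrA mulVf ?gt_eqF// mul1r.
by [].
Qed.

End star.

(** * Second moments *)

Section joint_law.
Context d0 (T : measurableType d0) d1 (V : measurableType d1) (R : realType).
Variables (P : probability T R) (Q : {sigma_finite_measure set V -> \bar R}).
Variables (n : nat) (X : 'I_n -> T -> V).
Hypotheses (mX : forall i, measurable_fun setT (X i)).
Hypothesis PX : forall i B, measurable B -> P (X i @^-1` B) = Q B.
Hypothesis indep : forall B : 'I_n -> set V, (forall i, measurable (B i)) ->
  P [set w | forall i, B i (X i w)] = (\prod_(i < n) P (X i @^-1` B i))%E.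
Hypothesis Q1 : Q setT = 1%E.
Local Open Scope ereal_scope.

Definition Xs m (s : m.-tuple 'I_n) (w : T) : m.-tuple V := [tuple X (tnth s i) w | i < m].

Lemma measurable_Xs m (s : m.-tuple 'I_n) : measurable_fun setT (Xs s).
Proof.
apply/measurable_fun_tnthP => i.
rewrite (_ : _ \o _ = X (tnth s i)); first exact: mX.
by apply/funext => w /=; rewrite tnth_mktuple.
Qed.

Lemma measurable_Xs_pre m (s : m.-tuple 'I_n) B : measurable B -> measurable (Xs s @^-1` B).
Proof. by move=> mB; rewrite -[X in measurable X]setTI; exact: measurable_Xs. Qed.

Definition box_event m (s : m.-tuple 'I_n) (B : 'I_m -> set V) : set T :=
  [set w | forall i, B i (X (tnth s i) w)].

Lemma measurable_box_event m (s : m.-tuple 'I_n) B : (forall i, measurable (B i)) ->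
  measurable (box_event s B).
Proof.
move=> mB; rewrite (_ : box_event s B = Xs s @^-1` [set x | forall i, B i (tnth x i)]).
  by apply: measurable_Xs_pre; exact: measurable_box.
by apply/seteqP; split => w h i; have := h i; rewrite tnth_mktuple.
Qed.

(** Independence is given for all [n] points together, so an index outside [s] receives the trivial
    constraint; as [s] has no repetition, an index in [s] receives exactly one of the [B i]. *)
Lemma box_event_prob m (s : m.-tuple 'I_n) B : uniq s -> (forall i, measurable (B i)) ->
  P (box_event s B) = \prod_(i < m) Q (B i).
Proof.
move=> us mB.
pose C j : set V := [set x | forall i, tnth s i = j -> B i x].
have mC j : measurable (C j).
  rewrite (_ : C j = \bigcap_(i in [set: 'I_m]) (if tnth s i == j then B i else setT)).
    by apply: fin_bigcap_measurable => // i _; case: ifP.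
  apply/seteqP; split=> x h i; first by move=> _; case: eqP => // /h.
  by move=> sj; have := h i I; rewrite sj eqxx.
rewrite (_ : box_event s B = [set w | forall j, C j (X j w)]); last first.
  apply/seteqP; split => w h; first by move=> j i <-; exact: h.
  by move=> i; exact: h.
rewrite indep//.
under eq_bigr do rewrite PX//.
rewrite (bigID (fun j => j \in s))/= [X in _ * X]big1 ?mule1; last first.
  move=> j js; rewrite (_ : C j = setT)//.
  by apply/seteqP; split => // x _ i sj; move: js; rewrite -sj mem_tnth.
rewrite -(big_uniq _ us)/= big_tuple; apply: eq_bigr => i _; congr (Q _).
apply/seteqP; split => x; first exact.
by move=> Bx i' /(tuple_uniqP _ us) ->.
Qed.

Lemma box_event_prob2 m m' (s : m.-tuple 'I_n) (s' : m'.-tuple 'I_n) B B' :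
  uniq (s ++ s') -> (forall i, measurable (B i)) -> (forall i, measurable (B' i)) ->
  P (box_event s B `&` box_event s' B') = (\prod_(i < m) Q (B i)) * (\prod_(i < m') Q (B' i)).
Proof.
move=> us mB mB'.
pose B2 (i : 'I_(m + m')) := match fintype.split i with inl a => B a | inr b => B' b end.
have := @box_event_prob _ [tuple of s ++ s'] B2 us.
have -> : box_event [tuple of s ++ s'] B2 = box_event s B `&` box_event s' B'.
  apply/seteqP; split => w.
    move=> h; split => i.
      by have := h (lshift m' i); rewrite /B2 (unsplitK (inl i)) tnth_lshift.
    by have := h (rshift m i); rewrite /B2 (unsplitK (inr i)) tnth_rshift.
  move=> [h h'] i; rewrite /B2 -[i in tnth _ i]splitK.
  by case: fintype.split => a /=; rewrite ?tnth_lshift ?tnth_rshift; [exact: h|exact: h'].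
move=> ->; last by move=> i; rewrite /B2; case: fintype.split.
rewrite big_split_ord/=; congr (_ * _); apply: eq_bigr => i _.
  by rewrite /B2 (unsplitK (inl i)).
by rewrite /B2 (unsplitK (inr i)).
Qed.

(** Passes from boxes to all measurable sets, jointly with an event [F]. Keeping [F] general drives
    the induction: a constraint on the first point is absorbed into [F], and uniqueness of the
    product measure treats head and tail. It also yields the independence of two disjoint tuples. *)
Lemma joint_law_given m (s : m.-tuple 'I_n) (F : set T) : measurable F ->
  (forall B, (forall i, measurable (B i)) ->
    P (F `&` box_event s B) = P F * \prod_(i < m) Q (B i)) ->
  forall B, measurable B -> P (F `&` Xs s @^-1` B) = P F * powm Q m B.
Proof.
elim: m s F => [|m IH] s F mF hF B mB.
  rewrite /= diracE.
  have [B0|nB0] := boolP ([tuple] \in B).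
    rewrite (_ : Xs s @^-1` B = setT) ?setIT ?mule1//.
    by apply/seteqP; split => // w _ /=; rewrite (tuple0 (Xs s w)); exact: set_mem.
  rewrite (_ : Xs s @^-1` B = set0) ?setI0 ?measure0 ?mule0//.
  apply/seteqP; split => // w /=; rewrite (tuple0 (Xs s w)) => /mem_set.
  by rewrite (negbTE nB0).
case/tupleP: s => i s in hF *.
(* A null [F] is set apart because the law below is normalised by [P F]. *)
have [PF0|PF0] := eqVneq (P F) 0.
  rewrite PF0 mul0e; apply/eqP; rewrite eq_le measure_ge0 andbT -PF0.
  by apply: le_measure; rewrite ?inE//; apply: measurableI => //; exact: measurable_Xs_pre.
have mXA A : measurable A -> measurable (X i @^-1` A).
  by move=> mA; rewrite -[X in measurable X]setTI; exact: mX.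
have hFA A : measurable A -> forall B', (forall j, measurable (B' j)) ->
    P ((F `&` X i @^-1` A) `&` box_event s B') = P F * (Q A * \prod_(j < m) Q (B' j)).
  move=> mA B' mB'.
  pose B2 (j : 'I_m.+1) := if unlift ord0 j is Some k then B' k else A.
  have -> : (F `&` X i @^-1` A) `&` box_event s B' = F `&` box_event (cons_tuple i s) B2.
    rewrite -setIA; congr (_ `&` _); apply/seteqP; split => w.
      move=> [Aw h] j; rewrite /B2; case: unliftP => [k ->|-> //].
      by rewrite tnthS; exact: h.
    move=> h; split; first by have := h ord0; rewrite /B2 unlift_none.
    by move=> k; have := h (lift ord0 k); rewrite /B2 liftK tnthS.
  rewrite hF; last by move=> j; rewrite /B2; case: unlift.
  rewrite big_ord_recl /B2 unlift_none; congr (_ * (_ * _)).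
  by apply: eq_bigr => j _; rewrite liftK.
have PFA A : measurable A -> P (F `&` X i @^-1` A) = P F * Q A.
  move=> mA; have := hFA A mA (fun=> setT) (fun=> measurableT).
  rewrite big1 ?mule1// => <-; congr (P _).
  by apply/seteqP; split => [w h|w []].
have rect A C : measurable A -> measurable C ->
    P (F `&` X i @^-1` A `&` Xs s @^-1` C) = P F * (Q A * powm Q m C).
  move=> mA mC; rewrite (IH s (F `&` X i @^-1` A)) ?PFA ?muleA//.
    by apply: measurableI => //; exact: mXA.
  by move=> B' mB'; rewrite hFA// muleA.
have mph : measurable_fun setT (fun w => (X i w, Xs s w)).
  by apply: measurable_fun_pair; [exact: mX|exact: measurable_Xs].
have PFfin : P F \is a fin_num by exact: fin_num_measure.
have pF0 : (0 < fine (P F))%R by rewrite fine_gt0// lt0e PF0 measure_ge0/= ltey_eq PFfin.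
have pF1 : (0 <= (fine (P F))^-1)%R by rewrite invr_ge0 ltW.
(* The conditional law, given [F], of the first point and the remaining ones; it is a product on
   rectangles. *)
pose nu := mscale (NngNum pF1) (push_measure (mrestr P mF) mph).
have nuE C : nu C = (fine (P F))^-1%:E * P ((fun w => (X i w, Xs s w)) @^-1` C `&` F) by [].
have := product_measure_unique (m1 := Q) (m2 := powm Q m) (m' := nu).
move=> /(_ _ (@tcons _ V m @^-1` B)) => uniqE.
have -> : powm Q m.+1 B = nu (@tcons _ V m @^-1` B).
  apply: uniqE.
    move=> A C mA mC; rewrite [LHS]nuE.
    rewrite (_ : _ `&` F = F `&` X i @^-1` A `&` Xs s @^-1` C).
      by rewrite rect// muleA -{2}(fineK PFfin) -EFinM mulVf ?gt_eqF// mul1e.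
    by apply/seteqP; split => w /= [[? ?] ?].
  by rewrite -[X in measurable X]setTI; exact: measurable_tcons.
rewrite nuE muleA -[X in X * _ * _](fineK PFfin) -EFinM divff ?gt_eqF// mul1e setIC; congr (P (_ `&` _)).
apply/seteqP; split => w; rewrite /preimage/= (_ : Xs (cons_tuple i s) w = cons_tuple (X i w) (Xs s w))//.
  apply: eq_from_tnth => j; rewrite tnth_mktuple.
  by case: (unliftP ord0 j) => [k ->|->]; rewrite ?tnthS ?tnth_mktuple.
apply: eq_from_tnth => j; rewrite tnth_mktuple.
by case: (unliftP ord0 j) => [k ->|->]; rewrite ?tnthS ?tnth_mktuple.
Qed.

Lemma joint_law m (s : m.-tuple 'I_n) B : uniq s -> measurable B ->
  P (Xs s @^-1` B) = powm Q m B.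
Proof.
move=> us mB; have := @joint_law_given m s setT measurableT.
rewrite probability_setT => /(_ _ B mB); rewrite setTI mul1e; apply.
by move=> C mC; rewrite setTI mul1e box_event_prob.
Qed.

(** Two applications of [joint_law_given]: one with the event of [s] as [F], and, to supply its
    hypothesis on boxes, one with a box event of [s'] as [F]. *)
Lemma joint_law2 m m' (s : m.-tuple 'I_n) (s' : m'.-tuple 'I_n) B B' :
  uniq (s ++ s') -> measurable B -> measurable B' ->
  P (Xs s @^-1` B `&` Xs s' @^-1` B') = powm Q m B * powm Q m' B'.
Proof.
move=> us mB mB'.
have /and3P[us1 _ us2] : [&& uniq s, ~~ has (mem s) s' & uniq s'] by rewrite -cat_uniq.
rewrite joint_law_given//; first by rewrite joint_law.
  exact: measurable_Xs_pre.
move=> C' mC'; rewrite setIC joint_law_given//.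
- by rewrite joint_law// box_event_prob// muleC.
- exact: measurable_box_event.
by move=> C mC; rewrite setIC box_event_prob2// box_event_prob// muleC.
Qed.

End joint_law.

(** * Chebyshev's inequality for counts of events *)

Section chebyshev.
Context d0 (T : measurableType d0) (R : realType) (P : probability T R).
Variables (I : finType) (D : pred I) (A : I -> set T).
Hypothesis mA : forall i, measurable (A i).

Definition count_events (w : T) : R := \sum_(i | D i) \1_(A i) w.
Definition pr (B : set T) : R := fine (P B).

Lemma prE B : measurable B -> P B = (pr B)%:E.
Proof. by move=> mB; rewrite fineK// fin_num_measure. Qed.

Lemma pr_ge0 B : 0 <= pr B.
Proof. exact: fine_ge0. Qed.

Lemma measurable_count_events : measurable_fun setT count_events.
Proof.
rewrite (_ : count_events = fun w => \sum_(i <- [seq i <- index_enum I | D i]) \1_(A i) w).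
  by apply: measurable_sum => i; exact: measurable_indic.
by apply/funext => w; rewrite big_filter.
Qed.

Lemma count_events_ge0 w : 0 <= count_events w.
Proof. by apply: sumr_ge0. Qed.

Lemma integral_sum_indic (J : finType) (E : pred J) (B : J -> set T) :
  (forall j, measurable (B j)) ->
  (\int[P]_w (\sum_(j | E j) \1_(B j) w)%:E = (\sum_(j | E j) pr (B j))%:E)%E.
Proof.
move=> mB; rewrite -[in RHS]big_filter; under eq_integral do rewrite -big_filter -sumEFin.
rewrite ge0_integral_sum//; last first.
  by move=> j; apply/measurable_EFinP; exact: measurable_indic.
rewrite -sumEFin; apply: eq_bigr => j _.
by rewrite integral_indic// setIT; exact: prE.
Qed.

Lemma chebyshev_count (a mu : R) : 0 < a -> mu = \sum_(i | D i) pr (A i) ->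
  (P [set w | a <= `|count_events w - mu|]%R <=
    ((\sum_(p : I * I | D p.1 && D p.2) pr (A p.1 `&` A p.2) - mu ^+ 2) / a ^+ 2)%:E)%E.
Proof.
move=> a0 muE; set N := count_events; set S2 := \sum_(p | _) _.
have mN := measurable_count_events.
have mNm : measurable_fun setT (fun w => `|N w - mu|).
  by apply: measurableT_comp => //; exact: measurable_funB.
have mB : measurable [set w | a <= `|N w - mu|].
  rewrite (_ : [set w | _] = setT `&` (fun w => `|N w - mu|) @^-1` `[a, +oo[%classic).
    by apply: mNm => //; exact: measurable_itv.
  by rewrite setTI set_itvE.
have mu0 : 0 <= mu by rewrite muE; apply: sumr_ge0 => i _; exact: pr_ge0.
have IN : (\int[P]_w (N w)%:E = mu%:E)%E by rewrite muE; exact: integral_sum_indic.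
have IN2 : (\int[P]_w (N w ^+ 2)%:E = S2%:E)%E.
  rewrite -(@integral_sum_indic _ _ (fun p : I * I => A p.1 `&` A p.2)); last first.
    by move=> p; exact: measurableI.
  apply: eq_integral => w _; congr (_%:E).
  rewrite expr2 /N /count_events big_distrlr/= pair_big/=.
  by apply: eq_bigr => p _; rewrite indicI.
have mN2 : measurable_fun setT (fun w => (N w ^+ 2)%:E).
  by apply/measurable_EFinP; exact: measurable_funX.
have msq : measurable_fun setT (fun w => ((N w - mu) ^+ 2)%:E).
  by apply/measurable_EFinP; apply: measurable_funX; exact: measurable_funB.
have mcN : measurable_fun setT (fun w => (2 * mu)%:E * (N w)%:E)%E.
  by apply: emeasurable_funM => //; apply/measurable_EFinP.
(* The expansion of the square is written without subtraction, so that each side integrates as a sum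
   of nonnegative functions. *)
have key : (\int[P]_w ((N w - mu) ^+ 2)%:E + (2 * mu * mu)%:E = (S2 + mu ^+ 2)%:E)%E.
  transitivity (\int[P]_w (((N w - mu) ^+ 2)%:E + (2 * mu)%:E * (N w)%:E))%E.
    rewrite ge0_integralD//.
    - rewrite ge0_integralZl//; first by rewrite IN.
      + exact/measurable_EFinP.
      + by move=> w _; rewrite lee_fin count_events_ge0.
      + by rewrite lee_fin mulr_ge0.
    - by move=> w _; rewrite lee_fin sqr_ge0.
    - by move=> w _; rewrite -EFinM lee_fin !mulr_ge0 ?count_events_ge0.
  transitivity (\int[P]_w ((N w ^+ 2)%:E + (mu ^+ 2)%:E))%E.
    by apply: eq_integral => w _; rewrite -EFinM -!EFinD; congr (_%:E); ring.
  rewrite ge0_integralD//.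
  - by rewrite IN2 integral_cst// [X in (_ + _ * X)%E]probability_setT mule1.
  - by move=> w _; rewrite lee_fin sqr_ge0.
  - by move=> w _; rewrite lee_fin sqr_ge0.
have le1 : ((a ^+ 2)%:E * P [set w | a <= `|N w - mu|]%R <= \int[P]_w ((N w - mu) ^+ 2)%:E)%E.
  rewrite -[X in (_ * P X)%E]setIT -integral_indic// -ge0_integralZl//; first last.
  - by rewrite lee_fin sqr_ge0.
  - by apply/measurable_EFinP; exact: measurable_indic.
  apply: ge0_le_integral => //.
  - by move=> w _; rewrite -EFinM lee_fin mulr_ge0 ?sqr_ge0.
  - by apply: emeasurable_funM => //; apply/measurable_EFinP; exact: measurable_indic.
  move=> w _; rewrite -EFinM lee_fin indicE.
  have [/set_mem/= h|_] := boolP (_ \in _); last by rewrite mulr0 sqr_ge0.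
  by rewrite mulr1 -[leRHS]real_normK ?num_real// lerXn2r ?nnegrE// ltW.
rewrite prE// in le1 *; rewrite lee_fin.
have J0 : (0 <= \int[P]_w ((N w - mu) ^+ 2)%:E)%E.
  by apply: integral_ge0 => w _; rewrite lee_fin sqr_ge0.
move: key le1 J0; case: (integral _ _ _) => [x||] //=.
rewrite -EFinD => -[key]; rewrite -EFinM !lee_fin => le1 _.
by rewrite ler_pdivlMr ?exprn_gt0// mulrC; lra.
Qed.

End chebyshev.

Section counting.
Variable n : nat.

(** Such a tuple is determined by the list of its [m] distinct entries and, for each of the [k]
    places, a position in that list. *)
Lemma card_tuple_size_undup k m :
  (#|[set c : k.-tuple 'I_n | size (undup c) == m]%SET| <= m ^ k * n ^ m)%N.
Proof.
pose F (q : k.-tuple 'I_m * m.-tuple 'I_n) : k.-tuple 'I_n :=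
  [tuple tnth q.2 (tnth q.1 i) | i < k].
apply: (@leq_trans #|codom F|); last first.
  by apply: (leq_trans (leq_image_card F _)); rewrite card_prod !card_tuple !card_ord.
apply: subset_leq_card; apply/fintype.subsetP => c; rewrite inE => /eqP sc.
have hi i : (index (tnth c i) (undup c) < m)%N.
  by rewrite -sc index_mem mem_undup mem_tnth.
have sz : size (undup c) == m by rewrite sc.
apply/codomP; exists ([tuple Ordinal (hi i) | i < k], Tuple sz).
apply: eq_from_tnth => i; rewrite !tnth_mktuple /=.
by rewrite [RHS](tnth_nth (tnth c i))/= nth_index// mem_undup mem_tnth.
Qed.

End counting.

Section star_event.
Context (R : realType) (d : nat).
Notation V := (d.-tuple R).
Variables (Q : {sigma_finite_measure set V -> \bar R}).
Hypothesis Q1 : Q setT = 1%E.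

Definition star_set (rho : R) k : set (k.+1.-tuple V) :=
  [set x | forall i : 'I_k, cball rho (thead x) (tnth x (lift ord0 i))].
Arguments star_set : clear implicits.

Lemma measurable_star_set rho k : measurable (star_set rho k).
Proof.
rewrite (_ : star_set rho k = \bigcap_(i in [set: 'I_k])
  (setT `&` (fun x : k.+1.-tuple V => dist2 (thead x) (tnth x (lift ord0 i)) <= rho ^+ 2) @^-1` [set true])).
  apply: fin_bigcap_measurable => // i _.
  have mnear : measurable_fun setT
      (fun x : k.+1.-tuple V => dist2 (thead x) (tnth x (lift ord0 i)) <= rho ^+ 2).
    have mp : measurable_fun setT (fun x : k.+1.-tuple V => (thead x, tnth x (lift ord0 i))).
      by apply: measurable_fun_pair; exact: measurable_tnth.
    exact: (measurableT_comp (measurable_near rho) mp).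
  exact: mnear.
apply/seteqP; split => x h i; first by move=> _; rewrite setTI; exact: h.
by have := h i I; rewrite setTI.
Qed.

Lemma powm_star_set rho k : powm Q k.+1 (star_set rho k) = star_prob Q rho k.
Proof.
transitivity (\int[Q]_x powm Q k (xsection (@tcons _ V k @^-1` star_set rho k) x))%E; first by [].
apply: eq_integral => x _.
have -> : xsection (@tcons _ V k @^-1` star_set rho k) x =
    [set y : k.-tuple V | forall i, cball rho x (tnth y i)].
  rewrite xsectionE; apply/seteqP; split => y h i.
    by have := h i; rewrite /tcons theadE tnthS.
  by rewrite /tcons theadE tnthS; exact: h.
rewrite (powm_box Q (B := fun=> cball rho x)); last by move=> i; exact: measurable_cball.
under eq_bigr do rewrite -[Q (cball rho x)](fineK (Q_fin Q1 (measurable_cball (d := d) rho x))).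
by rewrite prodEFin prodr_const card_ord.
Qed.

End star_event.

Arguments star_set {R d} rho k.

Section overlap.
Context (R : realType) (d : nat).
Notation V := (d.-tuple R).
Context d0 (T : measurableType d0).
Variables (P : probability T R) (Q : {sigma_finite_measure set V -> \bar R}).
Variables (n : nat) (X : 'I_n -> T -> V).
Hypotheses (mX : forall i, measurable_fun setT (X i)).
Hypothesis PX : forall i B, measurable B -> P (X i @^-1` B) = Q B.
Hypothesis indep : forall B : 'I_n -> set V, (forall i, measurable (B i)) ->
  P [set w | forall i, B i (X i w)] = (\prod_(i < n) P (X i @^-1` B i))%E.
Hypothesis Q1 : Q setT = 1%E.
Variables (E : set (3.-tuple V)) (rho : R) (st : nat -> R).
Hypothesis mE : measurable E.
Hypothesis Eclose : forall x, E x -> forall i j, cball rho (tnth x i) (tnth x j).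
Hypothesis st0 : forall k, 0 <= st k.
Hypothesis star_st : forall k, (1 < k < 5)%N -> (star_prob Q rho k <= (st k)%:E)%E.

Definition triple_event (t : 3.-tuple 'I_n) : set T := Xs X t @^-1` E.

Lemma measurable_triple_event t : measurable (triple_event t).
Proof. exact: measurable_Xs_pre. Qed.

Lemma size_undup_overlap (t t' : 3.-tuple 'I_n) : uniq t -> ~~ uniq (t ++ t') ->
  (2 < size (undup (t ++ t')) < 6)%N.
Proof.
move=> ut nu; apply/andP; split.
  have st3 : (size t <= size (undup (t ++ t')))%N.
    apply: uniq_leq_size => // x xt.
    by rewrite mem_undup mem_cat xt.
  by rewrite size_tuple in st3.
by have := ltn_size_undup (t ++ t'); rewrite nu size_cat !size_tuple.
Qed.

Lemma overlap_prob (t t' : 3.-tuple 'I_n) : uniq t -> uniq t' -> ~~ uniq (t ++ t') ->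
  pr P (triple_event t `&` triple_event t') <= st (size (undup (t ++ t'))).-1.
Proof.
move=> ut ut' nu; have /andP[m3 m6] := size_undup_overlap ut nu.
set U := undup _ in m3 m6 *.
(* Each triple is free of repetition and their concatenation is not, so they share a vertex. It
   becomes the centre of the star, since every vertex of either triple is close to it. *)
have [v vt' vt] : exists2 v, v \in t' & v \in t.
  apply/hasP; move: nu; rewrite cat_uniq ut ut' andbT /=.
  by rewrite negbK.
have vU : v \in U by rewrite mem_undup mem_cat vt.
have uU : uniq U by exact: undup_uniq.
have sz : size (rem v U) == (size U).-1 by rewrite size_rem.
pose s := Tuple sz.
have us : uniq (cons_tuple v s).
  by rewrite /= rem_uniq// andbT mem_rem_uniq// inE eqxx.
have mS : measurable (Xs X (cons_tuple v s) @^-1` star_set rho (size U).-1).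
  by apply: measurable_Xs_pre => //; exact: measurable_star_set.
rewrite -lee_fin -prE; last by apply: measurableI; exact: measurable_triple_event.
apply: (@le_trans _ _ (star_prob Q rho (size U).-1)); last first.
  by apply: star_st; case: (size U) m3 m6 => // k /=; rewrite !ltnS => -> ->.
rewrite -powm_star_set// -(joint_law mX PX indep Q1 us); last exact: measurable_star_set.
apply: le_measure; rewrite ?inE//.
  by apply: measurableI; exact: measurable_triple_event.
move=> w [At At'] i.
change (cball rho (tnth (Xs X (cons_tuple v s) w) ord0)
  (tnth (Xs X (cons_tuple v s) w) (lift ord0 i))).
rewrite !tnth_mktuple tnth0 tnthS.
have : tnth s i \in U by apply: mem_rem; exact: (mem_tnth i s).
rewrite mem_undup mem_cat => /orP[].
- move=> /tnthP[j ->]; move: vt => /tnthP[j' ->].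
  by have := Eclose At j' j; rewrite !tnth_mktuple.
- move=> /tnthP[j ->]; move: vt' => /tnthP[j' ->].
  by have := Eclose At' j' j; rewrite !tnth_mktuple.
Qed.

(* At most [m ^ 6 * n ^ m] pairs of triples span exactly [m] vertices. *)
Definition overlap_bound : R := \sum_(3 <= m < 6) (m ^ 6 * n ^ m)%:R * st m.-1.

Definition p3 : R := fine (powm Q 3 E).

Lemma pr_triple (t : 3.-tuple 'I_n) : uniq t -> pr P (triple_event t) = p3.
Proof. by move=> ut; rewrite /pr /p3 (joint_law mX PX indep Q1). Qed.

Lemma card_overlap m :
  (#|[set p : 3.-tuple 'I_n * 3.-tuple 'I_n | size (undup (p.1 ++ p.2)) == m]%SET| <= m ^ 6 * n ^ m)%N.
Proof.
apply: leq_trans (card_tuple_size_undup n 6 m).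
pose F (p : 3.-tuple 'I_n * 3.-tuple 'I_n) : 6.-tuple 'I_n := [tuple of p.1 ++ p.2].
have Finj : injective F.
  move=> [a b] [a' b'] /(congr1 val) /= /eqP.
  by rewrite eqseq_cat ?size_tuple// => /andP[/eqP/val_inj -> /eqP/val_inj ->].
rewrite -(card_imset _ Finj); apply: subset_leq_card; apply/fintype.subsetP => c /imsetP[p].
by rewrite !inE => h ->.
Qed.

(** Disjoint pairs factor by independence and cancel against the same pairs in the squared mean. The
    rest of the squared mean is nonnegative and is dropped, which leaves the overlapping pairs. *)
Lemma second_moment :
  \sum_(p : 3.-tuple 'I_n * 3.-tuple 'I_n | uniq p.1 && uniq p.2)
     pr P (triple_event p.1 `&` triple_event p.2) -
  (\sum_(t : 3.-tuple 'I_n | uniq t) pr P (triple_event t)) ^+ 2 <= overlap_bound.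
Proof.
have p30 : 0 <= p3 by exact: fine_ge0.
have -> : (\sum_(t : 3.-tuple 'I_n | uniq t) pr P (triple_event t)) ^+ 2 =
    \sum_(p : 3.-tuple 'I_n * 3.-tuple 'I_n | uniq p.1 && uniq p.2) p3 * p3.
  rewrite expr2 big_distrlr/= pair_big/=.
  by apply: eq_bigr => p /andP[u1 u2]; rewrite !pr_triple.
rewrite lerBlDl.
rewrite (bigID (fun p : 3.-tuple 'I_n * 3.-tuple 'I_n => uniq (p.1 ++ p.2)))/= [X in _ <= X + _](bigID (fun p : 3.-tuple 'I_n * 3.-tuple 'I_n => uniq (p.1 ++ p.2)))/=.
rewrite -addrA lerD//.
  apply: ler_sum => p /andP[/andP[u1 u2] u12].
  by rewrite /pr (joint_law2 mX PX indep Q1)// fineM ?le_refl//; rewrite -(joint_law mX PX indep Q1 (s := p.1))// fin_num_measure//; exact: measurable_triple_event.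
apply: ler_wpDl; first by apply: sumr_ge0 => p _; rewrite mulr_ge0.
(* The probability bound is spread over all pairs, sorted by the number of vertices, so that
   [card_overlap] can count them. *)
apply: (@le_trans _ _ (\sum_(p : 3.-tuple 'I_n * 3.-tuple 'I_n)
   \sum_(3 <= m < 6) (size (undup (p.1 ++ p.2)) == m)%:R * st m.-1)).
  rewrite [leRHS](bigID (fun p : 3.-tuple 'I_n * 3.-tuple 'I_n => [&& uniq p.1, uniq p.2 & ~~ uniq (p.1 ++ p.2)]))/=.
  apply: ler_wpDr.
    by apply: sumr_ge0 => p _; apply: sumr_ge0 => m _; rewrite mulr_ge0.
  rewrite (eq_bigl (fun p : 3.-tuple 'I_n * 3.-tuple 'I_n => [&& uniq p.1, uniq p.2 & ~~ uniq (p.1 ++ p.2)])); last first.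
    by move=> p; rewrite -andbA.
  apply: ler_sum => p /and3P[u1 u2 nu].
  apply: (le_trans (overlap_prob u1 u2 nu)).
  have /andP[m3 m6] := size_undup_overlap u1 nu.
  rewrite (big_rem (size (undup (p.1 ++ p.2))))/=; last by rewrite mem_index_iota m3.
  rewrite eqxx mul1r lerDl; apply: sumr_ge0 => m _; rewrite mulr_ge0//.
rewrite exchange_big/=; apply: ler_sum => m _.
rewrite -big_distrl/= ler_wpM2r// -natr_sum ler_nat.
apply: leq_trans (card_overlap m).
by rewrite -big_mkcond/= sum1dep_card.
Qed.

Lemma count_concentration (a : R) : 0 < a ->
  (P [set w | a <= `|count_events R (fun t : 3.-tuple 'I_n => uniq t) triple_event w -
       (#|[set t : 3.-tuple 'I_n | uniq t]%SET|)%:R * p3|]%R <= (overlap_bound / a ^+ 2)%:E)%E.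
Proof.
move=> a0.
have muE : (#|[set t : 3.-tuple 'I_n | uniq t]%SET|)%:R * p3 = \sum_(t : 3.-tuple 'I_n | uniq t) pr P (triple_event t).
  rewrite (eq_bigr (fun=> p3)); last by move=> t; exact: pr_triple.
  by rewrite sumr_const mulr_natl cardsE.
apply: (le_trans (chebyshev_count measurable_triple_event a0 muE)).
rewrite lee_fin ler_wpM2r ?invr_ge0 ?sqr_ge0//.
by rewrite muE; exact: second_moment.
Qed.

End overlap.

(** * Cherries and triangles among the sample points *)

Section cherries_triangles.
Context (R : realType) (d : nat).
Notation V := (d.-tuple R).
Notation mu := (leb R d).
Notation ib := (@ib R).

Definition cherry (r : R) (x y z : V) : bool := (dist2 x y <= r ^+ 2) && (dist2 x z <= r ^+ 2).
Definition triangle (r : R) (x y z : V) : bool := cherry r x y z && (dist2 y z <= r ^+ 2).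

Definition i0 : 'I_3 := ord0.
Definition i1 : 'I_3 := lift ord0 ord0.
Definition i2 : 'I_3 := lift ord0 (lift ord0 ord0).

Lemma ord3P (i : 'I_3) : [\/ i = i0, i = i1 | i = i2].
Proof.
case: i => -[|[|[|//]]] h; [constructor 1|constructor 2|constructor 3]; exact: val_inj.
Qed.

Definition set3 (E : V -> V -> V -> bool) : set (3.-tuple V) :=
  [set x | E (tnth x i0) (tnth x i1) (tnth x i2)].

Lemma measurable_set3_fun E : meas3 E ->
  measurable_fun setT (fun x : 3.-tuple V => E (tnth x i0) (tnth x i1) (tnth x i2)).
Proof.
move=> mE.
have mp : measurable_fun setT (fun x : 3.-tuple V => ((tnth x i0, tnth x i1), tnth x i2)).
  by apply: measurable_fun_pair; [apply: measurable_fun_pair|]; exact: measurable_tnth.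
exact: (measurableT_comp mE mp).
Qed.

Lemma measurable_set3 E : meas3 E -> measurable (set3 E).
Proof.
move=> mE; rewrite -[X in measurable X]setTI.
exact: (measurable_set3_fun mE measurableT (Y := [set true])).
Qed.

Lemma powm_set3 (Q : {sigma_finite_measure set V -> \bar R}) E : meas3 E ->
  powm Q 3 (set3 E) = int3 Q E.
Proof.
move=> mE; have mF := measurable_set3_fun mE.
rewrite -(integral_ib (powm Q 3) mF).
have mI : measurable_fun setT (fun x : 3.-tuple V => ib (E (tnth x i0) (tnth x i1) (tnth x i2))).
  exact: measurable_ib.
have ge0 n (g : n.-tuple V -> bool) x : (0 <= ib (g x))%E by exact: ib_ge0.
have sec n (g : n.+1.-tuple V -> \bar R) (x : V) : measurable_fun setT g ->
    measurable_fun setT (fun t : n.-tuple V => g (cons_tuple x t)).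
  move=> mg; apply: (measurableT_comp mg).
  by apply: (measurable_cons (f := fun=> x)); [exact: measurable_cst|exact: measurable_id].
rewrite integral_powmS//; last by move=> x; exact: ib_ge0.
apply: eq_integral => x _.
have m2 := sec _ _ x mI.
rewrite integral_powmS//; last by move=> t; exact: ib_ge0.
apply: eq_integral => y _.
have m3 := sec _ _ y m2.
rewrite integral_powmS//; last by move=> t; exact: ib_ge0.
apply: eq_integral => z _.
have m4 := sec _ _ z m3.
rewrite (integral_powm0 Q)//.
by move=> t; exact: ib_ge0.
Qed.

Lemma meas3_cherry r : meas3 (cherry r).
Proof.
have m1 : measurable_fun setT (fun q : V * V * V => q.1) by exact: measurable_fst.
have m2 : measurable_fun setT (fun q : V * V * V => (q.1.1, q.2)).
  by apply: measurable_fun_pair => //; exact: measurableT_comp.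
by apply: measurable_and; [exact: (measurableT_comp (measurable_near r) m1)|exact: (measurableT_comp (measurable_near r) m2)].
Qed.

Lemma meas3_triangle r : meas3 (triangle r).
Proof.
have m2 : measurable_fun setT (fun q : V * V * V => (q.1.2, q.2)).
  by apply: measurable_fun_pair => //; exact: measurableT_comp.
by apply: measurable_and; [exact: meas3_cherry|exact: (measurableT_comp (measurable_near r) m2)].
Qed.

(** The squared form of the triangle inequality; with both terms at most [r^2] it gives exactly
    [(2 r)^2], the radius of the stars. *)
Lemma dist2_triangle (x y z : V) : dist2 y z <= 2 * (dist2 x y + dist2 x z).
Proof.
rewrite /dist2 -big_split/= big_distrr/=; apply: ler_sum => i _.
have := sqr_ge0 ((tnth x i - tnth y i) + (tnth x i - tnth z i)); nra.
Qed.

Lemma cherry_close r x : set3 (cherry r) x -> forall i j, cball (2 * r) (tnth x i) (tnth x j).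
Proof.
move=> /andP[h1 h2].
have d0 (a : V) : dist2 a a = 0 by rewrite /dist2 big1// => i _; rewrite subrr expr0n.
have h3 : dist2 (tnth x i1) (tnth x i2) <= (2 * r) ^+ 2.
  have := dist2_triangle (tnth x i0) (tnth x i1) (tnth x i2).
  by rewrite exprMn; lra.
have r2 := sqr_ge0 r.
rewrite /cball /= => i j; rewrite exprMn in h3 *.
have h1' : dist2 (tnth x i0) (tnth x i1) <= r ^+ 2 by [].
have h2' : dist2 (tnth x i0) (tnth x i2) <= r ^+ 2 by [].
have s1 := dist2C (tnth x i1) (tnth x i0).
have s2 := dist2C (tnth x i2) (tnth x i0).
have s3 := dist2C (tnth x i2) (tnth x i1).
by case: (ord3P i) => ->; case: (ord3P j) => ->; rewrite ?d0 ?s1 ?s2 ?s3; lra.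
Qed.

Lemma triangle_close r x : set3 (triangle r) x -> forall i j, cball (2 * r) (tnth x i) (tnth x j).
Proof. by move=> /andP[h _]; exact: cherry_close. Qed.

Definition Kcherry (u v : V) : bool := (nrm2 u <= 1) && (nrm2 v <= 1).
Definition Ktriangle (u v : V) : bool :=
  (nrm2 u <= 1) && ((nrm2 v <= 1) && (nrm2 u + nrm2 v - 2 * dot u v <= 1)).

Lemma meas2_Kcherry : meas2 Kcherry.
Proof.
by apply: measurable_and; apply: measurable_fun_ler => //;
  apply: (measurableT_comp (@measurable_nrm2 R d)).
Qed.

Lemma meas2_Ktriangle : meas2 Ktriangle.
Proof.
apply: measurable_and.
  by apply: measurable_fun_ler => //; apply: (measurableT_comp (@measurable_nrm2 R d)).
apply: measurable_and; apply: measurable_fun_ler => //.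
  by apply: (measurableT_comp (@measurable_nrm2 R d)).
apply: measurable_funB.
  by apply: measurable_funD; apply: (measurableT_comp (@measurable_nrm2 R d)).
apply: measurable_funM => //; apply: measurable_sum => i; apply: measurable_funM.
  by apply: (measurableT_comp (@measurable_tnth _ _ _ i)).
by apply: (measurableT_comp (@measurable_tnth _ _ _ i)).
Qed.

Lemma cherryK r (r0 : 0 < r) x u v : cherry r x (taff x r u) (taff x r v) = Kcherry u v.
Proof.
have r2 : 0 < r ^+ 2 by rewrite exprn_gt0.
by rewrite /cherry !dist2_taff; congr (_ && _); rewrite -[X in (_ <= X)]mulr1 ler_pM2l.
Qed.

Lemma triangleK r (r0 : 0 < r) x u v : triangle r x (taff x r u) (taff x r v) = Ktriangle u v.
Proof.
have r2 : 0 < r ^+ 2 by rewrite exprn_gt0.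
rewrite /triangle cherryK// dist2_taff2 -andbA; congr (_ && (_ && _)).
by rewrite -[X in (_ <= X)]mulr1 ler_pM2l.
Qed.

Lemma small_nrm2 (u : V) : nrm2 u <= 1 -> small 1 u.
Proof.
move=> u1 i; rewrite -(@ler_pXn2r _ 2) ?nnegrE// expr1n real_normK ?num_real//.
apply: le_trans u1; rewrite /nrm2 (bigD1 i)//= lerDl.
by apply: sumr_ge0 => j _; exact: sqr_ge0.
Qed.

Lemma integral_Kcherry : (\int[mu]_u \int[mu]_v ib (Kcherry u v) = cherryvol R d)%E.
Proof. by apply: eq_integral => u _; apply: eq_integral => v _; exact: ibM. Qed.

Lemma integral_Ktriangle : (\int[mu]_u \int[mu]_v ib (Ktriangle u v) = trivol R d)%E.
Proof. by apply: eq_integral => u _; apply: eq_integral => v _; exact: ibM. Qed.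

End cherries_triangles.

Section volumes.
Context (R : realType).

Lemma ballvol_gt0 d : 0 < fine (ballvol d 1 : \bar R).
Proof.
elim: d => [|d IH].
  rewrite /ballvol (@integral_leb0 R (fun x => ib R (nrm2 x <= 1))).
  - by rewrite nrm2_0 ler01.
  - by apply: measurable_ib; apply: measurable_fun_ler => //; exact: measurable_nrm2.
  - by move=> x; exact: ib_ge0.
rewrite ballvol_slice -[ballvol d 1]fineK ?ballvol_fin_num//.
rewrite -[slice_int R d]fineK ?slice_int_fin// -!EFinM/=.
by rewrite !mulr_gt0// slice_int_gt0.
Qed.

Definition cherry_const d : R := fine (ballvol d 1 : \bar R) ^+ 2.

Lemma cherryvol_const d : cherryvol R d = (cherry_const d)%:E.
Proof. by rewrite cherryvolE -[ballvol d 1]fineK ?ballvol_fin_num// -EFinM expr2. Qed.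

(** By [ballvol_slice], the factor [2 * ballvol d 1] in [trivolE] is [ballvol d.+1 1] divided by
    [slice_int d]. *)
Lemma trivol_const d : trivol R d.+1 = (alpha R d * cherry_const d.+1)%:E.
Proof.
rewrite trivolE /cherry_const /alpha.
have S0 := slice_int_gt0 R d.
have E : fine (ballvol d.+1 1 : \bar R) = 2 * fine (ballvol d 1 : \bar R) * fine (slice_int R d).
  by rewrite ballvol_slice -[in LHS](fineK (ballvol_fin_num d 1)) -[in LHS](fineK (slice_int_fin R d)) -!EFinM.
rewrite -(fineK (ballvol_fin_num d 1)) -(fineK (ballvol_fin_num d.+1 1)) -(fineK (clip_slice_int_fin R d)).
rewrite -!EFinM; congr (_%:E); rewrite /= E; field.
by rewrite gt_eqF.
Qed.

Lemma cherry_const_gt0 d : 0 < cherry_const d.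
Proof. by rewrite exprn_gt0// ballvol_gt0. Qed.

Lemma alpha_ge0 k : 0 <= alpha R k.
Proof.
rewrite divr_ge0// fine_ge0//; first exact: (int01_ge0 (@m_w_ge0 R k.+1 k)).
exact: (int01_ge0 (@w_ge0 R k)).
Qed.

End volumes.

(** * The estimator *)

Section dimension_of_ratio.
Context (R : realType).
Notation alpha := (alpha R).

(** Half the distance from [alpha k] to its nearest neighbour in the sequence; the value at 0 has a
    neighbour on one side only. *)
Definition gap k : R := match k with
  | 0 => (alpha 0 - alpha 1) / 2
  | j.+1 => Num.min ((alpha j - alpha k) / 2) ((alpha k - alpha k.+1) / 2)
  end.

Lemma gap_gt0 k : 0 < gap k.
Proof.
have h j : 0 < (alpha j - alpha j.+1) / 2 by rewrite divr_gt0// subr_gt0 alpha_decr.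
by case: k => [|k]; [exact: h|rewrite /gap lt_min !h].
Qed.

Lemma gap_le k : gap k <= (alpha k - alpha k.+1) / 2.
Proof. by case: k => [|k] //; rewrite /gap ge_min lexx orbT. Qed.

Lemma gap_leS k : gap k.+1 <= (alpha k - alpha k.+1) / 2.
Proof. by rewrite /gap ge_min lexx. Qed.

Lemma alpha_nonincr j k : (j <= k)%N -> alpha k <= alpha j.
Proof.
elim: k => [|k IH]; first by rewrite leqn0 => /eqP ->.
rewrite leq_eqVlt => /predU1P[-> //|]; rewrite ltnS => /IH; apply: le_trans.
by rewrite ltW// alpha_decr.
Qed.

(** For [i < l] the two radii are at most half of steps lying between [alpha l] and [alpha i], so
    together they do not exceed the distance of these values. *)
Lemma gap_disjoint x j k : `|x - alpha j| < gap j -> `|x - alpha k| < gap k -> j = k.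
Proof.
have W i l : (i < l)%N -> `|x - alpha i| < gap i -> `|x - alpha l| < gap l -> False.
  case: l => // l; rewrite ltnS => il; rewrite !ltr_norml => /andP[? ?] /andP[? ?].
  have := gap_le i; have := gap_leS l; have := alpha_nonincr il.
  have : alpha l.+1 <= alpha i.+1 by apply: alpha_nonincr; rewrite ltnS.
  by lra.
move=> hj hk; have [jk|kj|//] := ltngtP j k; first by case: (W _ _ jk hj hk).
by case: (W _ _ kj hk hj).
Qed.

(** The successor undoes the shift in the index of [alpha]. Outside all windows [xget] falls back on
    0, and the answer is dimension 1. *)
Definition dim_of_ratio (x : R) : nat := (xget 0%N [set k | `|x - alpha k| < gap k]).+1.

Lemma dim_of_ratioE x k : `|x - alpha k| < gap k -> dim_of_ratio x = k.+1.
Proof.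
move=> h; congr _.+1; have /xgetPex h' : exists k, [set k | `|x - alpha k| < gap k] k by exists k.
exact: gap_disjoint (h' 0%N) h.
Qed.

End dimension_of_ratio.

Section estimator.
Context (R : realType).

(** Ordered triples are counted: a cherry appears twice and a triangle six times, that is, twice for
    each of its three centres. The quotient of the two counts is therefore the proportion of closed
    cherries. *)
Definition triangle_count n (M : 'M[bool]_n) : R :=
  \sum_(t : 3.-tuple 'I_n | uniq t)
    ([&& M (tnth t i0) (tnth t i1), M (tnth t i0) (tnth t i2) & M (tnth t i1) (tnth t i2)])%:R.
Definition cherry_count n (M : 'M[bool]_n) : R :=
  \sum_(t : 3.-tuple 'I_n | uniq t)
    (M (tnth t i0) (tnth t i1) && M (tnth t i0) (tnth t i2))%:R.

Definition dim_estimator n (M : 'M[bool]_n) : R :=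
  (dim_of_ratio (triangle_count M / cherry_count M))%:R.

Context (d : nat) (r : R) (r0 : 0 < r).
Notation V := (d.-tuple R).
Context d0 (T : measurableType d0) (n : nat) (X : 'I_n -> T -> V).

Lemma rgg_adjE w i j : i != j ->
  rgg_adj (fun i => X i w) r i j = (dist2 (X i w) (X j w) <= r ^+ 2).
Proof. by move=> ij; rewrite mxE ij edist_le. Qed.

Lemma uniq3 (t : 3.-tuple 'I_n) : uniq t ->
  [/\ tnth t i0 != tnth t i1, tnth t i0 != tnth t i2 & tnth t i1 != tnth t i2].
Proof. by move=> /tuple_uniqP ti; split; apply/eqP => /ti. Qed.

Lemma cherry_countE w : cherry_count (rgg_adj (fun i => X i w) r) =
  count_events R (fun t : 3.-tuple 'I_n => uniq t) (triple_event X (set3 (cherry r))) w.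
Proof.
apply: eq_bigr => t /uniq3[n01 n02 _]; rewrite !rgg_adjE// indicE; congr (nat_of_bool _)%:R.
have -> : (w \in triple_event X (set3 (cherry r)) t) =
    cherry r (tnth (Xs X t w) i0) (tnth (Xs X t w) i1) (tnth (Xs X t w) i2).
  by apply/idP/idP => [/set_mem//|h]; exact/mem_set.
by rewrite !tnth_mktuple.
Qed.

Lemma triangle_countE w : triangle_count (rgg_adj (fun i => X i w) r) =
  count_events R (fun t : 3.-tuple 'I_n => uniq t) (triple_event X (set3 (triangle r))) w.
Proof.
apply: eq_bigr => t /uniq3[n01 n02 n12]; rewrite !rgg_adjE// indicE; congr (nat_of_bool _)%:R.
have -> : (w \in triple_event X (set3 (triangle r)) t) =
    triangle r (tnth (Xs X t w) i0) (tnth (Xs X t w) i1) (tnth (Xs X t w) i2).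
  by apply/idP/idP => [/set_mem//|h]; exact/mem_set.
by rewrite !tnth_mktuple /triangle /cherry -andbA.
Qed.

End estimator.

(** There are finitely many adjacency matrices, and each one is prescribed by finitely many distance
    conditions. *)
Lemma measurable_rgg_event (R : realType) d (r : R) d0 (T : measurableType d0) n
    (X : 'I_n -> T -> d.-tuple R) (S : set 'M[bool]_n) : 0 < r ->
  (forall i, measurable_fun setT (X i)) ->
  measurable [set w | S (rgg_adj (fun i => X i w) r)].
Proof.
move=> r0 mX.
have -> : [set w | S (rgg_adj (fun i => X i w) r)] =
    \bigcup_(M in S) \bigcap_(p in [set: 'I_n * 'I_n])
      [set w | rgg_adj (fun i => X i w) r p.1 p.2 = M p.1 p.2].
  apply/seteqP; split => w; first by move=> h; exists (rgg_adj (fun i => X i w) r).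
  move=> [M SM h]; rewrite /= (_ : rgg_adj _ _ = M)//.
  by apply/matrixP => i j; exact: (h (i, j) I).
apply: fin_bigcup_measurable; first exact: finite_finset.
move=> M _; apply: fin_bigcap_measurable => //= -[i j] _ /=.
have mp : measurable_fun setT (fun w => (X i w, X j w)) by exact: measurable_fun_pair.
have mn : measurable_fun setT (fun w => (i != j) && (dist2 (X i w) (X j w) <= r ^+ 2)).
  by apply: measurable_and => //; exact: (measurableT_comp (measurable_near r) mp).
have := mn measurableT [set M i j] I; rewrite setTI; congr (measurable _).
by apply/seteqP; split => w /=; rewrite mxE edist_le.
Qed.

(** Write [m = K * c]. The distance from [NT] to [al * NC] is less than [eta * m] for triangles,
    plus [2 * al * eta * m] for the means, plus [al * eta * m] for cherries, in all
    [eta * m * (1 + 3 * al)]. Dividing by [NC > m / 2] doubles it. *)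
Lemma ratio_close (R : realFieldType) (al eta K c t NC NT : R) :
  0 <= al -> 0 < eta -> eta <= 2^-1 -> 0 < K -> 0 < c ->
  `|t - al * c| <= 2 * al * eta * c ->
  `|NC - K * c| < eta * (K * c) -> `|NT - K * t| < eta * (K * c) ->
  `|NT / NC - al| < 2 * eta * (1 + 3 * al).
Proof.
move=> al0 e0 e12 K0 c0 tc.
set m := K * c; have m0 : 0 < m by rewrite mulr_gt0.
have tc' : `|K * t - al * m| <= 2 * al * eta * m.
  rewrite /m mulrCA -mulrBr normrM (gtr0_norm K0) [leRHS]mulrCA ler_wpM2l//; exact: ltW.
move=> hC hT; rewrite ltr_norml in hC; rewrite ltr_norml in hT.
case/andP: hC => c1 c2; case/andP: hT => t1 t2.
rewrite ler_norml in tc'; case/andP: tc' => k1 k2.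
have em : eta * m <= 2^-1 * m by rewrite ler_wpM2r// ltW.
have NC2 : m / 2 < NC by lra.
have NC0 : 0 < NC by apply: lt_trans NC2; rewrite divr_gt0.
have NCn : NC != 0 by rewrite gt_eqF.
have a1' : al * (NC - m) <= al * (eta * m) by rewrite ler_wpM2l// ltW.
have a2' : al * (m - NC) <= al * (eta * m) by rewrite ler_wpM2l//; lra.
have ub : `|NT - al * NC| < eta * m * (1 + 3 * al).
  by rewrite ltr_norml; apply/andP; split; lra.
have -> : NT / NC - al = (NT - al * NC) / NC by field.
rewrite normrM normfV (gtr0_norm NC0) ltr_pdivrMr//; apply: (lt_le_trans ub).
have p0 : 0 <= eta * (1 + 3 * al) by rewrite mulr_ge0 ?(ltW e0)// addr_ge0// mulr_ge0.
have := ler_wpM2l p0 (ltW NC2); lra.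
Qed.

(** * Size of the variance bound *)

Section overlap_asymptotics.
Context (R : realType).

(** For [n >= 3] each factor of [n (n - 1) (n - 2)] is at least [n / 3]. *)
Lemma card_uniq3_ge n : (2 < n)%N ->
  n%:R ^+ 3 / 27 <= (#|[set t : 3.-tuple 'I_n | uniq t]%SET|)%:R :> R.
Proof.
move=> n3.
have -> : #|[set t : 3.-tuple 'I_n | uniq t]%SET| = (n * (n - 1) * (n - 2))%N.
  have := card_uniq_tuples 3 (predT : pred 'I_n).
  rewrite card_ord !ffactnS ffactn0 muln1 -!subn1 -subnDA mulnA => <-.
  by apply: eq_card => t; rewrite !inE all_predT.
rewrite ler_pdivrMr// -(natrX R n 3) -natrM ler_nat; nia.
Qed.

(** Here [y] stands for [r^d]: the orders of the terms with 3, 4 and 5 vertices over the square of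
    the mean order [n^3 y^2]. *)
Definition overlap_ratio (n : nat) (y : R) : R :=
  (n%:R ^+ 3 * y ^+ 2 + n%:R ^+ 4 * y ^+ 3 + n%:R ^+ 5 * y ^+ 4) / (n%:R ^+ 6 * y ^+ 4).

Lemma overlap_boundE (n : nat) (b F y : R) : 0 <= b -> 0 <= F -> 0 < y ->
  overlap_bound n (fun k => (b * y) ^+ k * F) <=
  (5 ^ 6)%:R * F * (b ^+ 2 + b ^+ 3 + b ^+ 4) *
    (n%:R ^+ 3 * y ^+ 2 + n%:R ^+ 4 * y ^+ 3 + n%:R ^+ 5 * y ^+ 4).
Proof.
move=> b0 F0 y0; have y0' := ltW y0.
rewrite /overlap_bound big_ltn// big_ltn// big_nat1/=.
set S := b ^+ 2 + b ^+ 3 + b ^+ 4.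
set U := n%:R ^+ 3 * y ^+ 2 + _ + _.
have S2 : b ^+ 2 <= S by rewrite /S -addrA lerDl addr_ge0// exprn_ge0.
have S3 : b ^+ 3 <= S by rewrite /S addrAC lerDr addr_ge0// exprn_ge0.
have S4 : b ^+ 4 <= S by rewrite /S lerDr addr_ge0// exprn_ge0.
have term m k : (m <= 5)%N -> b ^+ k <= S ->
    (m ^ 6 * n ^ m)%:R * ((b * y) ^+ k * F) <= (5 ^ 6)%:R * F * S * (n%:R ^+ m * y ^+ k).
  move=> m5 bk.
  have -> : (m ^ 6 * n ^ m)%:R * ((b * y) ^+ k * F) =
      (m ^ 6)%:R * F * b ^+ k * (n%:R ^+ m * y ^+ k) by rewrite natrM [(n ^ m)%:R]natrX exprMn; ring.
  apply: ler_wpM2r; first by rewrite mulr_ge0// exprn_ge0.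
  apply: ler_pM => //; [by rewrite mulr_ge0|exact: exprn_ge0|].
  by apply: ler_wpM2r => //; rewrite ler_nat leq_exp2r.
rewrite addrA; have -> : (5 ^ 6)%:R * F * S * U = (5 ^ 6)%:R * F * S * (n%:R ^+ 3 * y ^+ 2) +
   (5 ^ 6)%:R * F * S * (n%:R ^+ 4 * y ^+ 3) + (5 ^ 6)%:R * F * S * (n%:R ^+ 5 * y ^+ 4).
  by rewrite /U !mulrDr.
by rewrite !lerD// term.
Qed.

(** With [a = n^(3/2) y] the three quotients are [1/a^2], [1/(n^2 y)] and [1/n]; since [a >= 1] and
    [n^2 y >= a], the first two are at most [1/a]. *)
Lemma overlap_ratio_le (n : nat) (y : R) : (0 < n)%N -> 0 < y ->
  1 <= n%:R `^ (3 / 2) * y ->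
  overlap_ratio n y <= 2 / (n%:R `^ (3 / 2) * y) + n%:R^-1.
Proof.
move=> n0 y0; set a := _ * y => a1.
have nR : 1 <= n%:R :> R by rewrite ler1n.
have n0R : 0 < n%:R :> R by rewrite ltr0n.
have a0 : 0 < a by apply: lt_le_trans a1.
have a2 : a ^+ 2 = n%:R ^+ 3 * y ^+ 2.
  rewrite /a exprMn; congr (_ * _).
  rewrite -[LHS]powR_mulrn ?powR_ge0// -powRrM -[RHS]powR_mulrn//; congr (_ `^ _); lra.
have an : a <= n%:R ^+ 2 * y.
  rewrite /a ler_pM2r// -powR_mulrn// ler_powR//; lra.
have nn : n%:R != 0 :> R by rewrite gt_eqF.
have yn : y != 0 by rewrite gt_eqF.
have -> : overlap_ratio n y = (n%:R ^+ 3 * y ^+ 2)^-1 + (n%:R ^+ 2 * y)^-1 + n%:R^-1.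
  by rewrite /overlap_ratio; field; rewrite yn nn.
rewrite lerD2r -a2.
have h1 : (a ^+ 2)^-1 <= a^-1 by rewrite lef_pV2 ?posrE ?exprn_gt0// expr2 ler_peMl// ltW.
have n2y : 0 < n%:R ^+ 2 * y by exact: lt_le_trans an.
have h2 : (n%:R ^+ 2 * y)^-1 <= a^-1 by rewrite lef_pV2.
lra.
Qed.

Lemma overlap_ratio_small (y : nat -> R) (e : R) : (forall n, 0 < y n) -> 0 < e ->
  (fun n : nat => n%:R `^ (3 / 2 : R) * y n) @ \oo --> +oo ->
  \forall n \near \oo, overlap_ratio n (y n) <= e.
Proof.
move=> y0 e0 /cvgryPge cv; near=> n.
have n0 : (0 < n)%N by near: n; exact: nbhs_infty_gt.
have h1 : 1 <= n%:R `^ (3 / 2) * y n by near: n; exact: cv.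
have h2 : 4 / e <= n%:R `^ (3 / 2) * y n by near: n; exact: cv.
have h3 : 2 / e <= n%:R by near: n; exact: nbhs_infty_ger.
apply: (le_trans (overlap_ratio_le n0 (y0 n) h1)).
set a := _ * y n in h1 h2 *.
have a0 : 0 < a by apply: lt_le_trans h1.
have n0R : 0 < n%:R :> R by rewrite ltr0n.
have g1 : 2 / a <= e / 2.
  by rewrite ler_pdivrMr// mulrC; move: h2; rewrite ler_pdivrMr//; lra.
have g2 : n%:R^-1 <= e / 2.
  rewrite -[n%:R^-1]mul1r ler_pdivrMr//; move: h3; rewrite ler_pdivrMr//; lra.
lra.
Unshelve. all: by end_near. Qed.

End overlap_asymptotics.

Lemma ecvg0 (R : realType) (u : nat -> \bar R) : (forall n, 0 <= u n)%E ->
  (forall e : R, 0 < e -> \forall n \near \oo, (u n <= e%:E)%E) -> u @ \oo --> 0%E.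
Proof.
move=> u0 h; apply/fine_cvgP; split.
  apply: filterS (h 1 ltr01) => n un.
  by rewrite ge0_fin_numE// (le_lt_trans un)// ltry.
apply/cvgrPdist_le => e e0; apply: filterS (h e e0) => n un.
have un' : u n \is a fin_num by rewrite ge0_fin_numE// (le_lt_trans un)// ltry.
by rewrite /= sub0r normrN ger0_norm ?fine_ge0// -lee_fin fineK.
Qed.

(** * Consistency *)

Section main.
Context (R : realType) (k : nat).
Notation d := k.+1.
Notation V := (d.-tuple R).
Notation mu := (leb R d).
Variables (f : V -> R) (r : nat -> R).
Context (d0 : measure_display) (T : measurableType d0) (P : probability T R).
Variable X : forall n : nat, 'I_n -> T -> V.
Variable Q : {sigma_finite_measure set V -> \bar R}.
Hypotheses (mf_ : measurable_fun setT f) (f0 : forall x, 0 <= f x).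
Hypothesis f1 : (\int[mu]_x (f x)%:E = 1)%E.
Hypothesis f5 : (\int[mu]_x (f x ^+ 5)%:E < +oo)%E.
Hypotheses (r0 : forall n, 0 < r n) (rcvg : r @ \oo --> 0).
Hypothesis rd : (fun n : nat => n%:R `^ (3 / 2 : R) * r n ^+ d) @ \oo --> +oo.
Hypothesis QE : forall B, measurable B -> Q B = (\int[mu]_x (f x * \1_B x)%:E)%E.
Hypothesis mX : forall n (i : 'I_n), measurable_fun setT (X i).
Hypothesis PX : forall n (i : 'I_n) B, measurable B -> P (X i @^-1` B) = Q B.
Hypothesis indep : forall n (B : 'I_n -> set V), (forall i, measurable (B i)) ->
  P [set w | forall i, B i (X i w)] = (\prod_(i < n) P (X i @^-1` B i))%E.

Let Q1 : Q setT = 1%E.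
Proof.
by rewrite QE// -f1; apply: eq_integral => x _; rewrite indicT mulr1.
Qed.

(** The 1 is the integral of [f]; by [power_le_1_5] this single constant bounds the moments of order
    1 to 5. *)
Let F : R := 1 + fine (\int[mu]_x (f x ^+ 5)%:E)%E.

Let F0 : 0 <= F.
Proof.
by rewrite addr_ge0// fine_ge0//; apply: integral_ge0 => x _; rewrite lee_fin exprn_ge0.
Qed.

Lemma moment_le j : (0 < j <= 5)%N -> (\int[mu]_x (f x ^+ j)%:E <= F%:E)%E.
Proof.
move=> j5.
have mj i : measurable_fun setT (fun x => (f x ^+ i)%:E).
  by apply/measurable_EFinP; exact: measurable_funX.
have m1 : measurable_fun setT (fun x => (f x)%:E) by exact/measurable_EFinP.
apply: (@le_trans _ _ (\int[mu]_x ((f x)%:E + (f x ^+ 5)%:E))%E).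
  apply: ge0_le_integral => //.
  - by move=> x _; rewrite lee_fin exprn_ge0.
  - exact: emeasurable_funD.
  - by move=> x _; rewrite -EFinD lee_fin power_le_1_5.
rewrite ge0_integralD//; first last.
- by move=> x _; rewrite lee_fin exprn_ge0.
- by move=> x _; rewrite lee_fin.
rewrite f1 /F EFinD fineK// ge0_fin_numE//.
by apply: integral_ge0 => x _; rewrite lee_fin exprn_ge0.
Qed.

Lemma moment_fin j : (0 < j <= 5)%N ->
  exists2 I : R, (\int[mu]_x (f x ^+ j)%:E = I%:E)%E & 0 <= I <= F.
Proof.
move=> j5; have le := moment_le j5.
have ge : (0 <= \int[mu]_x (f x ^+ j)%:E)%E.
  by apply: integral_ge0 => x _; rewrite lee_fin exprn_ge0.
have fn : (\int[mu]_x (f x ^+ j)%:E)%E \is a fin_num.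
  by rewrite ge0_fin_numE// (le_lt_trans le)// ltry.
exists (fine (\int[mu]_x (f x ^+ j)%:E)%E); first by rewrite fineK.
by rewrite fine_ge0//= -lee_fin fineK.
Qed.

(** A vanishing third moment would force [f] to be zero almost everywhere, against total mass 1.
    Positivity gives the expected counts their exact order. *)
Lemma cube_moment_gt0 I : (\int[mu]_x (f x ^+ 3)%:E = I%:E)%E -> 0 < I.
Proof.
move=> IE.
have I0 : 0 <= I.
  by rewrite -lee_fin -IE; apply: integral_ge0 => x _; rewrite lee_fin exprn_ge0.
rewrite lt_neqAle I0 andbT; apply/eqP => I00; subst I.
have m3 : measurable_fun setT (fun x => (f x ^+ 3)%:E).
  by apply/measurable_EFinP; exact: measurable_funX.
have m1 : measurable_fun setT (fun x => (f x)%:E) by exact/measurable_EFinP.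
have ae0 : ae_eq mu setT (fun x => (f x ^+ 3)%:E) (cst 0%E).
  apply/(ae_eq_integral_abs mu measurableT m3).
  rewrite -[RHS]IE; apply: eq_integral => x _; rewrite gee0_abs// lee_fin exprn_ge0//.
have : (\int[mu]_x (f x)%:E = 0)%E.
  rewrite -[RHS](integral0 mu setT).
  apply: ge0_ae_eq_integral => //; first by move=> x _; rewrite lee_fin.
  apply: filterS ae0 => x h Dx; have /eqP := h Dx.
  by rewrite eqe expf_eq0/= => /eqP ->.
by rewrite f1 => /eqP; rewrite onee_eq0.
Qed.

Let b : R := 2 ^+ d * fine (ballvol d 1 : \bar R).

Let bvolE n : bvol d (2 * r n) = b * r n ^+ d.
Proof. by rewrite /bvol /b exprMn mulrAC. Qed.

Let bvol0 n : 0 < bvol d (2 * r n).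
Proof.
rewrite bvolE; apply: mulr_gt0; last by rewrite exprn_gt0.
by rewrite mulr_gt0 ?exprn_gt0// ballvol_gt0.
Qed.

Lemma star_prob_bound n j : (1 < j < 5)%N ->
  (star_prob Q (2 * r n)%R j <= ((b * r n ^+ d) ^+ j * (F + F))%:E)%E.
Proof.
move=> /andP[j1 j5].
have [I IE /andP[I0 IF]] := @moment_fin j.+1 j5.
have r20 : 0 < 2 * r n by rewrite mulr_gt0.
apply: (le_trans (star_prob_le mf_ f0 QE Q1 r20 (bvol0 n) IE)).
rewrite lee_fin bvolE ler_wpM2l ?lerD//.
by rewrite -bvolE exprn_ge0// ltW.
Qed.

Lemma concentration n (E : V -> V -> V -> bool) (a : R) : meas3 E ->
  (forall x, set3 E x -> forall i j, cball (2 * r n) (tnth x i) (tnth x j)) -> 0 < a ->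
  (P [set w | a <= `|count_events R (fun t : 3.-tuple 'I_n => uniq t)
        (triple_event (@X n) (set3 E)) w -
      (#|[set t : 3.-tuple 'I_n | uniq t]%SET|)%:R * fine (int3 Q E)|]%R <=
   (overlap_bound n (fun j => (b * r n ^+ d) ^+ j * (F + F)) / a ^+ 2)%:E)%E.
Proof.
move=> mE Ec a0; rewrite -powm_set3//.
apply: (count_concentration (@mX n) (@PX n) (@indep n) Q1 (measurable_set3 mE) Ec) => //.
- by move=> j; apply: mulr_ge0; [apply: exprn_ge0; rewrite -bvolE ltW|exact: addr_ge0].
- by move=> j j5; exact: star_prob_bound.
Qed.

Lemma estimator_consistent (eps : R) : 0 < eps ->
  (fun n : nat => P [set w | eps <
     `| dim_estimator R (rgg_adj (fun i => X i w) (r n) : 'M[bool]_n) - d%:R |]) @ \oo --> 0%E.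
Proof.
move=> eps0.
have [I IE _] := @moment_fin 3 isT.
have I0 := cube_moment_gt0 IE.
pose al := alpha R k.
have al0 : 0 <= al by exact: alpha_ge0.
pose W := cherry_const R d.
have W0 : 0 < W by exact: cherry_const_gt0.
have al3 : 0 < 2 * (1 + 3 * al) by rewrite mulr_gt0// ltr_wpDr// mulr_ge0.
(* Small enough for [ratio_close], and such that the error it yields stays within the window of
   [al]. *)
pose eta := Num.min 2^-1 (gap R k / (2 * (1 + 3 * al))).
have eta0 : 0 < eta by rewrite lt_min invr_gt0 ltr0n /= divr_gt0// gap_gt0.
have eta2 : eta <= 2^-1 by rewrite ge_min lexx.
have eta_gap : 2 * eta * (1 + 3 * al) <= gap R k.
  have : eta <= gap R k / (2 * (1 + 3 * al)) by rewrite ge_min lexx orbT.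
  by rewrite ler_pdivlMr//; lra.
pose e := eta * I.
have e0 : 0 < e by rewrite mulr_gt0.
have eI2 : e <= 2^-1 * I by rewrite ler_wpM2r// ltW.
have eI : e <= I by lra.
have [del del0 Hdel] := int3_asymp mf_ f0 QE IE e0 eI.
pose S := b ^+ 2 + b ^+ 3 + b ^+ 4.
have b0 : 0 < b by rewrite mulr_gt0 ?exprn_gt0// ballvol_gt0.
have S0 : 0 < S by rewrite !addr_gt0// exprn_gt0.
have FF0 : 0 <= F + F by exact: addr_ge0.
have [A A0 OBA] : exists2 A : R, 0 <= A & forall (n : nat) (y : R), 0 < y ->
    overlap_bound n (fun j => (b * y) ^+ j * (F + F)) <=
    A * (n%:R ^+ 3 * y ^+ 2 + n%:R ^+ 4 * y ^+ 3 + n%:R ^+ 5 * y ^+ 4).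
  exists ((5 ^ 6)%:R * (F + F) * S).
    by apply: mulr_ge0 (ltW S0); apply: mulr_ge0 FF0; exact: ler0n.
  by move=> n y y0; exact: overlap_boundE (ltW b0) FF0 y0.
(* Makes the deviation [a] at least [eta' * n^3 y^2]: 27 comes from the number of triples, and 1/2
   from [I - e >= I / 2]. *)
pose eta' := eta / 27 * (2^-1 * I * W).
have eta'0 : 0 < eta' by rewrite /eta'; apply: mulr_gt0; [rewrite divr_gt0|apply: mulr_gt0 W0; apply: mulr_gt0 I0; rewrite invr_gt0].
(* The 2 accounts for the two failure events, one for each count; the 1 ensures positivity. *)
pose C := 2 * (A / eta' ^+ 2) + 1.
have C0 : 0 < C by rewrite ltr_wpDl// mulr_ge0// divr_ge0// sqr_ge0.
have yp n : 0 < r n ^+ d by rewrite exprn_gt0.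
apply: ecvg0 => // e1 e10.
have rsmall : \forall n \near \oo, r n <= del.
  move/cvgrPdist_le : rcvg => /(_ _ del0); apply: filterS => n /=.
  by rewrite sub0r normrN gtr0_norm.
have e1C : 0 < e1 / C by rewrite divr_gt0.
near=> n.
have n2 : (2 < n)%N by near: n; exact: nbhs_infty_gt.
have rn : 0 < r n <= del by rewrite r0/=; near: n.
have on : overlap_ratio n (r n ^+ d) <= e1 / C.
  by near: n; exact: overlap_ratio_small.
pose y := r n ^+ d; have y0 : 0 < y by exact: yp.
have n0 : 0 < n%:R :> R by rewrite ltr0n; exact: ltn_trans n2.
pose c := fine (int3 Q (cherry (r n))).
pose t := fine (int3 Q (triangle (r n))).
have small_K (u v : V) : Kcherry u v -> small 1 u /\ small 1 v.
  by move=> /andP[u1 v1]; split; exact: small_nrm2.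
have [c1 c2] := Hdel _ rn _ _ (meas3_cherry (r n)) (@meas2_Kcherry R d)
  (fun x u v => cherryK (r0 n) x u v) small_K.
have small_K' (u v : V) : Ktriangle u v -> small 1 u /\ small 1 v.
  by move=> /andP[u1 /andP[v1 _]]; split; exact: small_nrm2.
have [t1 t2] := Hdel _ rn _ _ (meas3_triangle (r n)) (@meas2_Ktriangle R d)
  (fun x u v => triangleK (r0 n) x u v) small_K'.
rewrite integral_Kcherry cherryvol_const -/W -EFinM -/y in c1 c2.
rewrite integral_Ktriangle trivol_const -/al -/W -EFinM -/y in t1 t2.
have fin E : (0 <= int3 Q E)%E.
  by apply: integral_ge0 => x _; apply: integral_ge0 => ? _; apply: integral_ge0 => ? _; exact: ib_ge0.
have finE E (x : R) : (int3 Q E <= x%:E)%E -> int3 Q E = (fine (int3 Q E))%:E.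
  move=> le; rewrite fineK// ge0_fin_numE; last exact: fin.
  exact: le_lt_trans le (ltry x).
have cE : int3 Q (cherry (r n)) = c%:E by exact: finE c2.
have tE : int3 Q (triangle (r n)) = t%:E by exact: finE t2.
rewrite cE !lee_fin in c1 c2; rewrite tE !lee_fin in t1 t2.
pose K : R := (#|[set s : 3.-tuple 'I_n | uniq s]%SET|)%:R.
have KE : n%:R ^+ 3 / 27 <= K by exact: card_uniq3_ge.
have n3 : 0 < n%:R ^+ 3 :> R by rewrite exprn_gt0.
have K0 : 0 < K by apply: lt_le_trans KE; rewrite divr_gt0.
have y2 : 0 < y * y by rewrite mulr_gt0.
have clow : y * y * (2^-1 * I * W) <= c.
  apply: le_trans c1; rewrite -[leRHS]mulrA; apply: ler_wpM2l; first exact: ltW.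
  by apply: ler_wpM2r; [exact: ltW|lra].
have p0 : 0 < 2^-1 * I * W.
  by apply: mulr_gt0 W0; apply: mulr_gt0 I0; rewrite invr_gt0.
have c0 : 0 < c by apply: lt_le_trans clow; exact: mulr_gt0.
(* Both [t] and [al * c] lie between [al * y^2 * (I - e) * W] and [al * y^2 * I * W]. With
   [e = eta * I] the length of this range is at most [2 * al * eta * c], by [clow]. *)
have close : `|t - al * c| <= 2 * al * eta * c.
  move: (al) (c) (t) (W) (y) al0 c1 c2 t1 t2 clow; rewrite /e => al' c' t' W' y' al0' c1' c2' t1' t2' clow'.
  have h1 := ler_wpM2l al0' c1'; have h2 := ler_wpM2l al0' c2'.
  have ae0 : 0 <= 2 * al' * eta by rewrite !mulr_ge0// ltW.
  have h3 := ler_wpM2l ae0 clow'.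
  rewrite ler_norml; apply/andP; split; lra.
pose a := eta * (K * c).
have a0 : 0 < a by rewrite !mulr_gt0.
pose OB := overlap_bound n (fun j => (b * y) ^+ j * (F + F)).
pose N E w : R := count_events R (fun s : 3.-tuple 'I_n => uniq s) (triple_event (@X n) (set3 E)) w.
pose BC : set T := [set w | a <= `|N (cherry (r n)) w - K * c|].
pose BT : set T := [set w | a <= `|N (triangle (r n)) w - K * t|].
have PC : (P BC <= (OB / a ^+ 2)%:E)%E.
  exact: (concentration (meas3_cherry (r n)) (@cherry_close R d (r n)) a0).
have PT : (P BT <= (OB / a ^+ 2)%:E)%E.
  exact: (concentration (meas3_triangle (r n)) (@triangle_close R d (r n)) a0).
have mN E (x : R) : meas3 E -> measurable_fun setT (fun w => `|N E w - x|).
  move=> mE; apply: measurableT_comp => //; apply: measurable_funB => //.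
  apply: measurable_count_events => s; apply: measurable_triple_event; last exact: measurable_set3.
  exact: mX.
have mlev (g : T -> R) : measurable_fun setT g -> measurable [set w | a <= g w].
  move=> mg; rewrite (_ : [set w | _] = setT `&` g @^-1` `[a, +oo[%classic).
    by apply: mg => //; exact: measurable_itv.
  by rewrite setTI set_itvE.
have mBC : measurable BC by apply: mlev; apply: mN; exact: meas3_cherry.
have mBT : measurable BT by apply: mlev; apply: mN; exact: meas3_triangle.
have mU := measurableU _ _ mBC mBT.
have mev : measurable [set w | eps <
    `| dim_estimator R (rgg_adj (fun i => X i w) (r n) : 'M[bool]_n) - d%:R |].
  exact: (measurable_rgg_event (fun M : 'M[bool]_n => eps < `|dim_estimator R M - d%:R|) (r0 n) (@mX n)).
apply: (@le_trans _ _ (P (BC `|` BT))).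
  apply: le_measure; [exact: mem_set mev|exact: mem_set mU|].
  (* When both counts are close to their means the estimator equals [d] exactly, so the deviation is
     0 and cannot exceed [eps]. *)
  move=> w ev; apply: contrapT => /not_orP[nC nT].
  have hC : `|cherry_count R (rgg_adj (fun i => @X n i w) (r n)) - K * c| < eta * (K * c).
    by rewrite (cherry_countE (r0 n) (@X n) w) ltNge; apply/negP => h; exact: (nC h).
  have hT : `|triangle_count R (rgg_adj (fun i => @X n i w) (r n)) - K * t| < eta * (K * c).
    by rewrite (triangle_countE (r0 n) (@X n) w) ltNge; apply/negP => h; exact: (nT h).
  have := ratio_close al0 eta0 eta2 K0 c0 close hC hT.
  move=> /lt_le_trans /(_ eta_gap) /dim_of_ratioE dE.
  have dD : dim_estimator R (rgg_adj (fun i => @X n i w) (r n)) = d%:R by rewrite /dim_estimator dE.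
  have : eps < `|dim_estimator R (rgg_adj (fun i => @X n i w) (r n)) - d%:R| by exact: ev.
  by rewrite dD subrr normr0 => /(lt_trans eps0); rewrite ltxx.
have hU : (P (BC `|` BT) <= P BC + P BT)%E := measureU2 _ mBC mBT.
apply: (le_trans hU); apply: (le_trans (leeD PC PT)); rewrite -EFinD lee_fin.
have OBE : OB <= A * (n%:R ^+ 3 * y ^+ 2 + n%:R ^+ 4 * y ^+ 3 + n%:R ^+ 5 * y ^+ 4).
  exact: OBA.
have alow : eta' * (n%:R ^+ 3 * y ^+ 2) <= a.
  have -> : eta' * (n%:R ^+ 3 * y ^+ 2) = eta * ((n%:R ^+ 3 / 27) * (y * y * (2^-1 * I * W))).
    by rewrite /eta'; ring.
  apply: ler_wpM2l; first exact: ltW.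
  by apply: ler_pM => //; apply: ltW; (exact: mulr_gt0 || exact: divr_gt0).
have ny : 0 < n%:R ^+ 3 * y ^+ 2 by rewrite mulr_gt0 ?exprn_gt0.
have a2 : eta' ^+ 2 * (n%:R ^+ 6 * y ^+ 4) <= a ^+ 2.
  have -> : eta' ^+ 2 * (n%:R ^+ 6 * y ^+ 4) = (eta' * (n%:R ^+ 3 * y ^+ 2)) ^+ 2 by ring.
  by rewrite lerXn2r ?nnegrE// ?(ltW a0)// mulr_ge0// ltW.
have ny6 : 0 < n%:R ^+ 6 * y ^+ 4 by rewrite mulr_gt0 ?exprn_gt0.
have or0 : 0 <= overlap_ratio n y.
  apply: divr_ge0 (ltW ny6).
  by apply: addr_ge0; [apply: addr_ge0|]; apply: mulr_ge0; apply: exprn_ge0; exact: ltW.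
have Aor0 : 0 <= A / eta' ^+ 2 * overlap_ratio n y.
  by apply: mulr_ge0 or0; apply: divr_ge0 A0 _; exact: sqr_ge0.
have yn : y != 0 by rewrite gt_eqF.
have nn : n%:R != 0 :> R by rewrite gt_eqF.
have en : eta' != 0 by rewrite gt_eqF.
have hmain : OB / a ^+ 2 <= A / eta' ^+ 2 * overlap_ratio n y.
  rewrite ler_pdivrMr; last exact: exprn_gt0.
  apply: (le_trans OBE); apply: le_trans (ler_wpM2l Aor0 a2).
  rewrite le_eqVlt; apply/orP; left; apply/eqP.
  move: (eta') en => h hn; rewrite /overlap_ratio; field.
  by rewrite yn nn hn.
have AC : 2 * (A / eta' ^+ 2) <= C by rewrite lerDl.
have CE : C * (e1 / C) = e1 by rewrite mulrC divfK// gt_eqF.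
have h1 := ler_wpM2r or0 AC; have := ler_wpM2l (ltW C0) on.
rewrite CE; move: h1 hmain; rewrite -/y; lra.
Unshelve. all: by end_near. Qed.

End main.

Theorem theorem1 (R : realType) :
  exists Delta : forall n : nat, 'M[bool]_n -> R,
  forall (d : nat) (f : d.-tuple R -> R) (r : nat -> R)
    (d0 : measure_display) (T : measurableType d0) (P : probability T R)
    (X : forall n : nat, 'I_n -> T -> d.-tuple R),
    (0 < d)%N ->
    is_density f ->
    (int_Rd (fun x => (f x ^+ 5)%:E) < +oo)%E ->
    (forall n, 0 < r n) ->
    r @ \oo --> 0 ->
    (fun n : nat => n%:R `^ (3 / 2 : R) * r n ^+ d) @ \oo --> +oo ->
    (forall n (i : 'I_n), has_density P (X n i) f) ->
    (forall n, mutually_independent P (X n)) ->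
    forall eps : R, 0 < eps ->
      (fun n : nat =>
         P [set w | eps < `| Delta n (rgg_adj (fun i => X n i w) (r n)) - d%:R |])
        @ \oo --> 0%E.
Proof.
exists (@dim_estimator R) => -[//|k] f r d0 T P X _ [mf_ [f0 f1]] f5 r0 rcvg rd hX indep eps eps0.
have mX n i : measurable_fun setT (X n i) by have [] := hX n i.
(* The common law [Q] is taken to be the distribution of one sample point, which is already a
   probability measure; every other point has the same density, hence the same law. *)
pose X1 : {mfun T >-> k.+1.-tuple R} :=
  HB.pack (X 1%N ord0) (isMeasurableFun.Build _ _ _ _ _ (mX 1%N ord0)).
have mj j : measurable_fun setT (fun x : k.+1.-tuple R => (f x ^+ j)%:E).
  by apply/measurable_EFinP; exact: measurable_funX.
have fB B : measurable B -> int_Rd (fun x => (f x * \1_B x)%:E) =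
    (\int[leb R k.+1]_x (f x * \1_B x)%:E)%E.
  move=> mB; rewrite int_RdE//; last by move=> x; rewrite lee_fin mulr_ge0.
  by apply/measurable_EFinP; apply: measurable_funM => //; exact: measurable_indic.
apply: (@estimator_consistent R k f r d0 T P X (distribution P X1)) => //.
- by rewrite -f1 int_RdE//; apply/measurable_EFinP.
- have f50 x : (0 <= (f x ^+ 5)%:E)%E by rewrite lee_fin exprn_ge0.
  by rewrite (int_RdE (mj 5) f50) in f5.
- by move=> B mB; rewrite -fB//; have [_ hB] := hX 1%N ord0; exact: hB.
- move=> n i B mB; have [_ h1] := hX n i; have [_ h2] := hX 1%N ord0.
  exact: etrans (h1 B mB) (esym (h2 B mB)).
Qed.
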